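(* Let $v\in\mathbb{R}$ and let $\mathcal{G}_D(v)$ be the germ at speed $v$ associated with the drag force $D$. Suppose that $((\rho_-,q_-),(\rho_+,q_+))$ belongs to $\mathcal{G}_D(v)$. Then for every $\varepsilon>0$ and every admissible regularization $H^\varepsilon$ of the Heaviside function, there exists a piecewise $\mathcal{C}^1$ entropy solution $(\rho^\varepsilon,q^\varepsilon)$ of $$\begin{cases}\partial_t\rho^\varepsilon+\partial_x q^\varepsilon=0,\\ \partial_t q^\varepsilon+\partial_x\left(\frac{(q^\varepsilon)^2}{\rho^\varepsilon}+c^2\rho^\varepsilon\right)=-D(\rho^\varepsilon,q^\varepsilon-v\rho^\varepsilon)\,(H^\varepsilon)'(x-vt),\end{cases}$$ depending only on $\xi=x-vt\in[-\varepsilon/2,\varepsilon/2]$, such that $(\rho^\varepsilon(-\varepsilon/2),q^\varepsilon(-\varepsilon/2))=(\rho_-,q_-)$ and $(\rho^\varepsilon(\varepsilon/2),q^\varepsilon(\varepsilon/2))=(\rho_+,q_+)$. Conversely, if $(\rho_-,q_-)$ and $(\rho_+,q_+)$ are the values at $-\varepsilon/2$ and $\varepsilon/2$ of such a solution, then $((\rho_-,q_-),(\rho_+,q_+))\in\mathcal{G}_D(v)$.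
   Context: $c>0$ is a fixed constant. The drag force $D:\mathbb{R}_+^*\times\mathbb{R}\to\mathbb{R}$ is continuous and has the same sign as its second argument: $D(\rho,\alpha)>0$ if $\alpha>0$, $D(\rho,\alpha)<0$ if $\alpha<0$, $D(\rho,0)=0$. Admissible regularization: $H^\varepsilon\in\mathcal{C}^0(\mathbb{R})\cap\mathcal{C}^1((-\varepsilon/2,\varepsilon/2))$, $H^\varepsilon$ is nondecreasing, $H^\varepsilon(x)=0$ for $x\le-\varepsilon/2$ and $H^\varepsilon(x)=1$ for $x\ge\varepsilon/2$. Densities are positive. Solutions are understood in the weak sense; ''piecewise $\mathcal{C}^1$'' means that $[-\varepsilon/2,\varepsilon/2]$ splits into finitely many intervals in whose interiors the solution is $\mathcal{C}^1$, with one-sided limits at the breakpoints. ''Entropy solution'' means that each discontinuity is an entropy satisfying shock (of speed $v$) for the isothermal Euler equations $\partial_t\rho+\partial_x q=0$, $\partial_t q+\partial_x(q^2/\rho+c^2\rho)=0$. A shock is allowed to sit at an end $\xi=\pm\varepsilon/2$; the value at that end is then the state on the outer side of the shock. For $\alpha\neq 0$ let $F_\alpha(\rho)=\int_{|\alpha|/c}^{\rho}\frac{1}{|D(r,\alpha)|}\left(c^2-\frac{\alpha^2}{r^2}\right)dr$. Germ. $\mathcal{G}_D(v)$ is the set of pairs $((\rho_-,q_-),(\rho_+,q_+))\in(\mathbb{R}_+^*\times\mathbb{R})^2$ such that $q_--v\rho_-=q_+-v\rho_+=:\alpha$ and one of the following holds: - $\alpha=0$, $\rho_-=\rho_+$ and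 $q_-=q_+$; - $\alpha>0$, $(\frac{\alpha}{c}-\rho_+)(\frac{\alpha}{c}-\rho_-)\ge0$ and $F_\alpha(\rho_-)-F_\alpha(\rho_+)=1$; - $\alpha<0$, $(\frac{|\alpha|}{c}-\rho_+)(\frac{|\alpha|}{c}-\rho_-)\ge0$ and $F_\alpha(\rho_+)-F_\alpha(\rho_-)=1$; - $c\rho_-<\alpha$, $\rho_+\ge\frac{\alpha}{c}$ and there exist $\rho\in[\rho_-,\frac{\alpha}{c})$ and $\theta\in[0,1]$ with $F_\alpha(\rho_-)-F_\alpha(\rho)=\theta$ and $F_\alpha\left(\frac{\alpha^2}{c^2\rho}\right)-F_\alpha(\rho_+)=1-\theta$; - $\alpha<-c\rho_+$, $\rho_-\ge\frac{|\alpha|}{c}$ and there exist $\rho\in[\rho_+,\frac{|\alpha|}{c})$ and $\theta\in[0,1]$ with $F_\alpha(\rho_+)-F_\alpha(\rho)=\theta$ and $F_\alpha\left(\frac{\alpha^2}{c^2\rho}\right)-F_\alpha(\rho_-)=1-\theta$. *)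

(* Defs.v *)
From HB Require Import structures.
From mathcomp Require Import all_boot all_order all_algebra.
From mathcomp Require Import all_classical all_reals all_analysis.
Set Implicit Arguments.
Unset Strict Implicit.
Unset Printing Implicit Defensive.
Import Order.TTheory GRing.Theory Num.Theory.
Import numFieldNormedType.Exports.
Local Open Scope classical_set_scope.
Local Open Scope ring_scope.

(* [D rho alpha] only matters for [0 < rho]; continuity is joint. *)
Definition drag_force (R : realType) (D : R -> R -> R) : Prop :=
  [/\ forall p : R * R, 0 < p.1 -> {for p, continuous (fun p => D p.1 p.2)},
      forall rho alpha, 0 < rho -> 0 < alpha -> 0 < D rho alpha,
      forall rho alpha, 0 < rho -> alpha < 0 -> D rho alpha < 0 &
      forall rho, 0 < rho -> D rho 0 = 0].

Definition C1_itv (R : realType) (a b : R) (f : R -> R) : Prop :=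
  {in `]a, b[, forall x, derivable f x 1} /\ {in `]a, b[, continuous (derive1 f)}.

(* No bound on [derive1 H] near [- eps / 2] and [eps / 2] is assumed. *)
Definition admissible_regularization (R : realType) (eps : R) (H : R -> R) :
    Prop :=
  [/\ continuous H,
      C1_itv (- eps / 2) (eps / 2) H,
      {homo H : x y / x <= y},
      forall x, x <= - eps / 2 -> H x = 0 &
      forall x, eps / 2 <= x -> H x = 1].

(* States are pairs (density, momentum). *)

Definition flux (R : realType) (c : R) (U : R * R) : R :=
  U.2 ^+ 2 / U.1 + c ^+ 2 * U.1.

(* Mechanical energy and its flux, the physical entropy pair of the isothermal
   Euler equations with pressure [c ^+ 2 * rho]. *)
Definition energy (R : realType) (c : R) (U : R * R) : R :=
  U.2 ^+ 2 / (2 * U.1) + c ^+ 2 * (U.1 * ln U.1).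

Definition energy_flux (R : realType) (c : R) (U : R * R) : R :=
  U.2 / U.1 * (energy c U + c ^+ 2 * U.1).

(* Rankine-Hugoniot relations and entropy inequality across a discontinuity of
   speed [v], [Ul] being the state at smaller [x]. *)
Definition entropy_shock (R : realType) (c v : R) (Ul Ur : R * R) : Prop :=
  [/\ Ul <> Ur /\ 0 < Ul.1 /\ 0 < Ur.1,
      Ur.2 - Ul.2 = v * (Ur.1 - Ul.1),
      flux c Ur - flux c Ul = v * (Ur.2 - Ul.2) &
      energy_flux c Ur - energy_flux c Ul <= v * (energy c Ur - energy c Ul)].

Definition left_limit (R : realType) (rho q : R -> R) (xi : R) : R * R :=
  (lim (rho x @[x --> xi^'-]), lim (q x @[x --> xi^'-])).

Definition right_limit (R : realType) (rho q : R -> R) (xi : R) : R * R :=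
  (lim (rho x @[x --> xi^'+]), lim (q x @[x --> xi^'+])).

(* [itv_partition a b s] says that [a :: s] is increasing with last element
   [b].  The values at the breakpoints are unconstrained. *)
Definition C1_on_pieces (R : realType) (a b : R) (s : seq R) (f : R -> R) :
    Prop :=
  forall i, (i < size s)%N ->
    let l := nth b (a :: s) i in
    let r := nth b s i in
    [/\ C1_itv l r f, cvg (f x @[x --> l^'+]) & cvg (f x @[x --> r^'-])].

Definition piecewise_C1 (R : realType) (a b : R) (rho q : R -> R) : Prop :=
  exists s : seq R,
    [/\ itv_partition a b s, C1_on_pieces a b s rho & C1_on_pieces a b s q].

(* Points of the space-time plane are pairs (t, x). *)

Definition strip (R : realType) (v eps : R) : set (R * R) :=
  [set p | - eps / 2 < p.2 - v * p.1 < eps / 2].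

Definition dt (R : realType) (phi : R * R -> R) (p : R * R) : R :=
  'D_((1 : R), (0 : R)) phi p.

Definition dx (R : realType) (phi : R * R -> R) (p : R * R) : R :=
  'D_((0 : R), (1 : R)) phi p.

Definition test_function (R : realType) (Omega : set (R * R))
    (phi : R * R -> R) : Prop :=
  [/\ continuous phi,
      forall p, derivable phi p ((1 : R), (0 : R)) /\
                derivable phi p ((0 : R), (1 : R)),
      continuous (dt phi) /\ continuous (dx phi),
      compact (closure [set p | phi p != 0]) &
      closure [set p | phi p != 0] `<=` Omega].

(* [u], [f] and [S] are functions of the two variables (t, x). *)
Definition weak_balance_law (R : realType) (Omega : set (R * R))
    (u f S : R * R -> R) : Prop :=
  forall phi, test_function Omega phi ->
    \int[(lebesgue_measure \x lebesgue_measure)%E]_(p in Omega)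
      (u p * dt phi p + f p * dx phi p + S p * phi p) = 0 :> R.

(* The source terms are [0] and [- D(rho, q - v rho) H'(x - v t)], and
   [rho], [q] depend on (t, x) through [x - v * t] only. *)
Definition weak_wave (R : realType) (c : R) (D : R -> R -> R) (v eps : R)
    (H rho q : R -> R) : Prop :=
  let xi (p : R * R) := p.2 - v * p.1 in
  weak_balance_law (strip v eps)
    (fun p => rho (xi p)) (fun p => q (xi p)) (fun=> 0) /\
  weak_balance_law (strip v eps)
    (fun p => q (xi p)) (fun p => flux c (rho (xi p), q (xi p)))
    (fun p => - (D (rho (xi p)) (q (xi p) - v * rho (xi p)) * derive1 H (xi p))).

Definition continuous_or_shock (R : realType) (c v : R) (Ul Ur : R * R) :
    Prop :=
  Ul = Ur \/ entropy_shock c v Ul Ur.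

(* At an end of [- eps / 2, eps / 2] the value of the solution plays the role
   of the state on the outer side.  Densities are positive at every point and
   in the one-sided limits. *)
Definition entropy_wave (R : realType) (c : R) (D : R -> R -> R) (v eps : R)
    (H rho q : R -> R) : Prop :=
  let a := - eps / 2 in
  let b := eps / 2 in
  [/\ [/\ {in `[a, b], forall xi, 0 < rho xi},
          {in `[a, b[, forall xi, 0 < (right_limit rho q xi).1} &
          {in `]a, b], forall xi, 0 < (left_limit rho q xi).1}],
      piecewise_C1 a b rho q,
      weak_wave c D v eps H rho q,
      {in `]a, b[, forall xi,
        continuous_or_shock c v (left_limit rho q xi) (right_limit rho q xi)} &
      continuous_or_shock c v (rho a, q a) (right_limit rho q a) /\
      continuous_or_shock c v (left_limit rho q b) (rho b, q b)].

Definition oriented_integral (R : realType) (f : R -> R) (a b : R) : R :=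
  if a <= b then \int[lebesgue_measure]_(x in `[a, b]) f x
  else - \int[lebesgue_measure]_(x in `[b, a]) f x.

Definition Ffun (R : realType) (c : R) (D : R -> R -> R) (alpha rho : R) : R :=
  oriented_integral
    (fun r => 1 / `|D r alpha| * (c ^+ 2 - alpha ^+ 2 / r ^+ 2))
    (`|alpha| / c) rho.

Definition germ (R : realType) (c : R) (D : R -> R -> R) (v : R) :
    set ((R * R) * (R * R)) :=
  [set U | let rhom := U.1.1 in let qm := U.1.2 in
           let rhop := U.2.1 in let qp := U.2.2 in
           let alpha := qm - v * rhom in
           let F := Ffun c D alpha in
    [/\ 0 < rhom, 0 < rhop, alpha = qp - v * rhop &
     [\/ [/\ alpha = 0, rhom = rhop & qm = qp]
      , [/\ 0 < alpha,
            0 <= (alpha / c - rhop) * (alpha / c - rhom) &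
            F rhom - F rhop = 1]
      , [/\ alpha < 0,
            0 <= (`|alpha| / c - rhop) * (`|alpha| / c - rhom) &
            F rhop - F rhom = 1]
      | [/\ c * rhom < alpha, alpha / c <= rhop &
            exists rho theta : R,
              [/\ rhom <= rho < alpha / c, 0 <= theta <= 1,
                  F rhom - F rho = theta &
                  F (alpha ^+ 2 / (c ^+ 2 * rho)) - F rhop = 1 - theta]]
        \/
        [/\ alpha < - (c * rhop), `|alpha| / c <= rhom &
            exists rho theta : R,
              [/\ rhop <= rho < `|alpha| / c, 0 <= theta <= 1,
                  F rhop - F rho = theta &
                  F (alpha ^+ 2 / (c ^+ 2 * rho)) - F rhom = 1 - theta]]]]].

(* Main.v *)
Require Import Defs.
From HB Require Import structures.
From mathcomp Require Import all_boot all_order all_algebra.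
From mathcomp Require Import ring lra.
From mathcomp Require Import all_classical all_reals all_analysis.
From mathcomp Require Import measurable_realfun.
Set Implicit Arguments.
Unset Strict Implicit.
Unset Printing Implicit Defensive.
Import Order.TTheory GRing.Theory Num.Theory.
Import numFieldNormedType.Exports.
Local Open Scope classical_set_scope.
Local Open Scope ring_scope.

(** The idea.

Reduction to one variable.  For functions of [xi = x - v t], the shear
[(t, xi) |-> (t, xi + v t)] and Fubini's theorem turn a weak balance law with
density [u], flux [f] and source [S] into a statement about [f - v u], the flux
relative to the moving frame: off the breakpoints its derivative is [S], and it
does not jump ([weak_form_reduction], [weak_balance_of_FTC],
[strong_of_weak]).  For the mass equation this says that
[alpha = q - v rho] is constant.  Then [q = alpha + v rho], the relative
momentum flux is [alpha^2 / rho + c^2 rho] up to a constant, and the momentum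
equation becomes

  [(c^2 - alpha^2 / rho^2) rho' = - D(rho, alpha) H'].

Across a discontinuity from [l] to [r] the Rankine-Hugoniot relations reduce to
[l r = (alpha / c)^2].  The entropy production is then [c^2 alpha B] with
[B = (l / r - r / l) / 2 + ln (r / l)], which has the sign of [l - r] because
[ln x < (x - 1 / x) / 2] for [x > 1].  So the entropy inequality says that
[alpha (r - l) > 0]: the density increases in the direction of the flow
([continuous_or_shockP]).  The record [wave_profile] states this reduced
problem, and [profile_entropy_wave] and [entropy_wave_profile] are the two
halves of its equivalence with the original one.

The potential.  Let [alpha > 0].  By its definition [F = F_alpha] has derivative
[(c^2 - alpha^2 / r^2) / D(r, alpha)], so [F(rho) + H] is constant along every
smooth arc.  [F] decreases up to the sonic density [s = alpha / c], increases
after it, and vanishes at [s].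

Every wave satisfies the germ condition ([profile_connection]).  As [H] is
nondecreasing, [F(rho)] is nonincreasing along a smooth arc; hence an arc that
reaches the minimum point [s] of [F] stays there, and none crosses [s].  A jump
goes from below [s] to above [s], so there is at most one.  Since [H] increases
by [1] in total, [F(rho)] loses [1] in total if there is no jump; if there is
one where [H = theta], it loses [theta] before and [1 - theta] after.  These are
the alternatives of the germ.

Every germ element carries a wave ([connection_profile]).  On each side of [s]
the potential is invertible, so the arcs can be written [rho = g(H)] with
[F(g(h)) = constant - h].  Two arcs are glued at the first point where [H]
takes the value [theta].

The case [alpha < 0] follows by reflecting the axis, which replaces [H(xi)] by
[1 - H(- xi)] and exchanges the two states ([wave_profile_mirror]).  If
[alpha = 0] there is no drag and there are no jumps, so the density is
constant. *)

(** * Measurability, shifts and partial derivatives in the plane *)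

Section plane_measurability.
Variable R : realType.

(** The rational boxes form a countable base of the plane, and boxes are
    measurable for the product sigma-algebra; it follows that continuous test
    functions are measurable for the product measure. *)
Lemma open_plane_measurable (U : set (R * R)) : open U ->
  (measurable : set (set (measurableTypeR R * measurableTypeR R))) U.
Proof.
move=> oU.
pose box (k : rat * rat * rat) : set (measurableTypeR R * measurableTypeR R) :=
  ball (ratr k.1.1 : R) (ratr k.2) `*` ball (ratr k.1.2 : R) (ratr k.2).
pose F (k : rat * rat * rat) : set (measurableTypeR R * measurableTypeR R) :=
  [set p | box k `<=` U /\ box k p].
have -> : U = \bigcup_k F k.
  apply/seteqP; split => [[t x] Utx|p [k _ []]]; last exact.
  have : nbhs (t, x) U by move: oU; rewrite openE => /(_ _ Utx).
  move=> /nbhs_ballP[e /= e0 eU].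
  have [r] := @rat_in_itvoo R 0 (e / 2) ltac:(lra).
  rewrite in_itv /= => /andP[r0 re].
  have [p] := @rat_in_itvoo R t (t + ratr r) ltac:(lra).
  have [q] := @rat_in_itvoo R x (x + ratr r) ltac:(lra).
  rewrite !in_itv /= => /andP[q1 q2] /andP[p1 p2].
  exists (p, q, r) => //; split.
    move=> [t' x'] [/=]; rewrite /ball /= => bt bx; apply: eU; split => /=.
      rewrite /ball /=; move: bt; rewrite !ltr_distlC => /andP[? ?].
      by apply/andP; split; lra.
    rewrite /ball /=; move: bx; rewrite !ltr_distlC => /andP[? ?].
    by apply/andP; split; lra.
  split => /=; rewrite /ball /= ltr_distlC; apply/andP; split; lra.
apply: countable_bigcupT_measurable => [|k]; first exact: countableP.
have [kU|kU] := pselect (box k `<=` U); last first.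
  by rewrite (_ : F k = set0)//; apply/seteqP; split => // p [].
rewrite (_ : F k = box k); last by apply/seteqP; split => // p [].
by apply: measurableX; apply: open_measurable; exact: ball_open.
Qed.

Lemma continuous_plane_measurable (f : R * R -> R) : continuous f ->
  measurable_fun [set: measurableTypeR R * measurableTypeR R] f.
Proof.
move=> /continuousP cf.
apply: (measurability _ (RGenOpens.measurableE R)).
move=> _ [_ [a [b ->] <-]]; rewrite setTI.
by apply: open_plane_measurable; apply: cf; exact: interval_open.
Qed.

Local Notation mu := (@lebesgue_measure R).

(** A translate of a half-open interval has the same length, and the half-open
    intervals determine the measure. *)
Lemma lebesgue_measure_shift (c : R) (A : set (measurableTypeR R)) : measurable A ->
  mu A = pushforward mu (fun x : measurableTypeR R => x + c : measurableTypeR R) A.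
Proof.
have mshift : measurable_fun setT (fun x : measurableTypeR R => x + c : measurableTypeR R).
  by apply: continuous_measurable_fun => x; apply: cvgD; [exact: cvg_id|exact: cvg_cst].
pose shift_mfun := isMeasurableFun.Build _ _ _ _ _ mshift.
apply: (@lebesgue_measure_unique _ (pushforward mu (MeasurableFun.Pack (MeasurableFun.Class shift_mfun)))) => X [[a b] /= ab <-].
rewrite /pushforward /=.
rewrite (_ : _ @^-1` _ = `]a - c, b - c]%classic); last first.
  by apply/seteqP; split => x /=; rewrite !in_itv /= ltrBlDr lerBrDr.
rewrite !lebesgue_measure_itv /= !lte_fin ltrD2r; case: ifP => // _.
by congr (_%:E); ring.
Qed.

Lemma measurable_shift (c : R) :
  measurable_fun setT (fun x : measurableTypeR R => x + c : measurableTypeR R).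
Proof.
by apply: continuous_measurable_fun => x; apply: cvgD; [exact: cvg_id|exact: cvg_cst].
Qed.

Lemma integral_shift (c : R) (f : measurableTypeR R -> R) :
  mu.-integrable setT (EFin \o f) ->
  (\int[mu]_x (f (x + c))%:E = \int[mu]_x (f x)%:E)%E.
Proof.
move=> fi.
have mf : measurable_fun setT (EFin \o f) by case/integrableP: fi.
have shiftE (g : measurableTypeR R -> \bar R)  : (\int[mu]_x g x =
    \int[pushforward mu (fun x : measurableTypeR R => (x + c)%R : measurableTypeR R)]_x g x)%E.
  apply: eq_measure_integral => [|]; first exact: measurable_shift.
  by move=> ms B mB _; exact: lebesgue_measure_shift.
rewrite [RHS]shiftE integral_pushforward//; first exact: measurable_shift.
rewrite preimage_setT.
apply/integrableP; split.
  by apply: measurableT_comp => //; exact: measurable_shift.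
case/integrableP: fi => _; rewrite shiftE ge0_integral_pushforward//.
- exact: measurable_shift.
- exact: measurableT_comp.
Qed.

Local Notation mu2 := (mu \x mu)%E.

(** After multiplication by a compactly supported test function only such
    integrands occur, so this supplies the integrability that Fubini's theorem
    asks for. *)
Lemma bounded_box_integrable (G : measurableTypeR R * measurableTypeR R -> R) (T M : R) :
  measurable_fun setT G -> (forall p, `|G p| <= M) ->
  (forall p, T < `|p.1| \/ T < `|p.2| -> G p = 0) ->
  mu2.-integrable setT (EFin \o G).
Proof.
move=> mG GM G0.
pose I : set (measurableTypeR R) := `[- T, T]%classic.
pose B : set (measurableTypeR R * measurableTypeR R) := I `*` I.
have mI : measurable I by exact: measurable_itv.
have mB : measurable B by exact: measurableX.
have muI : (mu I < +oo)%E.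
  by rewrite /I lebesgue_measure_itv /=; case: ifP => _ //; rewrite -EFinB ltry.
have muB : (mu2 B < +oo)%E.
  by rewrite product_measure1E// lte_mul_pinfty// ge0_fin_numE.
rewrite (_ : _ \o _ = (EFin \o G) \_ B); last first.
  apply/funext => p; rewrite patchE; case: ifPn => //= pB; congr (_%:E); apply: G0.
  have [//|p1] := ltP T `|p.1|; first by left.
  have [//|p2] := ltP T `|p.2|; first by right.
  exfalso; move/negP: pB; apply; rewrite inE /B /I /=.
  by split; rewrite in_itv /= -ler_norml.
apply/(integrable_restrict _ _ measurableT) => //; rewrite setTI.
apply: measurable_bounded_integrable => //.
- exact: measurable_funTS.
- by exists M; split; [exact: num_real|move=> y My p _; exact: le_trans (GM _) (ltW My)].
Qed.

(** Only the inner integral is translated, with [t] fixed, so that no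
    two-dimensional change of variables is involved. *)
Lemma integral_shear (v : R) (G : measurableTypeR R * measurableTypeR R -> R) (T M : R) :
  measurable_fun setT G -> (forall p, `|G p| <= M) ->
  (forall p, T < `|p.1| \/ T < `|p.2| -> G p = 0) ->
  (\int[mu2]_p (G p)%:E = \int[mu]_t \int[mu]_x (G (t, (x + v * t)%R))%:E)%E.
Proof.
move=> mG GM G0.
rewrite -integral12_prod_meas1; last exact: bounded_box_integrable G0.
apply: eq_integral => t _; rewrite /fubini_F /=.
rewrite -[LHS](integral_shift (v * t))//.
pose I : set (measurableTypeR R) := `[- T, T]%classic.
have mI : measurable I by exact: measurable_itv.
have muI : (mu I < +oo)%E.
  by rewrite /I lebesgue_measure_itv /=; case: ifP => _ //; rewrite -EFinB ltry.
rewrite (_ : _ \o _ = (EFin \o (fun y => G (t, y))) \_ I); last first.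
  apply/funext => p; rewrite patchE; case: ifPn => //= pB; congr (_%:E); apply: G0.
  right; rewrite ltNge ler_norml /=; apply: contra pB => pB.
  by rewrite inE /I /= in_itv.
apply/(integrable_restrict _ _ measurableT) => //; rewrite setTI.
apply: measurable_bounded_integrable => //.
- by apply: measurable_funTS; exact: measurable_fun_pair2.
- by exists M; split; [exact: num_real|move=> y My p _; exact: le_trans (GM _) (ltW My)].
Qed.

End plane_measurability.

Section partials.
Variable R : realType.
Implicit Types (phi : R * R -> R) (p : R * R) (t x v : R).

(** The derivative of [phi] along an axis has literally the difference
    quotients of a function of one variable, which makes one-variable calculus
    available for test functions. *)
Lemma growth_fst phi t x :
  (fun h : R => h^-1 *: (phi (h *: (1, 0) + (t, x)) - phi (t, x))) =
  (fun h : R => h^-1 *: ((fun s => phi (s, x)) (h *: 1 + t) - phi (t, x))).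
Proof.
apply/funext => h; congr (_ *: (phi _ - _)).
by rewrite -[LHS]/(h *: 1 + t, h *: 0 + x) scaler0 add0r.
Qed.

Lemma growth_snd phi t x :
  (fun h : R => h^-1 *: (phi (h *: (0, 1) + (t, x)) - phi (t, x))) =
  (fun h : R => h^-1 *: ((fun s => phi (t, s)) (h *: 1 + x) - phi (t, x))).
Proof.
apply/funext => h; congr (_ *: (phi _ - _)).
by rewrite -[LHS]/(h *: 0 + t, h *: 1 + x) scaler0 add0r.
Qed.

Lemma dtE phi t x : dt phi (t, x) = 'D_1 (fun s => phi (s, x)) t.
Proof. by rewrite /dt /derive growth_fst. Qed.

Lemma dxE phi t x : dx phi (t, x) = 'D_1 (fun s => phi (t, s)) x.
Proof. by rewrite /dx /derive growth_snd. Qed.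

Lemma derivable_fstE phi t x :
  derivable phi (t, x) (1, 0) <-> derivable (fun s => phi (s, x)) t 1.
Proof. by rewrite /derivable growth_fst. Qed.

Lemma derivable_sndE phi t x :
  derivable phi (t, x) (0, 1) <-> derivable (fun s => phi (t, s)) x 1.
Proof. by rewrite /derivable growth_snd. Qed.

Lemma MVT_between (f f' : R -> R) (a b : R) :
  (forall x, is_derive x 1 f (f' x)) ->
  exists2 c, `|c - a| <= `|b - a| & f b - f a = f' c * (b - a).
Proof.
move=> df.
have cf : continuous f.
  by move=> x; apply/differentiable_continuous/derivable1_diffP; case: (df x).
have [ab|ba] := leP a b.
  have [c] := MVT_segment ab (fun x _ => df x) (continuous_subspaceT cf).
  rewrite in_itv /= => /andP[ac cb] E; exists c => //.
  by rewrite !ger0_norm ?subr_ge0//; lra.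
have [c] := MVT_segment (ltW ba) (fun x _ => df x) (continuous_subspaceT cf).
rewrite in_itv /= => /andP[ac cb] E; exists c; last by rewrite -opprB E; lra.
by rewrite !ler0_norm ?subr_le0//; lra.
Qed.

(** The partial derivatives are continuous, so [phi] is differentiable in the
    plane: the increment along the line is split into one along each axis, and
    the mean value theorem is applied to both. *)
Lemma is_derive_along_line phi (x v t : R) :
  (forall p, derivable phi p (1, 0) /\ derivable phi p (0, 1)) ->
  continuous (dt phi) -> continuous (dx phi) ->
  is_derive t 1 (fun s => phi (s, x + v * s))
    (dt phi (t, x + v * t) + v * dx phi (t, x + v * t)).
Proof.
move=> dphi cdt cdx.
suff : h^-1 *: (phi (h *: 1 + t, x + v * (h *: 1 + t)) - phi (t, x + v * t)) @[h --> 0^'] -->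
    dt phi (t, x + v * t) + v * dx phi (t, x + v * t).
  by move=> L; split; [apply/cvg_ex; eexists; exact: L|exact: cvg_lim L].
pose p0 := (t, x + v * t).
apply/cvgrPdist_le => e e0.
pose e1 := e / (1 + `|v|).
have v1 : 0 < 1 + `|v| by rewrite ltr_pwDl.
have e10 : 0 < e1 by rewrite divr_gt0.
have /cvgrPdist_le/(_ _ e10)/nbhs_ballP[d1 /= d10 H1] := cdt p0.
have /cvgrPdist_le/(_ _ e10)/nbhs_ballP[d2 /= d20 H2] := cdx p0.
(* A displacement of size less than [d] in time moves the point of the line by
   less than [d1] and [d2] in both coordinates. *)
pose d := Num.min d1 d2 / (1 + `|v|).
have d0 : 0 < d by rewrite divr_gt0// lt_min d10 d20.
have dle : d * (1 + `|v|) <= d1 /\ d * (1 + `|v|) <= d2.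
  by rewrite /d divfK ?gt_eqF// !ge_min !lexx orbT.
near=> h.
have h0 : h != 0 by near: h; exact: nbhs_dnbhs_neq.
have hd : `|h| < d.
  near: h; apply: nbhs_dnbhs; apply/nbhs_ballP; exists d => //= y.
  by rewrite /ball /= sub0r normrN.
have D1 (s : R) : is_derive s 1 (fun s => phi (s, x + v * (h + t))) (dt phi (s, x + v * (h + t))).
  by rewrite dtE; apply: derivableP; apply/derivable_fstE; exact: (dphi _).1.
have D2 (s : R) : is_derive s 1 (fun s => phi (t, s)) (dx phi (t, s)).
  by rewrite dxE; apply: derivableP; apply/derivable_sndE; exact: (dphi _).2.
have [c1 c1h E1] := @MVT_between (fun s => phi (s, x + v * (h + t)))
   (fun s => dt phi (s, x + v * (h + t))) t (h + t)
   D1.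
have [c2 c2h E2] := @MVT_between (fun s => phi (t, s))
   (fun s => dx phi (t, s)) (x + v * t) (x + v * (h + t))
   D2.
rewrite /= in E1 E2.
have hvd : `|h| <= d * (1 + `|v|) /\ `|v * h| < d * (1 + `|v|).
  rewrite normrM.
  have := normr_ge0 v; have := normr_ge0 h; nra.
have -> : h^-1 *: (phi (h *: 1 + t, x + v * (h *: 1 + t)) - phi (t, x + v * t)) =
   dt phi (c1, x + v * (h + t)) + v * dx phi (t, c2).
  have -> : h *: 1 + t = h + t by rewrite /GRing.scale /= mulr1.
  rewrite -(subrKA (phi (t, x + v * (h + t)))) E1 E2 /GRing.scale /=.
  by field.
have B1 : `|dt phi p0 - dt phi (c1, x + v * (h + t))| <= e1.
  apply: H1; split; rewrite /ball /=.
    rewrite distrC (le_lt_trans c1h)//; rewrite addrK.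
    have := normr_ge0 v; nra.
  rewrite (_ : _ - _ = - (v * h)); last by ring.
  rewrite normrN; lra.
have B2 : `|dx phi p0 - dx phi (t, c2)| <= e1.
  apply: H2; split; rewrite /ball /=; first by rewrite subrr normr0.
  rewrite distrC (le_lt_trans c2h)//.
  rewrite (_ : _ - _ = v * h); last by ring.
  lra.
rewrite -/p0.
rewrite (_ : _ - _ = (dt phi p0 - dt phi (c1, x + v * (h + t))) + v * (dx phi p0 - dx phi (t, c2))); last by ring.
rewrite (le_trans (ler_normD _ _))// normrM.
have -> : e = e1 + `|v| * e1 by rewrite /e1; field; rewrite gt_eqF.
by rewrite lerD// ler_wpM2l.
Unshelve. all: end_near. Qed.

End partials.

(** * Reduction of the weak form to one variable *)

Section test_functions.
Variable R : realType.
Local Notation mu := (@lebesgue_measure R).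
Local Notation mu2 := (mu \x mu)%E.
Implicit Types phi : R * R -> R.

(** The complement of the support is open, so [phi] vanishes on a whole
    neighbourhood of [p]. *)
Lemma off_support phi p : ~ closure [set p | phi p != 0] p ->
  [/\ phi p = 0, dt phi p = 0 & dx phi p = 0].
Proof.
move=> Kp.
have near0 : \forall q \near p, phi q = (cst 0 : R * R -> R) q.
  have : open (~` closure [set p | phi p != 0]) by apply: closed_openC; exact: closed_closure.
  rewrite openE => /(_ p Kp).
  apply: filterS => q /= Kq; apply/eqP/negPn/negP => phiq.
  by apply: Kq; exact: subset_closure.
split; first exact: (nbhs_singleton near0).
  by rewrite /dt (near_eq_derive _ near0) derive_cst.
by rewrite /dx (near_eq_derive _ near0) derive_cst.
Qed.

Lemma compact_range (K : set (R * R)) (f : R * R -> R) : compact K -> continuous f ->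
  exists M : R, forall p, K p -> `|f p| <= M.
Proof.
move=> cK cf.
have /compact_bounded[M [_ HM]] : compact (f @` K).
  by apply: continuous_compact => //; exact: continuous_subspaceT.
by exists (M + 1) => p Kp; apply: (HM (M + 1)); [lra|exists p].
Qed.

(** Leaves room between the projected support of a test function and the ends
    of the interval, near which the coefficients may be unbounded. *)
Lemma compact_sub_oo (A : set R) (l r : R) : l < r -> compact A -> A `<=` `]l, r[%classic ->
  exists l' r', [/\ l < l', l' < r', r' < r & A `<=` `[l', r']%classic].
Proof.
move=> lr cA Alr.
have [->|A0] := eqVneq A set0.
  exists (l + (r - l) / 3), (l + (r - l) / 2).
  by split; [lra..|exact: sub0set].
have /set0P A0' := A0.
have idc : {within A, continuous (@id R)} by apply: continuous_subspaceT => x; exact: cvg_id.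
have [y Ay ymax] := compact_EVT_max A0' cA idc.
have [x Ax xmin] := compact_EVT_min A0' cA idc.
have := Alr _ (set_mem Ay); have := Alr _ (set_mem Ax); rewrite /= !in_itv /= => /andP[lx xr] /andP[ly yr].
exists ((l + x) / 2), ((y + r) / 2); split; [lra| |lra|].
  by have := xmin _ Ay; rewrite /=; lra.
move=> z Az; rewrite /= in_itv /=; have := xmin _ (mem_set Az); have := ymax _ (mem_set Az); rewrite /=.
by move=> *; apply/andP; split; lra.
Qed.

Lemma continuous_fstR : continuous (@fst R R).
Proof. by move=> p; exact: cvg_fst. Qed.

Lemma continuous_sndR : continuous (@snd R R).
Proof. by move=> p; exact: cvg_snd. Qed.

Lemma continuous_xi (v : R) : continuous (fun p : R * R => p.2 - v * p.1).
Proof.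
move=> p; apply: cvgB; first exact: cvg_snd.
by apply: cvgM; [exact: cvg_cst|exact: cvg_fst].
Qed.

Lemma continuous_shear (v : R) : continuous (fun p : R * R => (p.1, p.2 + v * p.1)).
Proof.
move=> p; apply: (@cvg_pair _ _ _ _ (nbhs p.1) (nbhs (p.2 + v * p.1))); first exact: cvg_fst.
apply: cvgD; first exact: cvg_snd.
by apply: cvgM; [exact: cvg_cst|exact: cvg_fst].
Qed.

Lemma integral_derive_compact_support (f f' : R -> R) (T : R) : 0 < T ->
  (forall x : R, is_derive x 1 f (f' x)) -> continuous f' ->
  (forall x, T <= `|x| -> f x = 0 /\ f' x = 0) ->
  (\int[mu]_x (f' x)%:E = 0)%E.
Proof.
move=> T0 df cf' f0.
have cf : continuous f.
  by move=> x; apply/differentiable_continuous/derivable1_diffP; case: (df x).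
rewrite (_ : (fun x => (f' x)%:E) = (fun x => (f' x)%:E) \_ `[- T, T]); last first.
  apply/funext => x; rewrite patchE; case: ifPn => //= xT; congr (_%:E).
  have [Tx|Tx] := leP T `|x|; first by case: (f0 x Tx).
  by move: xT; rewrite notin_setE /= in_itv /= -ler_norml => /negP; rewrite -ltNge; lra.
rewrite -integral_mkcond (@continuous_FTC2 _ f' f (- T) T); last first.
- by move=> x _; rewrite derive1E; case: (df x).
- split; [by move=> x _; case: (df x)| |].
    by apply: cvg_at_right_filter; exact: cf.
  by apply: cvg_at_left_filter; exact: cf.
- exact: continuous_subspaceT.
- lra.
have -> : f T = 0 by case: (f0 T) => //; rewrite ger0_norm// ltW.
have -> : f (- T) = 0 by case: (f0 (- T)) => //; rewrite normrN ger0_norm// ltW.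
by rewrite sube0.
Qed.

Section reduction.
Variables (v : R) (u m S : measurableTypeR R -> R) (phi : R * R -> R).
Variables (M : R).
Hypothesis mu_ : measurable_fun setT u.
Hypothesis mm : measurable_fun setT m.
Hypothesis mS : measurable_fun setT S.
Hypothesis uM : forall x, `|u x| <= M.
Hypothesis mM : forall x, `|m x| <= M.
Hypothesis SM : forall x, `|S x| <= M.
Hypothesis cphi : continuous phi.
Hypothesis dphi : forall p, derivable phi p (1, 0) /\ derivable phi p (0, 1).
Hypothesis cdt : continuous (dt phi).
Hypothesis cdx : continuous (dx phi).
Hypothesis cK : compact (closure [set p | phi p != 0]).

(** At fixed [xi], the terms with [u] form [u xi] times the derivative in [t]
    of [phi (t, xi + v * t)], and its integral over [t] vanishes because the
    support is compact. What remains is the space derivative paired with [m],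
    the flux relative to the moving frame. *)
Lemma weak_form_reduction_bounded :
  (\int[mu2]_p (u (p.2 - v * p.1) * dt phi p +
     (v * u (p.2 - v * p.1) + m (p.2 - v * p.1)) * dx phi p +
     S (p.2 - v * p.1) * phi p)%:E =
   \int[mu]_t \int[mu]_x
      (m x * dx phi (t, x + v * t) + S x * phi (t, x + v * t))%:E)%E.
Proof.
have [T1 HT1] := compact_range cK continuous_fstR.
have [T2 HT2] := compact_range cK continuous_sndR.
have [N1 HN1] := compact_range cK cphi.
have [N2 HN2] := compact_range cK cdt.
have [N3 HN3] := compact_range cK cdx.
(* [T] bounds the support in the original coordinates and in the sheared
   ones. *)
pose T : R := 1 + `|T1| + `|T2| + `|v| * `|T1|.
have T1T : `|T1| <= T /\ `|T2| + `|v| * `|T1| < T /\ 0 < T /\ `|T2| <= T /\ `|T1| < T.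
  have := normr_ge0 T1; have := normr_ge0 T2; have := normr_ge0 v.
  rewrite /T; nra.
pose N : R := `|N1| + `|N2| + `|N3|.
have M0 : 0 <= M by rewrite (le_trans _ (uM 0)).
have phiN p : [/\ `|phi p| <= N, `|dt phi p| <= N & `|dx phi p| <= N].
  have [Kp|Kp] := pselect (closure [set p | phi p != 0] p).
    rewrite /N; have := HN1 _ Kp; have := HN2 _ Kp; have := HN3 _ Kp.
    move: (normr_ge0 N1) (normr_ge0 N2) (normr_ge0 N3) => n1 n2 n3 h3 h2 h1.
    split.
    - by rewrite (le_trans h1)// (le_trans (ler_norm _))// -addrA lerDl addr_ge0.
    - by rewrite (le_trans h2)// (le_trans (ler_norm _))// addrAC lerDr addr_ge0.
    - by rewrite (le_trans h3)// (le_trans (ler_norm _))// lerDr addr_ge0.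
  by case: (off_support Kp) => -> -> ->; rewrite normr0; split; rewrite /N !addr_ge0.
have N0 : 0 <= N by case: (phiN (0, 0)) => + _ _; apply: le_trans.
have off1 p : T <= `|p.1| \/ T <= `|p.2| -> [/\ phi p = 0, dt phi p = 0 & dx phi p = 0].
  move=> Tp; apply: off_support => Kp.
  have := HT1 _ Kp; have := HT2 _ Kp; have := ler_norm T1; have := ler_norm T2.
  have := normr_ge0 T1; have := normr_ge0 T2; have := normr_ge0 v.
  move: T1T Tp; nra.
have off2 t x : T <= `|t| \/ T <= `|x| ->
    [/\ phi (t, x + v * t) = 0, dt phi (t, x + v * t) = 0 & dx phi (t, x + v * t) = 0].
  move=> Tp; apply: off_support => Kp.
  have := HT1 _ Kp; have := HT2 _ Kp; rewrite /=.
  have := ler_norm T1; have := ler_norm T2.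
  have := normr_ge0 T1; have := normr_ge0 T2; have := normr_ge0 v.
  have : `|x| <= `|x + v * t| + `|v| * `|t|.
    rewrite -normrM -[X in `|X| <= _](addrK (v * t)); exact: ler_normB.
  have := normr_ge0 t.
  move: T1T Tp; nra.
have mxi : measurable_fun [set: measurableTypeR R * measurableTypeR R]
    (fun p : R * R => p.2 - v * p.1 : measurableTypeR R).
  have h := continuous_plane_measurable (@continuous_xi v).
  exact: h.
have mshr (f : R * R -> R) : continuous f -> measurable_fun [set: measurableTypeR R * measurableTypeR R]
    (fun p => f (p.1, p.2 + v * p.1)).
  move=> cf; apply: continuous_plane_measurable => p.
  by apply: continuous_comp; [exact: continuous_shear|exact: cf].
have msnd (f : measurableTypeR R -> R) : measurable_fun setT f ->
    measurable_fun [set: measurableTypeR R * measurableTypeR R] (fun p => f p.2).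
  by move=> mf; apply: measurableT_comp => //; exact: measurable_snd.
(* [A] is [u] times the total time derivative at fixed [xi]; [B] is what
   remains. *)
pose A (p : measurableTypeR R * measurableTypeR R) : R :=
  u p.2 * (dt phi (p.1, p.2 + v * p.1) + v * dx phi (p.1, p.2 + v * p.1)).
pose B (p : measurableTypeR R * measurableTypeR R) : R :=
  m p.2 * dx phi (p.1, p.2 + v * p.1) + S p.2 * phi (p.1, p.2 + v * p.1).
have iA : mu2.-integrable setT (EFin \o A).
  apply: (@bounded_box_integrable _ A T (M * (N + `|v| * N))).
  - apply: measurable_funM; first exact: msnd.
    apply: measurable_funD; first exact: mshr.
    by apply: measurable_funM => //; exact: mshr.
  - move=> p; rewrite /A normrM ler_pM//.
    rewrite (le_trans (ler_normD _ _))// normrM.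
    by case: (phiN (p.1, p.2 + v * p.1)) => _ ? ?; rewrite lerD// ler_wpM2l.
  - move=> [t x] /= Tp; rewrite /A /=.
    by case: (off2 t x) => [|_ -> ->]; [move: Tp => [?|?]; [left|right]; exact: ltW|rewrite mulr0 addr0 mulr0].
have iB : mu2.-integrable setT (EFin \o B).
  apply: (@bounded_box_integrable _ B T (M * N + M * N)).
  - apply: measurable_funD.
      by apply: measurable_funM; [exact: msnd|exact: mshr].
    by apply: measurable_funM; [exact: msnd|exact: mshr].
  - move=> p; rewrite /B (le_trans (ler_normD _ _))// !normrM.
    by case: (phiN (p.1, p.2 + v * p.1)) => ? ? ?; rewrite lerD// ler_pM.
  - move=> [t x] /= Tp; rewrite /B /=.
    by case: (off2 t x) => [|-> _ ->]; [move: Tp => [?|?]; [left|right]; exact: ltW|rewrite !mulr0 addr0].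
pose G (p : measurableTypeR R * measurableTypeR R) : R := u (p.2 - v * p.1) * dt phi p +
     (v * u (p.2 - v * p.1) + m (p.2 - v * p.1)) * dx phi p +
     S (p.2 - v * p.1) * phi p.
rewrite -/(G _) (@integral_shear _ v G T (M * N + (`|v| * M + M) * N + M * N)).
- transitivity (\int[mu2]_p ((A p)%:E + (B p)%:E))%E.
    rewrite -integral12_prod_meas1; last exact: integrableD.
    apply: eq_integral => t _; apply: eq_integral => x _.
    rewrite /G /A /B /= addrK -EFinD; congr (_%:E); ring.
  rewrite integralD// -integral21_prod_meas1// -[X in (_ + X)%E]integral12_prod_meas1//.
  rewrite (_ : (\int[mu]_x fubini_G mu (EFin \o A) x = 0)%E) ?add0e//.
  rewrite (_ : fubini_G _ _ = cst 0%E) ?integral0//.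
  apply/funext => x; rewrite /fubini_G /=.
  rewrite /A /=.
  apply: (integral_derive_compact_support (f := fun t => u x * phi (t, x + v * t)) (T := T)).
  + by case: T1T => _ [_ []].
  + move=> t; apply: is_deriveZ; exact: is_derive_along_line.
  + move=> t; apply: cvgM; first exact: cvg_cst.
    apply: cvgD; last apply: cvgM; first 2 [exact: cvg_cst|idtac].
      apply: (@continuous_comp _ _ _ (fun t => (t, x + v * t)) (dt phi)); last exact: cdt.
      apply: (@cvg_pair _ _ _ _ (nbhs t) (nbhs (x + v * t))); first exact: cvg_id.
      by apply: cvgD; [exact: cvg_cst|apply: cvgM; [exact: cvg_cst|exact: cvg_id]].
    apply: (@continuous_comp _ _ _ (fun t => (t, x + v * t)) (dx phi)); last exact: cdx.
    apply: (@cvg_pair _ _ _ _ (nbhs t) (nbhs (x + v * t))); first exact: cvg_id.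
    by apply: cvgD; [exact: cvg_cst|apply: cvgM; [exact: cvg_cst|exact: cvg_id]].
  + move=> t Tt; case: (off2 t x); first by left.
    by move=> -> -> ->; rewrite !mulr0 addr0 mulr0.
- apply: measurable_funD; [apply: measurable_funD|].
  + apply: measurable_funM; first exact: (measurableT_comp mu_ mxi).
    exact: continuous_plane_measurable.
  + apply: measurable_funM; last exact: continuous_plane_measurable.
    apply: measurable_funD; last exact: (measurableT_comp mm mxi).
    by apply: measurable_funM => //; exact: (measurableT_comp mu_ mxi).
  + apply: measurable_funM; last exact: continuous_plane_measurable.
    exact: (measurableT_comp mS mxi).
- move=> p; rewrite /G; case: (phiN p) => ? ? ?.
  rewrite (le_trans (ler_normD _ _))// lerD//.
    rewrite (le_trans (ler_normD _ _))// lerD// normrM ler_pM//.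
    by rewrite (le_trans (ler_normD _ _))// lerD// normrM ler_wpM2l.
  by rewrite normrM ler_pM.
- move=> p Tp; rewrite /G.
  case: (off1 p) => [|-> -> ->]; first by move: Tp => [?|?]; [left|right]; exact: ltW.
  by rewrite !mulr0 !addr0.
Qed.

End reduction.

(** The derivative of a regularization may blow up at the ends of the
    interval, so the source term is in general not bounded on the whole
    interval. *)
Definition locally_bounded_on (l r : R) (f : R -> R) :=
  forall l' r' : R, l < l' -> r' < r ->
    exists M : R, forall x, l' <= x <= r' -> `|f x| <= M.

Lemma measurable_cut (l r l' r' : R) (f : R -> R) : l < l' -> r' < r ->
  measurable_fun (`]l, r[%classic : set (measurableTypeR R)) f ->
  measurable_fun (setT : set (measurableTypeR R)) (f \_ `[l', r']).
Proof.
move=> ll' r'r mf; apply/(measurable_restrictT _ (measurable_itv _)).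
apply: measurable_funS mf; first exact: measurable_itv.
move=> x; rewrite /= !in_itv /= => /andP[? ?]; apply/andP; split; lra.
Qed.

(** The coefficients can be set to zero outside a compact subinterval
    containing the projection of the support of [phi], which brings the
    statement back to bounded coefficients. *)
Lemma weak_form_reduction (l r v : R) (u f S : R -> R) (phi : R * R -> R)
    (Omega : set (R * R)) : l < r ->
  measurable_fun (`]l, r[%classic : set (measurableTypeR R)) u ->
  measurable_fun (`]l, r[%classic : set (measurableTypeR R)) f ->
  measurable_fun (`]l, r[%classic : set (measurableTypeR R)) S ->
  locally_bounded_on l r u -> locally_bounded_on l r f ->
  locally_bounded_on l r S ->
  test_function [set p | l < p.2 - v * p.1 < r] phi ->
  [set p | l < p.2 - v * p.1 < r] `<=` Omega ->
  \int[mu2]_(p in Omega) (u (p.2 - v * p.1) * dt phi p +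
     f (p.2 - v * p.1) * dx phi p + S (p.2 - v * p.1) * phi p) =
  fine (\int[mu]_t \int[mu]_x
     ((f x - v * u x) * dx phi (t, x + v * t) + S x * phi (t, x + v * t))%:E)%E.
Proof.
move=> lr mu_ mf mS bu bf bS [cphi dphi [cdt cdx] cK KO] subOmega.
pose K := closure [set p | phi p != 0].
have cA : compact ((fun p : R * R => p.2 - v * p.1) @` K).
  by apply: continuous_compact => //; apply: continuous_subspaceT; exact: continuous_xi.
have Alr : (fun p : R * R => p.2 - v * p.1) @` K `<=` `]l, r[%classic.
  by move=> _ [p Kp <-]; rewrite /= in_itv; exact: KO.
have [l' [r' [ll' l'r' r'r Klr]]] := compact_sub_oo lr cA Alr.
have Kxi p : K p -> p.2 - v * p.1 \in `[l', r'] by move=> Kp; apply: (Klr _); exists p.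
pose cut (g : R -> R) := g \_ `[l', r']%classic.
have cutE g x : x \in `[l', r'] -> cut g x = g x by move=> xlr; rewrite /cut patchE mem_set.
have [Mu HMu] := bu _ _ ll' r'r; have [Mf HMf] := bf _ _ ll' r'r.
have [MS HMS] := bS _ _ ll' r'r.
have cutM g M : (forall x, l' <= x <= r' -> `|g x| <= M) -> forall x, `|cut g x| <= `|M|.
  move=> gM x; rewrite /cut patchE; case: ifPn => [/set_mem /=|]; last by rewrite normr0.
  by rewrite in_itv /= => xlr; rewrite (le_trans (gM _ xlr))// ler_norm.
pose m x := f x - v * u x.
pose M : R := `|Mu| + `|Mf + `|v| * Mu| + `|MS|.
have mM : forall x, `|cut m x| <= `|Mf + `|v| * Mu|.
  apply: cutM => x xlr; rewrite /m (le_trans (ler_normB _ _))// normrM lerD ?HMf//.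
  by rewrite ler_wpM2l// HMu.
rewrite Rintegral_mkcond /Rintegral.
transitivity (fine (\int[mu2]_p (cut u (p.2 - v * p.1) * dt phi p +
     (v * cut u (p.2 - v * p.1) + cut m (p.2 - v * p.1)) * dx phi p +
     cut S (p.2 - v * p.1) * phi p)%:E)).
  congr fine; apply: eq_integral => p _; congr (_%:E).
  have [Kp|Kp] := pselect (K p); last first.
    rewrite patchE; case: (off_support Kp) => -> -> ->.
    by rewrite !mulr0 !addr0; case: ifP.
  rewrite patchE mem_set; last exact/subOmega/KO.
  by rewrite !cutE ?Kxi// /m; congr (_ + _ * _ + _); ring.
have muc : measurable_fun setT (cut u : measurableTypeR R -> R) by exact: measurable_cut mu_.
have mSc : measurable_fun setT (cut S : measurableTypeR R -> R) by exact: measurable_cut mS.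
have mmc : measurable_fun setT (cut m : measurableTypeR R -> R).
  apply: (measurable_cut ll' r'r).
  apply: measurable_funB; first exact: mf.
  by apply: measurable_funM; [exact: measurable_cst|exact: mu_].
have uM x : `|cut u x| <= M.
  by rewrite (le_trans (cutM _ _ HMu x))// /M -addrA lerDl addr_ge0.
have mM' x : `|cut m x| <= M.
  by rewrite (le_trans (mM x))// /M addrAC lerDr addr_ge0.
have SM x : `|cut S x| <= M.
  by rewrite (le_trans (cutM _ _ HMS x))// /M lerDr addr_ge0.
have E := weak_form_reduction_bounded v muc mmc mSc uM mM' SM cphi dphi cdt cdx cK.
rewrite E; congr fine.
apply: eq_integral => t _; apply: eq_integral => x _; congr (_%:E).
have [Kp|Kp] := pselect (K (t, x + v * t)); last first.
  by case: (off_support Kp) => -> _ ->; rewrite !mulr0.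
by have := Kxi _ Kp; rewrite /= addrK => xlr; rewrite !cutE.
Qed.

End test_functions.

(** * Functions with finitely many exceptional points *)

Section piecewise.
Variable R : realType.
Local Notation mu := (@lebesgue_measure R).
Implicit Types (s : seq R) (a b l r x : R) (f g h : R -> R).

(** The exceptional points form a list that is neither sorted nor contained in
    the interval, so the same list serves for all subintervals; the induction
    is on the exceptional points that the interval still contains. *)
Lemma finite_exception_ind (s : seq R) (P : R -> R -> Prop) (a b : R) :
  (forall l r, a <= l -> l < r -> r <= b ->
     (forall x, l < x < r -> x \notin s) -> P l r) ->
  (forall l x r, a <= l -> l < x -> x < r -> r <= b -> P l x -> P x r -> P l r) ->
  forall l r, a <= l -> l < r -> r <= b -> P l r.
Proof.
move=> Pgood Pcat.
suff ind (t : seq R) l r : a <= l -> l < r -> r <= b ->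
    (forall x, l < x < r -> x \in s -> x \in t) -> P l r.
  by move=> l r al lr rb; apply: (ind s).
elim: t l r => [|y t IH] l r al lr rb st.
  by apply: Pgood => // x xlr; apply/negP => /(st _ xlr).
have [/andP[ly yr]|ylr] := boolP (l < y < r); last first.
  apply: IH => // x xlr xs; move: (st _ xlr xs); rewrite inE => /predU1P[xy|//].
  by move: ylr; rewrite -xy xlr.
apply: (Pcat l y r) => //; apply: IH => //; try lra.
- move=> x /andP[lx xy] xs; have xr : l < x < r by apply/andP; split; lra.
  by move: (st _ xr xs); rewrite inE => /predU1P[E|//]; move: xy; rewrite E ltxx.
- move=> x /andP[yx xr] xs; have xlr : l < x < r by apply/andP; split; lra.
  by move: (st _ xlr xs); rewrite inE => /predU1P[E|//]; move: yx; rewrite E ltxx.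
Qed.

(** The regularity shared by the density, the momentum, their flux and the
    source term of a wave: weak enough to pass through algebraic operations
    and a jump, strong enough for measurability and for bounds on compact
    subintervals. *)
Definition regulated s l r f := forall x, l < x < r ->
  [/\ x \notin s -> {for x, continuous f},
      cvg (f y @[y --> x^'+]) & cvg (f y @[y --> x^'-])].

Lemma near_split (x : R) (P : set R) : P x ->
  (\forall y \near x^'+, P y) -> (\forall y \near x^'-, P y) -> \forall y \near x, P y.
Proof.
move=> Px; rewrite !near_withinE => Pr Pl; near=> y.
have [yx|xy|->//] := ltgtP y x; first by move: yx; near: y.
by move: xy; near: y.
Unshelve. all: end_near. Qed.

Lemma cvg_norm_le {T : Type} (F : set_system T) {FF : Filter F} (f : T -> R) (L : R) :
  f @ F --> L -> exists M : R, \forall y \near F, `|f y| <= M.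
Proof.
move=> /cvgrPdist_lt/(_ 1 ltr01) fL; exists (`|L| + 1).
apply: filterS fL => y Ly; rewrite -[f y](subKr L).
by rewrite (le_trans (ler_normB _ _))// lerD// ltW.
Qed.

(** Near each point a bound comes from the value there and from the two
    one-sided limits; compactness makes it uniform. *)
Lemma regulated_locally_bounded s l r f : regulated s l r f -> locally_bounded_on l r f.
Proof.
move=> rf l' r' ll' r'r.
have /compact_near_coveringP : compact `[l', r']%classic by exact: segment_compact.
move=> /(_ R (+oo)%R (fun M x => `|f x| <= M) _) [].
- move=> x; rewrite /= in_itv /= => /andP[l'x xr'].
  have [|_ /cvg_ex[/= L1 /cvg_norm_le[M1 H1]] /cvg_ex[/= L2 /cvg_norm_le[M2 H2]]] := rf x.
    by apply/andP; split; lra.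
  pose M : R := `|f x| + `|M1| + `|M2|.
  have HM : \forall y \near x, `|f y| <= M.
    apply: near_split.
    - by rewrite /M -addrA lerDl addr_ge0.
    - apply: filterS H1 => y Hy; rewrite (le_trans Hy)// (le_trans (ler_norm _))//.
      by rewrite /M addrAC lerDr addr_ge0.
    - apply: filterS H2 => y Hy; rewrite (le_trans Hy)// (le_trans (ler_norm _))//.
      by rewrite /M lerDr addr_ge0.
  exists ([set y | `|f y| <= M], [set N | M <= N]); first split => //=.
    by exists M; split; [exact: num_real|move=> N /ltW].
  by move=> [y N] /= [Hy HN]; exact: le_trans Hy HN.
- move=> M [_ HM]; exists (M + 1) => x xlr; apply: (HM (M + 1)); first lra.
  by rewrite /= in_itv.
Qed.

(** The function is continuous on the open set obtained by removing the
    exceptional points, and on the finite set of exceptional points everything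
    is measurable. *)
Lemma regulated_measurable s l r f : regulated s l r f ->
  measurable_fun (`]l, r[%classic : set (measurableTypeR R)) f.
Proof.
move=> rf.
have clo : closed [set` s].
  have /accessible_finite_set_closed : accessible_space R.
    exact/hausdorff_accessible/Rhausdorff.
  by apply; exact: finite_seq.
have -> : `]l, r[%classic = (`]l, r[%classic `&` ~` [set` s]) `|` (`]l, r[%classic `&` [set` s]).
  by rewrite -setIUr setUC setUv setIT.
have oU : open (`]l, r[%classic `&` ~` [set` s]).
  by apply: openI; [exact: interval_open|exact: closed_openC].
apply/measurable_funU.
- exact: open_measurable.
- by apply: measurableI => //; exact: closed_measurable.
split.
  apply: open_continuous_measurable_fun => // x /set_mem[/= + xs].
  by rewrite in_itv /= => /rf[cf _ _]; apply: cf; apply/negP.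
move=> _ Y mY; apply: countable_measurable => [t|]; first exact: measurable_set1.
apply: finite_set_countable; apply: sub_finite_set (finite_seq s).
by move=> x [[_ ?] _].
Qed.

(** Replaces the values at the ends by one-sided limits, so that theorems
    about segments apply to functions whose values at the ends are unrelated
    to their limits. *)
Definition extend_ends l r (vl vr : R) f x :=
  if x == l then vl else if x == r then vr else f x.

Lemma extend_ends_id l r vl vr f x : l < x < r -> extend_ends l r vl vr f x = f x.
Proof. by move=> /andP[lx xr]; rewrite /extend_ends gt_eqF// lt_eqF. Qed.

Lemma near_extend_ends l r vl vr f x : l < x < r ->
  \forall y \near x, f y = extend_ends l r vl vr f y.
Proof.
move=> xlr; have : x \in `]l, r[ by rewrite in_itv.
move=> /near_in_itvoo; apply: filterS => y; rewrite in_itv /= => ylr.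
by rewrite extend_ends_id.
Qed.

Lemma extend_ends_continuous l r vl vr f : l < r ->
  (forall x, l < x < r -> {for x, continuous f}) ->
  f x @[x --> l^'+] --> vl -> f x @[x --> r^'-] --> vr ->
  {within `[l, r], continuous (extend_ends l r vl vr f)}.
Proof.
move=> lr cf fl fr; apply/(continuous_within_itvP _ lr); split.
- move=> x; rewrite in_itv /= => xlr.
  rewrite /continuous_at extend_ends_id//.
  by apply: cvg_trans (cf x xlr); apply: near_eq_cvg; exact: near_extend_ends.
- rewrite {2}/extend_ends eqxx.
  apply: cvg_trans fl; apply: near_eq_cvg; near=> x.
  by rewrite extend_ends_id//; apply/andP; split; near: x; [exact: nbhs_right_gt|exact: nbhs_right_lt].
- rewrite {2}/extend_ends eqxx gt_eqF//.
  apply: cvg_trans fr; apply: near_eq_cvg; near=> x.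
  by rewrite extend_ends_id//; apply/andP; split; near: x; [exact: nbhs_left_gt|exact: nbhs_left_lt].
Unshelve. all: end_near. Qed.

Lemma extend_ends_LRcontinuous l r vl vr g : l < r ->
  (forall x, l < x < r -> derivable g x 1) ->
  g x @[x --> l^'+] --> vl -> g x @[x --> r^'-] --> vr ->
  derivable_oo_LRcontinuous (extend_ends l r vl vr g) l r.
Proof.
move=> lr dg gl gr.
have cg x : l < x < r -> {for x, continuous g}.
  by move=> /dg dgx; apply/differentiable_continuous/derivable1_diffP.
have /(continuous_within_itvP _ lr)[_ ? ?] := extend_ends_continuous lr cg gl gr.
split => // x; rewrite in_itv /= => xlr.
by apply: near_eq_derivable (dg x xlr); exact: near_extend_ends.
Qed.

Lemma smooth_FTC2 l r g h (gl gr : R) : l < r ->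
  (forall x, l < x < r -> is_derive x 1 g (h x) /\ {for x, continuous h}) ->
  cvg (h x @[x --> l^'+]) -> cvg (h x @[x --> r^'-]) ->
  g x @[x --> l^'+] --> gl -> g x @[x --> r^'-] --> gr ->
  (\int[mu]_(x in `]l, r[) (h x)%:E = (gr - gl)%:E)%E.
Proof.
move=> lr dgh /cvg_ex[/= hl Hl] /cvg_ex[/= hr Hr] Gl Gr.
have ch x : l < x < r -> {for x, continuous h} by case/dgh.
have dg x : l < x < r -> derivable g x 1 by case/dgh => -[].
have := continuous_FTC2 lr (extend_ends_continuous lr ch Hl Hr) (extend_ends_LRcontinuous lr dg Gl Gr).
have -> : extend_ends l r gl gr g l = gl by rewrite /extend_ends eqxx.
have -> : extend_ends l r gl gr g r = gr by rewrite /extend_ends eqxx gt_eqF.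
rewrite EFinB => <-; last first.
  move=> x; rewrite in_itv /= => xlr.
  rewrite derive1E extend_ends_id// -(near_eq_derive _ (near_extend_ends gl gr g xlr)).
  by case: (dgh _ xlr) => -[].
rewrite integral_itv_bndoo; last first.
  apply/measurable_EFinP; apply: open_continuous_measurable_fun; first exact: interval_open.
  move=> x /set_mem; rewrite /= in_itv /= => xlr.
  rewrite /continuous_at extend_ends_id//.
  by apply: cvg_trans (ch x xlr); apply: near_eq_cvg; exact: near_extend_ends.
apply: eq_integral => x /set_mem; rewrite /= in_itv /= => xlr.
by rewrite extend_ends_id.
Qed.

(** Adding up the increments over the pieces leaves only those at the ends,
    because the one-sided limits of [g] agree at inner points. *)
Lemma piecewise_FTC2 s a b g h (gL gR : R -> R) : a < b ->
  (forall x, a < x < b -> x \notin s -> is_derive x 1 g (h x) /\ {for x, continuous h}) ->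
  (forall x, a <= x < b -> cvg (h y @[y --> x^'+]) /\ g y @[y --> x^'+] --> gR x) ->
  (forall x, a < x <= b -> cvg (h y @[y --> x^'-]) /\ g y @[y --> x^'-] --> gL x) ->
  (forall x, a < x < b -> gL x = gR x) ->
  (\int[mu]_(x in `]a, b[) (h x)%:E = (gL b - gR a)%:E)%E.
Proof.
move=> ab dgh HR HL LR.
have reg : regulated s a b h.
  move=> x /andP[ax xb]; split.
  - by move=> xs; case: (dgh x) => //; rewrite ax.
  - by case: (HR x) => //; rewrite (ltW ax).
  - by case: (HL x) => //; rewrite (ltW xb) ax.
have mh := regulated_measurable reg.
have mh' l r : a <= l -> r <= b -> measurable_fun (`]l, r[%classic : set (measurableTypeR R)) (EFin \o h).
  move=> al rb; apply/measurable_EFinP; apply: measurable_funS mh => // x /=.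
  by rewrite !in_itv /= => /andP[? ?]; apply/andP; split; lra.
suff: forall l r, a <= l -> l < r -> r <= b ->
    (\int[mu]_(x in `]l, r[) (h x)%:E = (gL r - gR l)%:E)%E by apply.
apply: (@finite_exception_ind s) => [l r al lr rb good|l x r al lx xr rb E1 E2].
  have inab x : l < x < r -> a < x < b by move=> /andP[? ?]; apply/andP; split; lra.
  apply: smooth_FTC2 => //.
  - by move=> x xlr; apply: dgh; [exact: inab|exact: good].
  - by case: (HR l) => //; rewrite al /=; lra.
  - by case: (HL r) => //; rewrite rb andbT; lra.
  - by case: (HR l) => //; rewrite al /=; lra.
  - by case: (HL r) => //; rewrite rb andbT; lra.
rewrite (_ : `]l, r[%classic = `]l, x] `|` `]x, r[)%classic; last first.
  by apply: itv_bndbnd_setU; rewrite bnd_simp ?ltW.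
have mlr := mh' _ _ al rb.
have mlx : measurable_fun (`]l, x]%classic : set (measurableTypeR R)) (EFin \o h).
  apply: measurable_funS mlr => // y /=.
  by rewrite !in_itv /= => /andP[? ?]; apply/andP; split; lra.
rewrite integral_setU//; last first.
- apply/disj_setPS => y [/=]; rewrite !in_itv /= => /andP[? ?] /andP[? ?]; lra.
- rewrite (_ : (_ `|` _)%classic = `]l, r[%classic)//.
  by symmetry; apply: itv_bndbnd_setU; rewrite bnd_simp ?ltW.
rewrite (@integral_itv_bndoo _ l x (EFin \o h) false false); last by apply: mh' => //; lra.
have := E1; rewrite /= => ->; rewrite E2 -EFinD LR; last by apply/andP; split; lra.
by congr (_%:E); ring.
Qed.

End piecewise.

(** * Partitions and exceptional points *)

Section partitions.
Variable R : realType.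
Implicit Types (s : seq R) (a b l r x : R) (f g h : R -> R).

(** The regularity of [piecewise_C1] stated point by point: two functions can
    use the same list [s] without refining a partition. *)
Definition piecewise_smooth s a b f :=
  [/\ forall x, a < x < b -> x \notin s ->
        derivable f x 1 /\ {for x, continuous (derive1 f)},
      forall x, a <= x < b -> cvg (f y @[y --> x^'+]) &
      forall x, a < x <= b -> cvg (f y @[y --> x^'-])].

Lemma derivable_continuous f x : derivable f x 1 -> {for x, continuous f}.
Proof. by move=> df; apply/differentiable_continuous/derivable1_diffP. Qed.

Lemma continuous_cvgr f x : {for x, continuous f} -> f y @[y --> x^'+] --> f x.
Proof. exact: cvg_at_right_filter. Qed.

Lemma continuous_cvgl f x : {for x, continuous f} -> f y @[y --> x^'-] --> f x.
Proof. exact: cvg_at_left_filter. Qed.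

Definition smooth_piece l r f :=
  [/\ C1_itv l r f, cvg (f x @[x --> l^'+]) & cvg (f x @[x --> r^'-])].

Lemma C1_on_pieces_cons a b x s f :
  C1_on_pieces a b (x :: s) f <-> smooth_piece a x f /\ C1_on_pieces x b s f.
Proof.
split=> [H|[H0 H1]]; last first.
  by case=> [_|i]; [exact: H0|rewrite /= ltnS; exact: H1].
by split; [exact: (H 0)|move=> i si; exact: (H i.+1)].
Qed.

Lemma C1_on_pieces_cat a b c s t f : last a s = b ->
  C1_on_pieces a b s f -> C1_on_pieces b c t f -> C1_on_pieces a c (s ++ t) f.
Proof.
elim: s a => [a <- _|x s IH a lb /C1_on_pieces_cons[px ps] pt]; first exact.
by apply/C1_on_pieces_cons; split; [exact: px|exact: IH].
Qed.

Lemma C1_on_pieces_smooth a b s f : itv_partition a b s -> C1_on_pieces a b s f ->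
  piecewise_smooth s a b f.
Proof.
elim: s a => [a [_ /eqP <-] _|x s IH a [/= /andP[ax px] lb]].
  by split=> x /= /andP[? ?]; exfalso; lra.
move=> /C1_on_pieces_cons[[[df cf] cl cr] ps].
have xb : itv_partition x b s by split.
have [H1 H2 H3] := IH _ xb ps.
split.
- move=> y /andP[ay yb]; rewrite inE negb_or => /andP[yx ys].
  have [yx'|xy|E] := ltgtP y x; last by rewrite E eqxx in yx.
    by split; [apply: df|apply: cf]; rewrite in_itv /= ay.
  by apply: H1 => //; rewrite xy.
- move=> y /andP[ay yb]; have [xy|yx] := leP x y; first by apply: H2; rewrite xy.
  move: ay; rewrite le_eqVlt => /predU1P[<-//|ay].
  apply/cvg_ex; exists (f y); apply/continuous_cvgr/derivable_continuous/df.
  by rewrite in_itv /= ay.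
- move=> y /andP[ay yb]; have [yx|xy] := leP y x; last by apply: H3; rewrite xy.
  move: yx; rewrite le_eqVlt => /predU1P[->//|yx].
  apply/cvg_ex; exists (f y); apply/continuous_cvgl/derivable_continuous/df.
  by rewrite in_itv /= ay.
Qed.

(** Exception-free intervals are single pieces, and partitions of adjacent
    intervals concatenate. *)
Lemma piecewise_smooth_partition s a b f g : a < b ->
  piecewise_smooth s a b f -> piecewise_smooth s a b g -> piecewise_C1 a b f g.
Proof.
move=> ab [f1 f2 f3] [g1 g2 g3].
suff : forall l r, a <= l -> l < r -> r <= b -> piecewise_C1 l r f g by apply.
apply: (@finite_exception_ind _ s) => [l r al lr rb good|l x r al lx xr rb].
  have pc h : piecewise_smooth s a b h -> smooth_piece l r h.
    move=> [h1 h2 h3]; split.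
    - split=> x; rewrite in_itv /= => /andP[lx xr].
        by case: (h1 x) => //; [apply/andP; split; lra|apply: good; rewrite lx].
      by case: (h1 x) => //; [apply/andP; split; lra|apply: good; rewrite lx].
    - by apply: h2; apply/andP; split; lra.
    - by apply: h3; apply/andP; split; lra.
  exists [:: r]; split; first exact: itv_partition1.
    by apply/C1_on_pieces_cons; split; [exact: pc|case].
  by apply/C1_on_pieces_cons; split; [exact: pc|case].
move=> [s1 [p1 f4 g4]] [s2 [p2 f5 g5]]; exists (s1 ++ s2).
have /eqP lx' : last l s1 == x by case: p1.
split; first exact: itv_partition_cat p1 p2.
  exact: C1_on_pieces_cat f4 f5.
exact: C1_on_pieces_cat g4 g5.
Qed.

End partitions.

(** * Entropy satisfying shocks in the moving frame *)

Section shocks.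
Variable R : realType.
Implicit Types (c v alpha l r x : R).

(** The difference of the two sides vanishes at [1] and has derivative
    [- (y - 1) ^+ 2 / (2 * y ^+ 2)]. *)
Lemma ln_lt_half_sub_inv (x : R) : 1 < x -> ln x < (x - x^-1) / 2.
Proof.
move=> x1.
pose f := fun y : R => ln y - (y - y^-1) / 2.
have df (y : R) : 0 < y -> is_derive y 1 f (y^-1 - (1 + (y ^- 2)) / 2).
  move=> y0; rewrite /f.
  have d1 := is_derive1_ln y0.
  have y00 : y != 0 by rewrite gt_eqF.
  have d2 := is_deriveV y00 (is_derive_id y 1).
  have d3 := is_deriveZ (2^-1) (is_deriveB (is_derive_id y (1:R)) d2).
  have d4 := is_deriveB d1 d3.
  rewrite (_ : (fun _ => _) = (@ln R \- (2^-1 \*: (id \- (fun y => y^-1)))))%R; last first.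
    by apply/funext => z /=; rewrite mulrC.
  apply: is_derive_eq d4 _.
  by rewrite /GRing.scale /=; field.
have cf : {within `[1, x], continuous f}.
  apply: derivable_within_continuous => y; rewrite in_itv /= => /andP[y1 _].
  by have [] := df y (lt_le_trans ltr01 y1).
have [|z] := MVT x1 _ cf (df := fun y => y^-1 - (1 + (y ^- 2)) / 2).
  by move=> y; rewrite in_itv /= => /andP[y1 _]; apply: df; exact: lt_trans y1.
rewrite in_itv /= => /andP[z1 zx]; rewrite {1 2}/f ln1 invr1 subrr mul0r subrr subr0 => E.
rewrite -subr_lt0 E.
have z0 : 0 < z by lra.
rewrite (_ : _ - _ = - ((z - 1) ^+ 2 / (2 * z ^+ 2))); last by field; rewrite gt_eqF.
rewrite mulNr oppr_lt0 mulr_gt0 ?subr_gt0//.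
by apply: divr_gt0; [rewrite exprn_gt0// subr_gt0|rewrite mulr_gt0// exprn_gt0].
Qed.

(** The first factor is the entropy production of a jump up to the factor
    [c ^+ 2 * alpha]. The product is symmetric in [l] and [r], which leaves
    the case [l < r]; there [ln_lt_half_sub_inv] applies to [r / l]. *)
Lemma energy_jump_sign l r : 0 < l -> 0 < r -> l != r ->
  ((l / r - r / l) / 2 + (ln r - ln l)) * (r - l) < 0.
Proof.
move=> l0 r0 lr.
have lr0 : l / r = (r / l)^-1 by rewrite invf_div.
wlog lt_lr : l r l0 r0 lr lr0 / l < r => [H|].
  have [lt_lr|lt_rl|E] := ltgtP l r; first exact: H.
    have := H r l r0 l0; rewrite eq_sym lr invf_div => /(_ erefl erefl lt_rl); lra.
  by rewrite E eqxx in lr.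
have := @ln_lt_half_sub_inv (r / l); rewrite ltr_pdivlMr// mul1r => /(_ lt_lr).
rewrite ln_div ?posrE// -lr0 => H.
by rewrite nmulr_rlt0 ?subr_gt0//; lra.
Qed.

(** The form that the shock conditions take between two states with the same
    relative momentum [alpha]: a product fixed by Rankine-Hugoniot, and
    compression along the flow. *)
Definition admissible_jump c alpha l r :=
  l = r \/ (l * r * c ^+ 2 = alpha ^+ 2 /\ 0 < alpha * (r - l)).

Lemma fluxE c v alpha r : 0 < r ->
  flux c (r, alpha + v * r) =
    v * (alpha + v * r) + alpha * v + (alpha ^+ 2 / r + c ^+ 2 * r).
Proof. by move=> r0; rewrite /flux /=; field; rewrite gt_eqF. Qed.

(** The first term is transported at speed [v] and drops out of the entropy
    production, and so does the last one, which does not depend on [r]; the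
    third is continuous across a shock by Rankine-Hugoniot. *)
Lemma energy_fluxE c v alpha r : 0 < r ->
  energy_flux c (r, alpha + v * r) = v * energy c (r, alpha + v * r) +
    alpha * (alpha ^+ 2 / (2 * r ^+ 2) + c ^+ 2 * ln r) +
    v * (alpha ^+ 2 / r + c ^+ 2 * r) + alpha * (v ^+ 2 / 2 + c ^+ 2).
Proof. by move=> r0; rewrite /energy_flux /energy /=; field; rewrite gt_eqF. Qed.

(** Once [l * r * c ^+ 2 = alpha ^+ 2], the entropy production is
    [c ^+ 2 * (alpha * B)], where [B] has the sign of [l - r] by
    [energy_jump_sign]. *)
Lemma continuous_or_shockP c v alpha l r : 0 < c -> 0 < l -> 0 < r ->
  continuous_or_shock c v (l, alpha + v * l) (r, alpha + v * r) <->
  admissible_jump c alpha l r.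
Proof.
move=> c0 l0 r0.
have ln0 : l != 0 by rewrite gt_eqF.
have rn0 : r != 0 by rewrite gt_eqF.
pose B := (l / r - r / l) / 2 + (ln r - ln l).
have entropyE : l * r * c ^+ 2 = alpha ^+ 2 ->
    energy_flux c (r, alpha + v * r) - energy_flux c (l, alpha + v * l) -
    v * (energy c (r, alpha + v * r) - energy c (l, alpha + v * l)) =
    c ^+ 2 * (alpha * B).
  move=> E; rewrite !energy_fluxE// -E /B; field.
  by rewrite ln0 rn0.
split=> [[[-> _]|[[UlUr _] /= _ RH ent]]|[->|[E al]]]; [by left| |by left|].
  right.
  have lr : l != r by apply/eqP => E; apply: UlUr; rewrite E.
  have E : l * r * c ^+ 2 = alpha ^+ 2.
    move: RH; rewrite !fluxE// => RH.
    have : (r - l) * (l * r * c ^+ 2 - alpha ^+ 2) = 0.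
      have : l * r * (alpha ^+ 2 / r + c ^+ 2 * r - (alpha ^+ 2 / l + c ^+ 2 * l)) = 0.
        by apply/eqP; rewrite mulf_eq0; apply/orP; right; apply/eqP; lra.
      move=> <-; field; by rewrite ln0 rn0.
    by move=> /eqP; rewrite mulf_eq0 !subr_eq0 eq_sym (negPf lr) /= => /eqP.
  split => //.
  have := energy_jump_sign l0 r0 lr; rewrite -/B => Blt.
  have : c ^+ 2 * (alpha * B) <= 0 by rewrite -entropyE// subr_le0.
  rewrite pmulr_rle0 ?exprn_gt0// => aB.
  have a2 : 0 < alpha ^+ 2 by rewrite -E !mulr_gt0// exprn_gt0.
  have a0 : alpha != 0 by apply/eqP => a0; move: a2; rewrite a0 expr0n ltxx.
  have B0 : B != 0 by apply/eqP => B0; move: Blt; rewrite B0 mul0r ltxx.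
  have aB' : alpha * B < 0 by rewrite lt_neqAle aB andbT mulf_neq0.
  have B2 : 0 < B ^+ 2 by rewrite exprn_even_gt0//= orbC.
  have : 0 < alpha * (r - l) * B ^+ 2.
    rewrite (_ : _ * _ = (alpha * B) * (B * (r - l))); last by ring.
    by rewrite nmulr_lgt0.
  by rewrite pmulr_lgt0.
right.
have lr : l != r by apply/eqP => E'; move: al; rewrite E' subrr mulr0 ltxx.
split => /=.
- split=> // -[E' _]; by rewrite E' eqxx in lr.
- ring.
- rewrite !fluxE// -E; field; by rewrite ln0 rn0.
- rewrite -subr_le0 entropyE// pmulr_rle0 ?exprn_gt0//.
  have := energy_jump_sign l0 r0 lr; rewrite -/B => Blt.
  rewrite leNgt; apply/negP => aB.
  have : 0 < (alpha * B) * (alpha * (r - l)) by rewrite mulr_gt0.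
  rewrite (_ : _ * _ = alpha ^+ 2 * (B * (r - l))); last by ring.
  have a2 : 0 < alpha ^+ 2 by rewrite -E !mulr_gt0// exprn_gt0.
  by rewrite pmulr_rgt0//; lra.
Qed.

End shocks.

(** * Derivative of the potential *)

Section Ffun_derivative.
Variable R : realType.
Local Notation mu := (@lebesgue_measure R).

(** Near [r], both orientations express the increment of the integral taken
    from a base point to the left of both [s] and [r]. *)
Lemma oriented_integral_derive (f : R -> R) (s : R) : 0 < s ->
  (forall r, 0 < r -> {for r, continuous f}) ->
  forall r : R, 0 < r -> is_derive r 1 (oriented_integral f s) (f r).
Proof.
move=> s0 cf r r0.
(* The base point is positive because [f] is only known to be continuous
   there. *)
pose z := Num.min s r / 2.
pose u := Num.max s r + 1.
have zs : z < s /\ z < r by rewrite /z; case: (leP s r) => ?; lra.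
have su : s < u /\ r < u by rewrite /u; case: (leP s r) => ?; lra.
have z0 : 0 < z by rewrite /z; case: (leP s r) => ?; lra.
have iab y y' : z <= y -> mu.-integrable `[y, y'] (EFin \o f).
  move=> zy; apply: continuous_compact_integrable; first exact: segment_compact.
  apply/continuous_in_subspaceT => x /set_mem; rewrite /= in_itv /= => /andP[yx _].
  apply: cf; lra.
pose G y := \int[mu]_(x in `[z, y]) f x.
have [dG G'] : derivable G r 1 /\ derive1 G r = f r.
  apply: (@continuous_FTC1_closed _ f z r u); [lra|exact: iab|lra|exact: cf].
apply: (@near_eq_is_derive _ _ _ (G \- cst (G s))); last first.
  have dG' : is_derive r 1 G (f r) by split; [exact: dG|rewrite -derive1E].
  by have := is_deriveB dG' (is_derive_cst (G s) r 1); rewrite subr0.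
have zr : r \in `]z, u[ by rewrite in_itv /=; apply/andP; split; lra.
have split3 y y' : z <= y -> y <= y' ->
    \int[mu]_(x in `[z, y']) f x - \int[mu]_(x in `[z, y]) f x = \int[mu]_(x in `[y, y']) f x.
  move=> zy yy'; rewrite (Rintegral_itvB (iab _ _ (lexx z))) ?bnd_simp//.
  apply: Rintegral_itv_obnd_cbnd.
  apply: integrableS (iab y y' zy) => //.
  by move=> x /=; rewrite !in_itv /= => /andP[/ltW -> ->].
have := near_in_itvoo zr; apply: filterS => y; rewrite in_itv /= => /andP[zy yu].
rewrite /oriented_integral /G /=; case: (leP s y) => sy.
  by rewrite split3//; lra.
by rewrite -opprB split3//; lra.
Qed.

Lemma Ffun_derive (c : R) (D : R -> R -> R) (alpha : R) : 0 < c -> alpha != 0 ->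
  drag_force D -> forall r : R, 0 < r ->
  is_derive r 1 (Ffun c D alpha) ((c ^+ 2 - alpha ^+ 2 / r ^+ 2) / `|D r alpha|).
Proof.
move=> c0 a0 [cD Dp Dn _] r r0.
have Dneq0 x : 0 < x -> D x alpha != 0.
  move=> x0; have [a|a|/eqP] := ltgtP alpha 0; last by rewrite (negPf a0).
    by rewrite lt_eqF// Dn.
  by rewrite gt_eqF// Dp.
rewrite [X in is_derive _ _ _ X](_ : _ = 1 / `|D r alpha| * (c ^+ 2 - alpha ^+ 2 / r ^+ 2)); last first.
  by rewrite mul1r mulrC.
apply: oriented_integral_derive => //; first by rewrite divr_gt0// normr_gt0.
move=> x x0.
have cDx : {for x, continuous (fun x => D x alpha)}.
  apply: (@continuous_comp _ _ _ (fun x => (x, alpha)) (fun p => D p.1 p.2)).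
    by apply: (@cvg_pair _ _ _ _ (nbhs x) (nbhs alpha)); [exact: cvg_id|exact: cvg_cst].
  exact: (cD (x, alpha)).
apply: cvgM.
  apply: cvgM; first exact: cvg_cst.
  by apply: cvgV; [rewrite normr_eq0 Dneq0|exact: cvg_norm].
apply: cvgB; first exact: cvg_cst.
apply: cvgM; first exact: cvg_cst.
by apply: cvgV; [rewrite expf_neq0// gt_eqF|exact: exprn_continuous].
Qed.

Lemma Ffun_sonic (c : R) (D : R -> R -> R) (alpha : R) : Ffun c D alpha (`|alpha| / c) = 0.
Proof. by rewrite /Ffun /oriented_integral lexx set_itv1 Rintegral_set1. Qed.

End Ffun_derivative.

(** * From the differential equation to the weak form, and back *)

Section weak_from_strong.
Variable R : realType.
Local Notation mu := (@lebesgue_measure R).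
Local Notation mu2 := (mu \x mu)%E.

Lemma integral_vanish_outside (l r : R) (f : R -> R) :
  (forall x, ~~ (l < x < r) -> f x = 0) ->
  (\int[mu]_x (f x)%:E = \int[mu]_(x in `]l, r[) (f x)%:E)%E.
Proof.
move=> f0; rewrite [RHS]integral_mkcond; apply: eq_integral => x _.
rewrite patchE; case: ifPn => //; rewrite notin_setE /= in_itv /= => /negP xlr.
by rewrite f0.
Qed.

Lemma regulated_cvg (s : seq R) (l r : R) (f : R -> R) x : regulated s l r f -> l < x < r ->
  cvg (f y @[y --> x^'+]) /\ cvg (f y @[y --> x^'-]).
Proof. by move=> rf xlr; case: (rf x xlr). Qed.

(** For each [t] the inner integrand of the reduced weak form is the
    derivative of [f - v * u] times the test function; this product does not
    jump and vanishes near both ends. *)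
Lemma weak_balance_of_FTC (l r v : R) (s : seq R) (u f S GL GR : R -> R) : l < r ->
  regulated s l r u -> regulated s l r f -> regulated s l r S ->
  (forall x, l < x < r -> (f y - v * u y) @[y --> x^'+] --> GR x) ->
  (forall x, l < x < r -> (f y - v * u y) @[y --> x^'-] --> GL x) ->
  (forall x, l < x < r -> GL x = GR x) ->
  (forall x, l < x < r -> x \notin s ->
     is_derive x 1 (fun y => f y - v * u y) (S x)) ->
  weak_balance_law [set p | l < p.2 - v * p.1 < r]
    (fun p => u (p.2 - v * p.1)) (fun p => f (p.2 - v * p.1)) (fun p => S (p.2 - v * p.1)).
Proof.
move=> lr ru rf rS HR HL HLR dm phi tphi.
have [cphi dphi [cdt cdx] cK KO] := tphi.
rewrite (weak_form_reduction lr (regulated_measurable ru) (regulated_measurable rf)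
  (regulated_measurable rS) (regulated_locally_bounded ru) (regulated_locally_bounded rf)
  (regulated_locally_bounded rS) tphi)//.
pose K := closure [set p | phi p != 0].
have cA : compact ((fun p : R * R => p.2 - v * p.1) @` K).
  by apply: continuous_compact => //; apply: continuous_subspaceT; exact: continuous_xi.
have Alr : (fun p : R * R => p.2 - v * p.1) @` K `<=` `]l, r[%classic.
  by move=> _ [p Kp <-]; rewrite /= in_itv; exact: KO.
have [l1 [r1 [ll1 l1r1 r1r Klr]]] := compact_sub_oo lr cA Alr.
(* Strictly between the support of [phi] and the ends of the interval, so that
   the test function vanishes at [l'] and [r'] themselves. *)
pose l' := (l + l1) / 2; pose r' := (r1 + r) / 2.
have Kxi t x : ~~ (l' < x < r') -> ~ K (t, x + v * t).
  move=> xlr Kp; have : x \in `[l1, r1].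
    by apply: (Klr x); exists (t, x + v * t) => //=; rewrite addrK.
  rewrite in_itv /= => /andP[lx xr]; move: xlr; rewrite negb_and -!leNgt /l' /r' => /orP[]; lra.
have off t x : ~~ (l' < x < r') -> phi (t, x + v * t) = 0 /\ dx phi (t, x + v * t) = 0.
  by move=> xlr; case: (off_support (Kxi t x xlr)).
pose psi t x := phi (t, x + v * t).
have dpsi (t x : R) : is_derive x 1 (psi t) (dx phi (t, x + v * t)).
  have d1 : is_derive (x + v * t) 1 (fun y => phi (t, y)) (dx phi (t, x + v * t)).
    by rewrite dxE; apply: derivableP; apply/derivable_sndE; exact: (dphi _).2.
  have d2 : is_derive x 1 (shift (v * t)) 1 by exact: is_derive_shift.
  have d3 := @is_derive1_comp _ (fun y => phi (t, y)) (shift (v * t)) x _ _ d1 d2.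
  by apply: is_derive_eq d3 _; rewrite /GRing.scale /= mulr1.
have cpsi (t x : R) : {for x, continuous (psi t)} by apply: derivable_continuous; case: (dpsi t x).
have cdpsi (t x : R) : {for x, continuous (fun x => dx phi (t, x + v * t))}.
  apply: (@continuous_comp _ _ _ (fun x => (t, x + v * t)) (dx phi)); last exact: cdx.
  apply: (@cvg_pair _ _ _ _ (nbhs t) (nbhs (x + v * t))); first exact: cvg_cst.
  by apply: cvgD; [exact: cvg_id|exact: cvg_cst].
have inner t : (\int[mu]_x
     ((f x - v * u x) * dx phi (t, x + v * t) + S x * phi (t, x + v * t))%:E = 0)%E.
  rewrite (integral_vanish_outside (l := l') (r := r')); last first.
    by move=> x /(off t)[-> ->]; rewrite !mulr0 addr0.
  have sub x : l' <= x <= r' -> l < x < r.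
    by rewrite /l' /r' => /andP[? ?]; apply/andP; split; lra.
  rewrite (@piecewise_FTC2 _ s l' r' (fun x => (f x - v * u x) * psi t x) _
    (fun x => GL x * psi t x) (fun x => GR x * psi t x)).
  - have -> : psi t r' = 0 by case: (off t r') => //; rewrite ltxx andbF.
    have -> : psi t l' = 0 by case: (off t l') => //; rewrite ltxx.
    by rewrite !mulr0 subr0.
  - by rewrite /l' /r'; lra.
  - move=> x xlr xs; have xlr' : l < x < r by apply: sub; case/andP: xlr => /ltW -> /ltW ->.
    have [cu _ _] := ru x xlr'; have [cf _ _] := rf x xlr'; have [cS _ _] := rS x xlr'.
    split.
      have dM := is_deriveM (dm x xlr' xs) (dpsi t x).
      by apply: is_derive_eq dM _; rewrite /GRing.scale /= /psi; ring.
    apply: cvgD; first apply: cvgM; last by apply: cvgM; [exact: cS|exact: cpsi].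
      by apply: cvgB; [exact: cf|apply: cvgM; [exact: cvg_cst|exact: cu]].
    exact: cdpsi.
  - move=> x xlr; have xlr' : l < x < r by apply: sub; case/andP: xlr => -> /ltW ->.
    split; last by apply: cvgM; [exact: HR|exact/continuous_cvgr/cpsi].
    have [/cvg_ex[/= Sx cS] _] := regulated_cvg rS xlr'.
    apply/cvg_ex; eexists; apply: cvgD; apply: cvgM.
    + exact: HR.
    + exact: (continuous_cvgr (cdpsi t x)).
    + exact: cS.
    + exact: (continuous_cvgr (cpsi t x)).
  - move=> x xlr; have xlr' : l < x < r by apply: sub; case/andP: xlr => /ltW -> ->.
    split; last by apply: cvgM; [exact: HL|exact/continuous_cvgl/cpsi].
    have [_ /cvg_ex[/= Sx cS]] := regulated_cvg rS xlr'.
    apply/cvg_ex; eexists; apply: cvgD; apply: cvgM.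
    + exact: HL.
    + exact: (continuous_cvgl (cdpsi t x)).
    + exact: cS.
    + exact: (continuous_cvgl (cpsi t x)).
  - move=> x xlr; have xlr' : l < x < r by apply: sub; case/andP: xlr => /ltW -> /ltW ->.
    by rewrite HLR.
rewrite (_ : (fun t => _) = cst 0%E) ?integral0//.
by apply/funext => t; exact: inner.
Qed.

End weak_from_strong.

Section strong_from_weak.
Variable R : realType.
Local Notation mu := (@lebesgue_measure R).
Local Notation mu2 := (mu \x mu)%E.

Definition ramp (z : R) : R := Num.max 0 z.

Lemma ramp_continuous : continuous ramp.
Proof.
move=> z; apply: (@continuous_max _ _ (cst 0) id z); [exact: cvg_cst|exact: cvg_id].
Qed.

Lemma is_derive_ramp2 (z : R) : is_derive z 1 (fun y => ramp y ^+ 2) (2 * ramp z).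
Proof.
have [z0|z0|->] := ltgtP z 0.
- have -> : ramp z = 0 by rewrite /ramp max_l// ltW.
  rewrite mulr0; apply: (@near_eq_is_derive _ _ _ (cst (0 : R))).
  near=> y; rewrite /ramp max_l ?expr0n//.
  by apply: ltW; near: y; exact: lt_nbhsl.
- have -> : ramp z = z by rewrite /ramp max_r// ltW.
  have dz : is_derive z 1 (fun y : R => y ^+ 2) (2 * z).
    by apply: is_derive_eq; rewrite /GRing.scale /=; ring.
  apply: (near_eq_is_derive _ dz).
  near=> y; rewrite /ramp max_r//.
  by apply: ltW; near: y; exact: lt_nbhsr.
- apply/is_derive1_caratheodory; exists ramp; split.
  + move=> y; rewrite /ramp maxxx expr0n /= !subr0.
    have [y0|y0] := leP 0 y; first by rewrite expr2.
    by rewrite expr0n mul0r.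
  + exact: ramp_continuous.
  + by rewrite /ramp maxxx mulr0.
Unshelve. all: end_near. Qed.

(** A polynomial inside its support, so that its integral is explicit, and of
    class C1 because the ramp is squared. *)
Definition bump (d y : R) : R := ramp (d ^+ 2 - y ^+ 2) ^+ 2.
Definition dbump (d y : R) : R := - (4 * y * ramp (d ^+ 2 - y ^+ 2)).

Lemma is_derive_bump (d y : R) : is_derive y 1 (bump d) (dbump d y).
Proof.
have d1 : is_derive y 1 (fun y => d ^+ 2 - y ^+ 2) (- (2 * y)).
  by apply: is_derive_eq; rewrite /GRing.scale /=; ring.
have d3 := @is_derive1_comp _ (fun y => ramp y ^+ 2) (fun y => d ^+ 2 - y ^+ 2) y _ _ (is_derive_ramp2 _) d1.
by apply: is_derive_eq d3 _; rewrite /GRing.scale /= /dbump; ring.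
Qed.

Lemma bump_continuous d : continuous (bump d).
Proof. by move=> y; apply: derivable_continuous; case: (is_derive_bump d y). Qed.

Lemma dbump_continuous d : continuous (dbump d).
Proof.
move=> y; apply: cvgN; apply: cvgM; first by apply: cvgM; [exact: cvg_cst|exact: cvg_id].
have c1 : {for y, continuous (fun y : R => d ^+ 2 - y ^+ 2)}.
  by apply: cvgB; [exact: cvg_cst|exact: exprn_continuous].
exact: (continuous_comp c1 (@ramp_continuous _)).
Qed.

Lemma bump_out (d y : R) : 0 < d -> ~~ (- d < y < d) -> bump d y = 0 /\ dbump d y = 0.
Proof.
move=> d0 yd; rewrite /bump /dbump; suff -> : ramp (d ^+ 2 - y ^+ 2) = 0.
  by rewrite expr0n mulr0 oppr0.
by rewrite /ramp max_l//; move: yd; rewrite negb_and -!leNgt => /orP[?|?]; nra.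
Qed.

Lemma bump_ge0 d y : 0 <= bump d y.
Proof. exact: sqr_ge0. Qed.

Lemma bump_in (d y : R) : - d < y < d -> bump d y = (d ^+ 2 - y ^+ 2) ^+ 2.
Proof. by move=> /andP[? ?]; rewrite /bump /ramp max_r//; nra. Qed.

Lemma bump_integral (x0 d : R) : 0 < d ->
  (\int[mu]_(x in `](x0 - d)%R, (x0 + d)%R[) (bump d (x - x0))%:E = (16 / 15 * d ^+ 5)%:E)%E.
Proof.
move=> d0.
pose G (x : R) : R := d ^+ 4 * (x - x0) - 2 / 3 * d ^+ 2 * (x - x0) ^+ 3 + 5^-1 * (x - x0) ^+ 5.
have dG (x : R) : is_derive x 1 G ((d ^+ 2 - (x - x0) ^+ 2) ^+ 2).
  by rewrite /G; apply: is_derive_eq; rewrite /GRing.scale /=; field.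
have cG (x : R) : {for x, continuous G} by apply: derivable_continuous; case: (dG x).
rewrite (@smooth_FTC2 _ _ _ G _ (G (x0 - d)) (G (x0 + d))).
- by congr (_%:E); rewrite /G; field.
- lra.
- move=> x /andP[? ?]; split.
    by rewrite bump_in; [exact: dG|apply/andP; split; lra].
  apply: (@continuous_comp _ _ _ (fun x => x - x0) (bump d)); last exact: bump_continuous.
  by apply: cvgB; [exact: cvg_id|exact: cvg_cst].
- apply/cvg_ex; exists (bump d (x0 - d - x0)); apply: (@continuous_cvgr _ (fun x => bump d (x - x0))).
  apply: (@continuous_comp _ _ _ (fun x => x - x0) (bump d)); last exact: bump_continuous.
  by apply: cvgB; [exact: cvg_id|exact: cvg_cst].
- apply/cvg_ex; exists (bump d (x0 + d - x0)); apply: (@continuous_cvgl _ (fun x => bump d (x - x0))).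
  apply: (@continuous_comp _ _ _ (fun x => x - x0) (bump d)); last exact: bump_continuous.
  by apply: cvgB; [exact: cvg_id|exact: cvg_cst].
- exact/continuous_cvgr/cG.
- exact/continuous_cvgl/cG.
Qed.

(** A product in the coordinates [t] and [x - v * t], so that the reduced weak
    form factors. *)
Definition plane_bump (v x0 d : R) (p : R * R) : R := bump d p.1 * bump d (p.2 - v * p.1 - x0).

Lemma plane_bump_dx (v x0 d t x : R) :
  is_derive x 1 (fun y => plane_bump v x0 d (t, y)) (bump d t * dbump d (x - v * t - x0)).
Proof.
have d1 : is_derive x 1 (fun y => y - v * t - x0) 1.
  by apply: is_derive_eq; rewrite !subr0.
have d2 := @is_derive1_comp _ (bump d) (fun y => y - v * t - x0) x _ _ (is_derive_bump _ _) d1.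
have d3 := is_deriveZ (bump d t) d2.
by apply: is_derive_eq d3 _; rewrite /GRing.scale /= mulr1.
Qed.

Lemma plane_bump_dt (v x0 d t x : R) :
  is_derive t 1 (fun y => plane_bump v x0 d (y, x))
    (dbump d t * bump d (x - v * t - x0) - v * bump d t * dbump d (x - v * t - x0)).
Proof.
have d1 : is_derive t 1 (fun y => x - v * y - x0) (- v).
  by apply: is_derive_eq; rewrite /GRing.scale /=; ring.
have d2 := @is_derive1_comp _ (bump d) (fun y => x - v * y - x0) t _ _ (is_derive_bump _ _) d1.
have d3 := is_deriveM (is_derive_bump d t) d2.
by apply: is_derive_eq d3 _; rewrite /GRing.scale /=; ring.
Qed.

Lemma plane_bump_test (l r v x0 d : R) : 0 < d -> l < x0 - d -> x0 + d < r ->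
  test_function [set p | l < p.2 - v * p.1 < r] (plane_bump v x0 d).
Proof.
move=> d0 ld dr.
have cfst (f : R -> R) : continuous f -> continuous (fun p : R * R => f p.1).
  by move=> cf p; apply: (@continuous_comp _ _ _ fst f); [exact: cvg_fst|exact: cf].
have cxi0 : continuous (fun p : R * R => p.2 - v * p.1 - x0).
  by move=> p; apply: cvgB; [exact: continuous_xi|exact: cvg_cst].
have cxi (f : R -> R) : continuous f -> continuous (fun p : R * R => f (p.2 - v * p.1 - x0)).
  by move=> cf p; apply: (@continuous_comp _ _ _ (fun p : R * R => p.2 - v * p.1 - x0) f); [exact: cxi0|exact: cf].
have dtB : dt (plane_bump v x0 d) = (fun p => dbump d p.1 * bump d (p.2 - v * p.1 - x0) - v * bump d p.1 * dbump d (p.2 - v * p.1 - x0)).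
  by apply/funext => -[t x]; rewrite dtE; case: (plane_bump_dt v x0 d t x).
have dxB : dx (plane_bump v x0 d) = (fun p => bump d p.1 * dbump d (p.2 - v * p.1 - x0)).
  by apply/funext => -[t x]; rewrite dxE; case: (plane_bump_dx v x0 d t x).
pose K0 := [set p : R * R | - d <= p.1 <= d /\ - d <= p.2 - v * p.1 - x0 <= d].
have cK0 : closed K0.
  rewrite (_ : K0 = (fst @^-1` `[- d, d]) `&` ((fun p : R * R => p.2 - v * p.1 - x0) @^-1` `[- d, d])); last first.
    by apply/seteqP; split => p /=; rewrite !in_itv.
  apply: closedI.
    by move/continuous_closedP : (@continuous_fstR R); apply; exact: interval_closed.
  by move/continuous_closedP : cxi0; apply; exact: interval_closed.
have sK0 : closure [set p | plane_bump v x0 d p != 0] `<=` K0.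
  rewrite (closure_id K0).1//; apply: closure_subset => p /=.
  rewrite /plane_bump mulf_eq0 negb_or => /andP[n1 n2]; split.
    have [/andP[/ltW -> /ltW ->]//|/(bump_out d0)[E _]] := boolP (- d < p.1 < d).
    by rewrite E eqxx in n1.
  have [/andP[/ltW -> /ltW ->]//|/(bump_out d0)[E _]] := boolP (- d < p.2 - v * p.1 - x0 < d).
  by rewrite E eqxx in n2.
split.
- by move=> p; apply: cvgM; [apply: cfst|apply: cxi]; exact: bump_continuous.
- move=> [t x]; split.
    by apply/derivable_fstE; case: (plane_bump_dt v x0 d t x).
  by apply/derivable_sndE; case: (plane_bump_dx v x0 d t x).
- split.
    rewrite dtB => p; apply: cvgB.
      by apply: cvgM; [apply: cfst; exact: dbump_continuous|apply: cxi; exact: bump_continuous].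
    apply: cvgM; last by apply: cxi; exact: dbump_continuous.
    by apply: cvgM; [exact: cvg_cst|apply: cfst; exact: bump_continuous].
  rewrite dxB => p.
  by apply: cvgM; [apply: cfst; exact: bump_continuous|apply: cxi; exact: dbump_continuous].
- apply: (@subclosed_compact _ _ (`[- d, d] `*` `[x0 - d - `|v| * d, x0 + d + `|v| * d])%classic).
  + exact: closed_closure.
  + by apply: compact_setX; exact: segment_compact.
  + move=> p /sK0 [/andP[p1 p2] /andP[p3 p4]]; split => /=; rewrite in_itv /=; first by rewrite p1.
    have : `|v * p.1| <= `|v| * d by rewrite normrM ler_wpM2l// ler_norml p1.
    by rewrite ler_norml => /andP[? ?]; apply/andP; split; lra.
- move=> p /sK0 [_ /andP[p3 p4]] /=; apply/andP; split; lra.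
Qed.

Lemma continuous_integrable_oo (l r : R) (w : R -> R) :
  {within `[l, r], continuous w} -> mu.-integrable `]l, r[ (EFin \o w).
Proof.
move=> cw; apply: integrableS (continuous_compact_integrable _ cw); [by []|by []| |exact: segment_compact].
exact: subset_itv_oo_cc.
Qed.

Lemma integral_gt_bump (w : R -> R) (x0 d k : R) : 0 < d -> 0 < k ->
  {within `[x0 - d, x0 + d], continuous w} ->
  (forall x, x0 - d < x < x0 + d -> k * bump d (x - x0) <= w x) ->
  (0 < \int[mu]_(x in `](x0 - d)%R, (x0 + d)%R[) (w x)%:E)%E.
Proof.
move=> d0 k0 cw kw.
have iw : mu.-integrable `]x0 - d, x0 + d[ (EFin \o w).
  exact: continuous_integrable_oo.
have cb : continuous (fun x => k * bump d (x - x0)).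
  move=> x; apply: cvgM; first exact: cvg_cst.
  apply: (@continuous_comp _ _ _ (fun x => x - x0) (bump d)); last exact: bump_continuous.
  by apply: cvgB; [exact: cvg_id|exact: cvg_cst].
have cb1 : continuous (fun x => bump d (x - x0)).
  move=> x; apply: (@continuous_comp _ _ _ (fun x => x - x0) (bump d)); last exact: bump_continuous.
  by apply: cvgB; [exact: cvg_id|exact: cvg_cst].
have ib : mu.-integrable `]x0 - d, x0 + d[ (EFin \o (fun x => bump d (x - x0))).
  by apply: continuous_integrable_oo; exact: continuous_subspaceT.
have ikb : mu.-integrable `]x0 - d, x0 + d[ (EFin \o (fun x => k * bump d (x - x0))).
  by apply: continuous_integrable_oo; exact: continuous_subspaceT.
apply: (@lt_le_trans _ _ (\int[mu]_(x in `](x0 - d)%R, (x0 + d)%R[) (k * bump d (x - x0))%:E)%E); last first.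
  apply: le_integral => // x /set_mem; rewrite /= in_itv /= => xd.
  by rewrite lee_fin kw.
under eq_integral do rewrite EFinM.
rewrite integralZl// bump_integral// -EFinM lte_fin mulr_gt0// mulr_gt0 ?exprn_gt0//; lra.
Qed.

(** If the two sides differed at [x0], then [S - m'] would keep one strict
    sign near [x0]. Tested against a bump concentrated there, and after an
    integration by parts that moves the derivative from the bump to the
    relative flux, the reduced weak form would be a nonzero integral. *)
Lemma strong_of_weak (Omega : set (R * R)) (l r v x0 : R) (u f S m' : R -> R) : l < x0 < r ->
  [set p | l < p.2 - v * p.1 < r] `<=` Omega ->
  (forall x, l < x < r -> [/\ {for x, continuous u}, {for x, continuous f} & {for x, continuous S}]) ->
  (forall x, l < x < r -> is_derive x 1 (fun y => f y - v * u y) (m' x)) ->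
  (forall x, l < x < r -> {for x, continuous m'}) ->
  weak_balance_law Omega
    (fun p => u (p.2 - v * p.1)) (fun p => f (p.2 - v * p.1)) (fun p => S (p.2 - v * p.1)) ->
  m' x0 = S x0.
Proof.
move=> /andP[lx0 x0r] subO cufS dm cm' weak.
apply/eqP/negPn/negP => neq.
pose k := S x0 - m' x0.
have k0 : k != 0 by rewrite /k subr_eq0 eq_sym.
have cw0 : {for x0, continuous (fun x => S x - m' x)}.
  by apply: cvgB; [case: (cufS x0) => //; rewrite lx0|apply: cm'; rewrite lx0].
have e0 : 0 < `|k| / 2 by rewrite divr_gt0// normr_gt0.
have /cvgrPdist_lt/(_ _ e0)/nbhs_ballP[d1 /= d10 H1] := cw0.
(* Half the minimum keeps the closed interval of radius [d] inside the
   interval and inside the neighbourhood where [S - m'] is close to [k]. *)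
pose d := Num.min d1 (Num.min (x0 - l) (r - x0)) / 2.
have d0 : 0 < d by rewrite /d divr_gt0// !lt_min d10 !subr_gt0 lx0.
have d_lt : [/\ d < d1, l < x0 - d & x0 + d < r].
  have : 2 * d <= d1 /\ 2 * d <= x0 - l /\ 2 * d <= r - x0.
    by rewrite /d mulrC divfK// !ge_min !lexx !orbT.
  by case=> ? [? ?]; split; lra.
case: d_lt => dd1 ld dr.
have near_k x : x0 - d <= x <= x0 + d -> `|k - (S x - m' x)| < `|k| / 2.
  move=> xd; apply: H1; rewrite /ball /= ltr_distlC; case/andP: xd => ? ?.
  by apply/andP; split; lra.
have lr : l < r by lra.
have reg g : (forall x, l < x < r -> {for x, continuous g}) -> regulated [::] l r g.
  move=> cg x xlr; split; first by move=> _; exact: cg.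
    by apply/cvg_ex; exists (g x); exact/continuous_cvgr/cg.
  by apply/cvg_ex; exists (g x); exact/continuous_cvgl/cg.
have ru : regulated [::] l r u by apply: reg => x /cufS[].
have rf : regulated [::] l r f by apply: reg => x /cufS[].
have rS : regulated [::] l r S by apply: reg => x /cufS[].
have tphi := plane_bump_test v d0 ld dr.
have tphi' : test_function Omega (plane_bump v x0 d).
  by case: tphi => ? ? ? ? ?; split => //; exact: subset_trans subO.
have := weak _ tphi'.
rewrite (weak_form_reduction lr (regulated_measurable ru) (regulated_measurable rf)
  (regulated_measurable rS) (regulated_locally_bounded ru) (regulated_locally_bounded rf)
  (regulated_locally_bounded rS) tphi)//.
pose I : set R := `]x0 - d, x0 + d[%classic.
(* [g] is the product differentiated in the integration by parts, [g'] its
   derivative and [w] the remainder that carries the sign. *)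
pose g x := (f x - v * u x) * bump d (x - x0).
pose g' x := (f x - v * u x) * dbump d (x - x0) + m' x * bump d (x - x0).
pose w x := (S x - m' x) * bump d (x - x0).
have inlr x : x0 - d <= x <= x0 + d -> l < x < r.
  by move=> /andP[? ?]; apply/andP; split; lra.
have cshift (h : R -> R) : continuous h -> continuous (fun x => h (x - x0)).
  move=> ch x; apply: (@continuous_comp _ _ _ (fun x => x - x0) h); last exact: ch.
  by apply: cvgB; [exact: cvg_id|exact: cvg_cst].
have cg' x : x0 - d <= x <= x0 + d -> {for x, continuous g'}.
  move=> /inlr xlr; have [cu cf cS] := cufS _ xlr.
  apply: cvgD; apply: cvgM.
  - by apply: cvgB; [exact: cf|apply: cvgM; [exact: cvg_cst|exact: cu]].
  - by apply: cshift; exact: dbump_continuous.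
  - exact: cm'.
  - by apply: cshift; exact: bump_continuous.
have cw x : x0 - d <= x <= x0 + d -> {for x, continuous w}.
  move=> /inlr xlr; have [cu cf cS] := cufS _ xlr.
  apply: cvgM; first by apply: cvgB; [exact: cS|exact: cm'].
  by apply: cshift; exact: bump_continuous.
have dg (x : R) : x0 - d <= x <= x0 + d -> is_derive x 1 g (g' x).
  move=> /inlr xlr.
  have d1' : is_derive x 1 (fun y : R => bump d (y - x0)) (dbump d (x - x0)).
    have d2 : is_derive x 1 (fun y => y - x0) 1 by apply: is_derive_eq; rewrite subr0.
    have d3 := @is_derive1_comp _ (bump d) (fun y => y - x0) x _ _ (is_derive_bump _ _) d2.
    by apply: is_derive_eq d3 _; rewrite /GRing.scale /= mulr1.
  have dM := is_deriveM (dm x xlr) d1'.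
  by apply: is_derive_eq dM _; rewrite /GRing.scale /= /g'; ring.
have within_I (h : R -> R) : (forall x, x0 - d <= x <= x0 + d -> {for x, continuous h}) ->
    {within `[x0 - d, x0 + d], continuous h}.
  move=> ch; apply/continuous_in_subspaceT => x /set_mem; rewrite /= in_itv /=; exact: ch.
have int_I (h : R -> R) : (forall x, x0 - d <= x <= x0 + d -> {for x, continuous h}) -> mu.-integrable I (EFin \o h).
  by move=> ch; apply: continuous_integrable_oo; exact: within_I.
have int_g' : (\int[mu]_(x in I) (g' x)%:E = 0)%E.
  have ends : x0 - d <= x0 - d <= x0 + d /\ x0 - d <= x0 + d <= x0 + d.
    by rewrite !lexx andbT; split; lra.
  have cg x : x0 - d <= x <= x0 + d -> {for x, continuous g}.
    by move=> xd; apply: derivable_continuous; case: (dg x xd).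
  rewrite (@smooth_FTC2 _ _ _ g g' (g (x0 - d)) (g (x0 + d))).
  - rewrite /g.
    have [-> _] : bump d (x0 + d - x0) = 0 /\ dbump d (x0 + d - x0) = 0.
      by apply: bump_out => //; rewrite addrC addKr ltxx andbF.
    have [-> _] : bump d (x0 - d - x0) = 0 /\ dbump d (x0 - d - x0) = 0.
      by apply: bump_out => //; rewrite addrAC subrr add0r ltxx.
    by rewrite !mulr0 subr0.
  - lra.
  - by move=> x /andP[/ltW a1 /ltW a2]; split; [apply: dg|apply: cg']; rewrite a1.
  - by apply/cvg_ex; eexists; apply/continuous_cvgr/cg'; case: ends.
  - by apply/cvg_ex; eexists; apply/continuous_cvgl/cg'; case: ends.
  - by apply/continuous_cvgr/cg; case: ends.
  - by apply/continuous_cvgl/cg; case: ends.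
pose W := fine (\int[mu]_(x in I) (w x)%:E)%E.
have iw := int_I _ cw.
have WE : (\int[mu]_(x in I) (w x)%:E = W%:E)%E.
  rewrite /W fineK//; apply: (integrable_fin_num _ iw); exact: measurable_itv.
have inner t : (\int[mu]_x
     ((f x - v * u x) * dx (plane_bump v x0 d) (t, x + v * t) + S x * plane_bump v x0 d (t, x + v * t))%:E =
     (bump d t * W)%:E)%E.
  transitivity (\int[mu]_x (bump d t * (g' x + w x))%:E)%E.
    apply: eq_integral => x _; congr (_%:E).
    rewrite dxE; case: (plane_bump_dx v x0 d t (x + v * t)) => _ ->.
    by rewrite /plane_bump /= addrK /g' /w; ring.
  rewrite (integral_vanish_outside (l := x0 - d) (r := x0 + d)); last first.
    move=> x xd; rewrite /g' /w.
    have [-> ->] : bump d (x - x0) = 0 /\ dbump d (x - x0) = 0.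
      by apply: bump_out => //; apply: contra xd => /andP[? ?]; apply/andP; split; lra.
    by rewrite !mulr0 !addr0 mulr0.
  under eq_integral do rewrite EFinM.
  rewrite integralZl//; last first.
    by apply: (int_I (fun x => g' x + w x)) => x xd; apply: cvgD; [exact: cg'|exact: cw].
  under eq_integral do rewrite EFinD.
  by rewrite integralD//; [rewrite int_g' add0e WE EFinM|exact: int_I].
under eq_integral do rewrite inner.
rewrite (integral_vanish_outside (l := - d) (r := d)); last first.
  by move=> t td; case: (bump_out d0 td) => -> _; rewrite mul0r.
under eq_integral do rewrite EFinM muleC.
have ib : mu.-integrable (`]- d, d[%classic : set (measurableTypeR R)) (EFin \o bump d).
  by apply: continuous_integrable_oo; apply: continuous_subspaceT; exact: bump_continuous.
have Eb : (\int[mu]_(x in `](- d)%R, d[) (bump d x)%:E = (16 / 15 * d ^+ 5)%:E)%E.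
  rewrite -(bump_integral 0 d0) sub0r add0r; apply: eq_integral => x _.
  by congr (bump d _)%:E; rewrite subr0.
rewrite integralZl// Eb -EFinM /= => /eqP.
rewrite mulf_eq0 => /orP[|]; last first.
  by rewrite mulf_eq0 => /orP[]; [move/eqP; lra|rewrite expf_eq0 /= gt_eqF].
move=> /eqP W0.
have [k_lt|k_gt|/eqP] := ltgtP k 0; last by rewrite (negPf k0).
- have := @integral_gt_bump (fun x => - w x) x0 d (- k / 2) d0.
  have -> : (\int[mu]_(x in `](x0 - d)%R, (x0 + d)%R[) (- w x)%:E = 0)%E.
    under eq_integral do rewrite EFinN.
    by rewrite integralN ?WE ?W0 ?oppe0//; apply: integrable_add_def.
  rewrite ltxx => H; suff : false by []; apply: H; first lra.
    by apply: within_I => x xd; apply: cvgN; exact: cw.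
  move=> x /andP[/ltW a1 /ltW a2]; rewrite -mulNr ler_wpM2r ?bump_ge0//.
  have := near_k x; rewrite a1 a2 (ltr0_norm k_lt) ltr_norml => /(_ erefl) /andP[? ?]; lra.
- have := @integral_gt_bump w x0 d (k / 2) d0.
  rewrite WE W0 ltxx => H; suff : false by []; apply: H; first lra.
    exact: within_I.
  move=> x /andP[/ltW a1 /ltW a2]; rewrite ler_wpM2r ?bump_ge0//.
  have := near_k x; rewrite a1 a2 (gtr0_norm k_gt) ltr_norml => /(_ erefl) /andP[? ?]; lra.
Qed.

End strong_from_weak.

(** * The reduced problem *)

Section profiles.
Variable R : realType.
Implicit Types (s : seq R) (a b l r x c v alpha : R) (rho q H e : R -> R).

(** The one-variable problem solved by the density of a wave with relative
    momentum [alpha]; [e] is the drag at that momentum. Keeping [e] abstract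
    makes the class of profiles stable under reflection of the axis. *)
Record wave_profile c alpha e a b H s (rho L Rr : R -> R) : Prop := WaveProfile {
  profile_gt0 : forall x, a <= x <= b -> 0 < rho x;
  profile_right : forall x, a <= x < b -> rho y @[y --> x^'+] --> Rr x /\ 0 < Rr x;
  profile_left : forall x, a < x <= b -> rho y @[y --> x^'-] --> L x /\ 0 < L x;
  profile_ode : forall x, a < x < b -> x \notin s ->
    [/\ derivable rho x 1, {for x, continuous (derive1 rho)} &
        (c ^+ 2 - alpha ^+ 2 / rho x ^+ 2) * derive1 rho x = - (e (rho x) * derive1 H x)];
  profile_jump : forall x, a < x < b -> admissible_jump c alpha (L x) (Rr x);
  profile_jump_left : admissible_jump c alpha (rho a) (Rr a);
  profile_jump_right : admissible_jump c alpha (L b) (rho b) }.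

(** The terms in [v] cancel: at relative momentum [alpha] the relative
    momentum flux is [alpha ^+ 2 / rho + c ^+ 2 * rho] up to a constant. *)
Lemma flux_derive c v alpha (rho q : R -> R) (x r' : R) :
  rho x != 0 -> q x = alpha + v * rho x ->
  is_derive x 1 rho r' -> is_derive x 1 q (v * r') ->
  is_derive x 1 (fun y => flux c (rho y, q y) - v * q y)
    ((c ^+ 2 - alpha ^+ 2 / rho x ^+ 2) * r').
Proof.
move=> rx qx drho dq.
have d1 := is_deriveM dq dq.
have d2 := is_deriveV rx drho.
have d3 := is_deriveM d1 d2.
have d4 := is_deriveD d3 (is_deriveZ (c ^+ 2) drho).
have d5 := is_deriveB d4 (is_deriveZ v dq).
apply: is_derive_eq d5 _; have -> : (q * q) x = q x * q x by [].
by rewrite /GRing.scale /= qx; field.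
Qed.

Lemma flux_cvg {T : Type} (F : set_system T) {FF : Filter F} c (rho q : T -> R) (r0 q0 : R) : r0 != 0 ->
  rho @ F --> r0 -> q @ F --> q0 -> (fun y => flux c (rho y, q y)) @ F --> flux c (r0, q0).
Proof.
move=> r00 Hr Hq; apply: cvgD; last by apply: cvgM; [exact: cvg_cst|exact: Hr].
apply: cvgM; last exact: cvgV.
by rewrite expr2; under eq_fun do rewrite expr2; exact: cvgM.
Qed.

Lemma drag_cvg {T : Type} (F : set_system T) {FF : Filter F} (D : R -> R -> R) (rho al : T -> R) (r0 al0 : R) :
  drag_force D -> 0 < r0 -> rho @ F --> r0 -> al @ F --> al0 ->
  (fun y => D (rho y) (al y)) @ F --> D r0 al0.
Proof.
move=> [cD _ _ _] r00 Hr Ha.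
have cp : (rho y, al y) @[y --> F] --> (r0, al0) by apply: (@cvg_pair _ _ _ F (nbhs r0) (nbhs al0)).
exact: (cvg_comp _ _ cp (cD (r0, al0) r00)).
Qed.

Lemma exception_free_nbhs s a b x : a < x < b -> x \notin s ->
  exists l r, [/\ a < l, l < x < r, r < b & forall y, l < y < r -> y \notin s].
Proof.
move=> /andP[ax xb]; elim: s => [_|z s IH].
  by exists ((a + x) / 2), ((x + b) / 2); split; [lra|apply/andP; split; lra|lra|].
rewrite inE negb_or => /andP[xz /IH[l [r [al /andP[lx xr] rb free]]]].
have [zx|xz'|E] := ltgtP z x; last by rewrite E eqxx in xz.
- exists (Num.max l ((z + x) / 2)), r; split => //.
  + by rewrite lt_max al.
  + by rewrite gt_max lx xr !andbT; lra.
  + move=> y; rewrite gt_max => /andP[/andP[ly zy] yr]; rewrite inE negb_or free ?ly ?yr// andbT.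
    by apply/eqP => E; rewrite E in zy; lra.
- exists l, (Num.min r ((z + x) / 2)); split => //.
  + by rewrite lt_min lx xr /=; lra.
  + by rewrite gt_min rb.
  + move=> y; rewrite lt_min => /andP[ly /andP[yr yz]]; rewrite inE negb_or free ?ly ?yr// andbT.
    by apply/eqP => E; rewrite E in yz; lra.
Qed.

Lemma profile_regulated c alpha e a b H s rho L Rr :
  wave_profile c alpha e a b H s rho L Rr -> regulated s a b rho.
Proof.
move=> pf x /andP[ax xb]; split.
- by move=> xs; apply: derivable_continuous; case: (profile_ode pf _ xs) => //; rewrite ax.
- by apply/cvg_ex; exists (Rr x); case: (profile_right pf (x := x)) => //; rewrite (ltW ax).
- by apply/cvg_ex; exists (L x); case: (profile_left pf (x := x)) => //; rewrite (ltW xb) andbT.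
Qed.

(** In the mass equation the relative flux is the constant [alpha]. In the
    momentum equation it takes equal values on both sides of a jump, because
    the product of the two densities is [(alpha / c) ^+ 2], and elsewhere its
    derivative is the source by the differential equation. *)
Lemma profile_entropy_wave c D v eps H alpha s rho L Rr :
  0 < c -> drag_force D -> 0 < eps -> admissible_regularization eps H ->
  wave_profile c alpha (D^~ alpha) (- eps / 2) (eps / 2) H s rho L Rr ->
  entropy_wave c D v eps H rho (fun x => alpha + v * rho x).
Proof.
move=> c0 dragD eps0 [_ [dH cH] _ _ _] pf.
set a := - eps / 2; set b := eps / 2.
have ab : a < b by rewrite /a /b; lra.
set q := fun x => alpha + v * rho x.
have [rho0 rhoR rhoL ode jmp jmpa jmpb] := pf.
have qcvg (F : set_system R) (FF : Filter F) (y : R) : rho @ F --> y -> q @ F --> alpha + v * y.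
  by move=> Fy; apply: cvgD; [exact: cvg_cst|apply: cvgM; [exact: cvg_cst|exact: Fy]].
have Rlim x : a <= x < b -> right_limit rho q x = (Rr x, alpha + v * Rr x).
  move=> /rhoR[cR _]; rewrite /right_limit (cvg_lim _ cR)//.
  by rewrite (cvg_lim _ (qcvg _ _ _ cR)).
have Llim x : a < x <= b -> left_limit rho q x = (L x, alpha + v * L x).
  move=> /rhoL[cL _]; rewrite /left_limit (cvg_lim _ cL)//.
  by rewrite (cvg_lim _ (qcvg _ _ _ cL)).
have oo_co x : a < x < b -> a <= x < b by move=> /andP[/ltW -> ->].
have oo_oc x : a < x < b -> a < x <= b by move=> /andP[-> /ltW ->].
have oo_cc x : a < x < b -> a <= x <= b by move=> /andP[/ltW -> /ltW ->].
have aab : a <= a < b by rewrite lexx ab.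
have bab : a < b <= b by rewrite lexx ab.
have drho x : a < x < b -> x \notin s -> is_derive x 1 rho (derive1 rho x).
  by move=> xab xs; case: (ode x xab xs) => d _ _; rewrite derive1E; exact: derivableP.
have dq x : a < x < b -> x \notin s -> is_derive x 1 q (v * derive1 rho x).
  move=> xab xs.
  have := is_deriveD (is_derive_cst alpha x 1) (is_deriveZ v (drho x xab xs)).
  by rewrite add0r.
have rrho := profile_regulated pf.
have rq : regulated s a b q.
  move=> x xab; have [cr _] := rhoR x (oo_co _ xab); have [cl _] := rhoL x (oo_oc _ xab).
  split; first by move=> xs; apply: derivable_continuous; case: (dq x xab xs).
    by apply/cvg_ex; eexists; exact: (qcvg _ _ _ cr).
  by apply/cvg_ex; eexists; exact: (qcvg _ _ _ cl).
have rhoneq0 y : 0 < y -> y != 0 :> R by move=> y0; rewrite gt_eqF.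
have rf : regulated s a b (fun y => flux c (rho y, q y)).
  move=> x xab; have [cr Rx0] := rhoR x (oo_co _ xab); have [cl Lx0] := rhoL x (oo_oc _ xab).
  split.
  - move=> xs; have [cx _ _] := rrho x xab; have [cqx _ _] := rq x xab.
    by apply: flux_cvg; [exact/rhoneq0/rho0/oo_cc|exact: cx|exact: cqx].
  - by apply/cvg_ex; eexists; apply: flux_cvg; [exact: rhoneq0 Rx0|exact: cr|exact: (qcvg _ _ _ cr)].
  - by apply/cvg_ex; eexists; apply: flux_cvg; [exact: rhoneq0 Lx0|exact: cl|exact: (qcvg _ _ _ cl)].
have alE y : q y - v * rho y = alpha by rewrite /q addrK.
have rS : regulated s a b (fun y => - (D (rho y) (q y - v * rho y) * derive1 H y)).
  move=> x xab; have [cr Rx0] := rhoR x (oo_co _ xab); have [cl Lx0] := rhoL x (oo_oc _ xab).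
  have cHx : {for x, continuous (derive1 H)} by apply: cH; rewrite in_itv.
  rewrite (_ : (fun y => _) = (fun y => - (D (rho y) alpha * derive1 H y))); last first.
    by apply/funext => y; rewrite alE.
  split.
  - move=> xs; have [cx _ _] := rrho x xab.
    have cDx : {for x, continuous (fun y => D (rho y) alpha)}.
      apply: (@drag_cvg _ (nbhs x) _ D rho (cst alpha)) => //; last exact: cvg_cst.
        exact/rho0/oo_cc.
      exact: cx.
    by apply: cvgN; apply: cvgM; [exact: cDx|exact: cHx].
  - apply/cvg_ex; eexists; apply: cvgN; apply: cvgM; last exact: continuous_cvgr cHx.
    exact: (drag_cvg (al := cst alpha) dragD Rx0 cr (cvg_cst alpha)).
  - apply/cvg_ex; eexists; apply: cvgN; apply: cvgM; last exact: continuous_cvgl cHx.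
    exact: (drag_cvg (al := cst alpha) dragD Lx0 cl (cvg_cst alpha)).
split.
- split=> x xin.
  + by apply: rho0; rewrite in_itv in xin.
  + have xab : a <= x < b by rewrite in_itv in xin.
    by rewrite (Rlim x xab) /=; case: (rhoR x xab).
  + have xab : a < x <= b by rewrite in_itv in xin.
    by rewrite (Llim x xab) /=; case: (rhoL x xab).
- apply: (piecewise_smooth_partition (s := s)) => //.
    split=> [x xab xs|x xab|x xab]; first by case: (ode x xab xs).
      by apply/cvg_ex; exists (Rr x); case: (rhoR x xab).
    by apply/cvg_ex; exists (L x); case: (rhoL x xab).
  split=> [x xab xs|x xab|x xab].
  + split; first by case: (dq x xab xs).
    have cx : {for x, continuous (fun y => v * derive1 rho y)}.
      by case: (ode x xab xs) => _ cx _; apply: cvgM; [exact: cvg_cst|exact: cx].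
    have [l [r [al lxr rb free]]] := exception_free_nbhs xab xs.
    have E : \forall y \near x, v * derive1 rho y = derive1 q y.
      have : x \in `]l, r[ by rewrite in_itv.
      move=> /near_in_itvoo; apply: filterS => y; rewrite in_itv /= => lyr.
      have yab : a < y < b.
        by case/andP: lyr => ly yr; rewrite (lt_trans al ly) (lt_trans yr rb).
      by rewrite [RHS]derive1E; case: (dq y yab (free y lyr)) => _ ->.
    rewrite /prop_for /continuous_at -(nbhs_singleton E).
    by apply: cvg_trans cx; exact: near_eq_cvg.
  + by apply/cvg_ex; eexists; apply: qcvg; case: (rhoR x xab) => cr _; exact: cr.
  + by apply/cvg_ex; eexists; apply: qcvg; case: (rhoL x xab) => cl _; exact: cl.
- split.
    apply: (@weak_balance_of_FTC R a b v s rho q (fun=> 0) (fun=> alpha) (fun=> alpha)) => //.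
    + by move=> x xab; split=> [_||]; [exact: cvg_cst|exact: is_cvg_cst|exact: is_cvg_cst].
    + by move=> x _; rewrite (_ : (fun y => _) = cst alpha); [exact: cvg_cst|apply/funext => y; exact: alE].
    + by move=> x _; rewrite (_ : (fun y => _) = cst alpha); [exact: cvg_cst|apply/funext => y; exact: alE].
    + by move=> x _ _; rewrite (_ : (fun y => _) = cst alpha); [exact: is_derive_cst|apply/funext => y; exact: alE].
  apply: (@weak_balance_of_FTC R a b v s q (fun y => flux c (rho y, q y)) (fun y => - (D (rho y) (q y - v * rho y) * derive1 H y))
    (fun x => flux c (L x, alpha + v * L x) - v * (alpha + v * L x))
    (fun x => flux c (Rr x, alpha + v * Rr x) - v * (alpha + v * Rr x))) => //.
  + move=> x xab; have [cr Rx0] := rhoR x (oo_co _ xab).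
    apply: cvgB; first by apply: flux_cvg; [exact: rhoneq0|exact: cr|exact: qcvg].
    by apply: cvgM; [exact: cvg_cst|exact: qcvg].
  + move=> x xab; have [cl Lx0] := rhoL x (oo_oc _ xab).
    apply: cvgB; first by apply: flux_cvg; [exact: rhoneq0|exact: cl|exact: qcvg].
    by apply: cvgM; [exact: cvg_cst|exact: qcvg].
  + move=> x xab; have [_ Rx0] := rhoR x (oo_co _ xab); have [_ Lx0] := rhoL x (oo_oc _ xab).
    rewrite !fluxE//; case: (jmp x xab) => [->//|[<- _]].
    by field; rewrite !rhoneq0.
  + move=> x xab xs; have [_ _ E] := ode x xab xs.
    rewrite alE -E; apply: flux_derive => //; last exact: dq.
      exact/rhoneq0/rho0/oo_cc.
    exact: drho.
- move=> x; rewrite in_itv /= => xab; rewrite Rlim ?oo_co// Llim ?oo_oc//.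
  apply/continuous_or_shockP => //; last exact: jmp.
    by case: (rhoL x (oo_oc _ xab)).
  by case: (rhoR x (oo_co _ xab)).
- split.
    rewrite Rlim//; apply/continuous_or_shockP => //.
      by apply: rho0; rewrite lexx ltW.
    by case: (rhoR a aab).
  rewrite Llim//; apply/continuous_or_shockP => //.
    by case: (rhoL b bab).
  by apply: rho0; rewrite lexx ltW.
Qed.

(** The relative momentum has zero derivative off the breakpoints by the mass
    equation, and no jump by Rankine-Hugoniot, hence it is a constant [alpha].
    With [q] eliminated, the momentum equation is the differential equation
    for the density. *)
Lemma entropy_wave_profile c D v eps H rho q :
  0 < c -> drag_force D -> 0 < eps -> admissible_regularization eps H ->
  entropy_wave c D v eps H rho q ->
  exists alpha s L Rr,
    [/\ wave_profile c alpha (D^~ alpha) (- eps / 2) (eps / 2) H s rho L Rr,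
        q (- eps / 2) = alpha + v * rho (- eps / 2) &
        q (eps / 2) = alpha + v * rho (eps / 2)].
Proof.
move=> c0 dragD eps0 [_ [dH cH] _ _ _] [[rho0 Rr0 L0] [s [part pcrho pcq]] [weak1 weak2] jmp [jmpa jmpb]].
move: rho0 Rr0 L0 part pcrho pcq jmp jmpa jmpb.
set a := - eps / 2; set b := eps / 2 => rho0 Rr0 L0 part pcrho pcq jmp jmpa jmpb.
have ab : a < b by rewrite /a /b; lra.
have [rs1 rs2 rs3] := C1_on_pieces_smooth part pcrho.
have [qs1 qs2 qs3] := C1_on_pieces_smooth part pcq.
pose L x := lim (rho y @[y --> x^'-]); pose Rr x := lim (rho y @[y --> x^'+]).
pose QL x := lim (q y @[y --> x^'-]); pose QR x := lim (q y @[y --> x^'+]).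
have cL x : a < x <= b -> rho y @[y --> x^'-] --> L x by move=> /rs3.
have cR x : a <= x < b -> rho y @[y --> x^'+] --> Rr x by move=> /rs2.
have cQL x : a < x <= b -> q y @[y --> x^'-] --> QL x by move=> /qs3.
have cQR x : a <= x < b -> q y @[y --> x^'+] --> QR x by move=> /qs2.
have oo_co x : a < x < b -> a <= x < b by move=> /andP[/ltW -> ->].
have oo_oc x : a < x < b -> a < x <= b by move=> /andP[-> /ltW ->].
have oo_cc x : a < x < b -> a <= x <= b by move=> /andP[/ltW -> /ltW ->].
have aab : a <= a < b by rewrite lexx ab.
have bab : a < b <= b by rewrite lexx ab.
have drho x : a < x < b -> x \notin s -> is_derive x 1 rho (derive1 rho x).
  by move=> xab xs; case: (rs1 x xab xs) => d _; rewrite derive1E; exact: derivableP.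
have dq x : a < x < b -> x \notin s -> is_derive x 1 q (derive1 q x).
  by move=> xab xs; case: (qs1 x xab xs) => d _; rewrite derive1E; exact: derivableP.
have crho x : a < x < b -> x \notin s -> {for x, continuous rho}.
  by move=> xab xs; apply: derivable_continuous; case: (drho x xab xs).
have cq x : a < x < b -> x \notin s -> {for x, continuous q}.
  by move=> xab xs; apply: derivable_continuous; case: (dq x xab xs).
have dg x : a < x < b -> x \notin s ->
    is_derive x 1 (fun y => q y - v * rho y) (derive1 q x - v * derive1 rho x).
  by move=> xab xs; exact: is_deriveB (dq x xab xs) (is_deriveZ v (drho x xab xs)).
have subO l r : a < l -> r < b -> [set p : R * R | l < p.2 - v * p.1 < r] `<=` strip v eps.
  by move=> al rb p /= /andP[? ?]; rewrite /strip /= -/a -/b; apply/andP; split; lra.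
have mass x : a < x < b -> x \notin s -> derive1 q x - v * derive1 rho x = 0.
  move=> xab xs; have [l [r [al lxr rb free]]] := exception_free_nbhs xab xs.
  have sub y : l < y < r -> a < y < b by move=> /andP[? ?]; apply/andP; split; lra.
  apply: (@strong_of_weak R (strip v eps) l r v x rho q (fun=> 0) (fun y => derive1 q y - v * derive1 rho y)) => //.
  - exact: subO.
  - move=> y lyr; split; [exact: (crho y (sub y lyr) (free y lyr))|exact: (cq y (sub y lyr) (free y lyr))|exact: cvg_cst].
  - by move=> y lyr; apply: dg; [exact: sub|exact: free].
  - move=> y lyr; have [_ c1] := qs1 y (sub y lyr) (free y lyr).
    have [_ c2] := rs1 y (sub y lyr) (free y lyr).
    by apply: cvgB; [exact: c1|apply: cvgM; [exact: cvg_cst|exact: c2]].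
pose gL x := QL x - v * L x; pose gR x := QR x - v * Rr x.
have rankine Ul Ur : continuous_or_shock c v Ul Ur -> Ul.2 - v * Ul.1 = Ur.2 - v * Ur.1.
  by move=> [->//|[_ E _ _]]; lra.
have gLR x : a < x < b -> gL x = gR x.
  move=> xab; have xin : x \in `]a, b[ by rewrite in_itv.
  exact: (rankine _ _ (jmp x xin)).
(* Neither derivative nor jumps: the limits of the relative momentum at both
   ends of any subinterval agree. *)
have gconst l r : a <= l -> l < r -> r <= b -> gL r = gR l.
  move=> al lr rb.
  have := @piecewise_FTC2 R s l r (fun y => q y - v * rho y) (fun=> 0) gL gR lr.
  rewrite integral0 => H0; have : (0 : \bar R) = (gL r - gR l)%:E.
    apply: H0.
    - move=> x /andP[lx xr] xs; have xab : a < x < b by apply/andP; split; lra.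
      split; last exact: cvg_cst.
      by rewrite -(mass x xab xs); exact: dg.
    - move=> x /andP[lx xr]; have xab : a <= x < b by apply/andP; split; lra.
      split; first exact: is_cvg_cst.
      by apply: cvgB; [exact: cQR|apply: cvgM; [exact: cvg_cst|exact: cR]].
    - move=> x /andP[lx xr]; have xab : a < x <= b by apply/andP; split; lra.
      split; first exact: is_cvg_cst.
      by apply: cvgB; [exact: cQL|apply: cvgM; [exact: cvg_cst|exact: cL]].
    - by move=> x /andP[lx xr]; apply: gLR; apply/andP; split; lra.
  by move=> [] /esym /eqP; rewrite subr_eq0 => /eqP.
pose alpha := q a - v * rho a.
have gRa : gR a = alpha by have /rankine := jmpa.
have gLx x : a < x <= b -> gL x = alpha.
  by move=> /andP[ax xb]; rewrite (gconst a x).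
have gRx x : a <= x < b -> gR x = alpha.
  move=> /andP[]; rewrite le_eqVlt => /predU1P[<-//|ax xb].
  by rewrite -gLR ?gLx ?ax ?ltW.
have QLE x : a < x <= b -> QL x = alpha + v * L x by move=> /gLx <-; rewrite /gL subrK.
have QRE x : a <= x < b -> QR x = alpha + v * Rr x by move=> /gRx <-; rewrite /gR subrK.
have qb : q b = alpha + v * rho b.
  by have /rankine := jmpb; rewrite /= -/(QL b) -/(L b) -/(gL b) gLx// => ->; rewrite subrK.
have qa : q a = alpha + v * rho a by rewrite /alpha subrK.
have qx x : a < x < b -> x \notin s -> q x = alpha + v * rho x.
  move=> xab xs; rewrite -(gLx x (oo_oc _ xab)) /gL.
  have -> : QL x = q x by apply: cvg_lim => //; exact/continuous_cvgl/cq.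
  have -> : L x = rho x by apply: cvg_lim => //; exact/continuous_cvgl/crho.
  by rewrite subrK.
have rho0' x : a <= x <= b -> 0 < rho x by move=> xab; apply: rho0; rewrite in_itv.
have ode x : a < x < b -> x \notin s ->
    (c ^+ 2 - alpha ^+ 2 / rho x ^+ 2) * derive1 rho x = - (D (rho x) alpha * derive1 H x).
  move=> xab xs; have [l [r [al lxr rb free]]] := exception_free_nbhs xab xs.
  have sub y : l < y < r -> a < y < b by move=> /andP[? ?]; apply/andP; split; lra.
  have alE : q x - v * rho x = alpha by rewrite qx// addrK.
  rewrite -[in RHS]alE.
  have rneq0 y : l < y < r -> rho y != 0 by move=> /sub/oo_cc/rho0' r0; rewrite gt_eqF.
  apply: (@strong_of_weak R (strip v eps) l r v x q (fun y => flux c (rho y, q y))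
    (fun y => - (D (rho y) (q y - v * rho y) * derive1 H y))
    (fun y => (c ^+ 2 - alpha ^+ 2 / rho y ^+ 2) * derive1 rho y)) => //.
  - exact: subO.
  - move=> y lyr; have cr := crho y (sub y lyr) (free y lyr).
    have cqy := cq y (sub y lyr) (free y lyr); split.
    + exact: cqy.
    + by apply: flux_cvg; [exact: rneq0|exact: cr|exact: cqy].
    + have cDy : {for y, continuous (fun z => D (rho z) (q z - v * rho z))}.
        apply: (@drag_cvg _ (nbhs y) _ D rho (fun z => q z - v * rho z)) => //.
        * exact/rho0'/oo_cc/sub.
        * by apply: cvgB; [exact: cqy|apply: cvgM; [exact: cvg_cst|exact: cr]].
      apply: cvgN; apply: cvgM; first exact: cDy.
      by apply: cH; rewrite in_itv; exact: sub.
  - move=> y lyr; apply: flux_derive.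
    + exact: rneq0.
    + by apply: qx; [exact: sub|exact: free].
    + by apply: drho; [exact: sub|exact: free].
    + have -> : v * derive1 rho y = derive1 q y.
        by apply/esym/eqP; rewrite -subr_eq0; apply/eqP/mass; [exact: sub|exact: free].
      by apply: dq; [exact: sub|exact: free].
  - move=> y lyr; have cr := crho y (sub y lyr) (free y lyr).
    have [_ cdr] := rs1 y (sub y lyr) (free y lyr).
    apply: cvgM; last exact: cdr.
    apply: cvgB; first exact: cvg_cst.
    apply: cvgM; first exact: cvg_cst.
    apply: cvgV; first by rewrite expf_neq0// rneq0.
    have c2 : {for y, continuous (fun z => rho z * rho z)}.
      by apply: cvgM; exact: cr.
    exact: c2.
have Rr0' x : a <= x < b -> 0 < Rr x by move=> xab; apply: (Rr0 x); rewrite in_itv.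
have L0' x : a < x <= b -> 0 < L x by move=> xab; apply: (L0 x); rewrite in_itv.
have Rlim x : a <= x < b -> right_limit rho q x = (Rr x, alpha + v * Rr x).
  by move=> xab; rewrite -QRE.
have Llim x : a < x <= b -> left_limit rho q x = (L x, alpha + v * L x).
  by move=> xab; rewrite -QLE.
exists alpha, s, L, Rr; split => //; split => //.
- by move=> x xab; split; [exact: cR|exact: Rr0'].
- by move=> x xab; split; [exact: cL|exact: L0'].
- by move=> x xab xs; have [? ?] := rs1 x xab xs; split => //; exact: ode.
- move=> x xab; have xin : x \in `]a, b[ by rewrite in_itv.
  have := jmp x xin; rewrite (Rlim _ (oo_co _ xab)) (Llim _ (oo_oc _ xab)) => J.
  exact: (@continuous_or_shockP R c v alpha _ _ c0 (L0' _ (oo_oc _ xab)) (Rr0' _ (oo_co _ xab))).1 J.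
- have ra : 0 < rho a by apply: rho0'; rewrite lexx ltW.
  move: jmpa; rewrite (Rlim _ aab) qa => J.
  exact: (@continuous_or_shockP R c v alpha _ _ c0 ra (Rr0' _ aab)).1 J.
- have rb : 0 < rho b by apply: rho0'; rewrite lexx ltW.
  move: jmpb; rewrite (Llim _ bab) qb => J.
  exact: (@continuous_or_shockP R c v alpha _ _ c0 (L0' _ bab) rb).1 J.
Qed.

End profiles.

(** * Reflection of the axis *)

Section mirror.
Variable R : realType.
Implicit Types (s : seq R) (a b x c alpha : R) (rho H e : R -> R).

Lemma is_derive_mirror (f : R -> R) x : derivable f (- x) 1 ->
  is_derive x 1 (fun y => f (- y)) (- derive1 f (- x)).
Proof.
move=> df.
have d1 : is_derive (- x) 1 f (derive1 f (- x)) by rewrite derive1E; exact: derivableP.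
have d2 := @is_derive1_comp _ f -%R x _ _ d1 (is_deriveNid x 1).
by apply: is_derive_eq d2 _; rewrite /GRing.scale /= mulrN1.
Qed.

Lemma admissible_jump_mirror c alpha (l r : R) :
  admissible_jump c alpha l r -> admissible_jump c (- alpha) r l.
Proof.
move=> [->|[E al]]; [by left|right].
by split; [rewrite sqrrN -E; ring|rewrite mulNr -mulrN opprB].
Qed.

(** Reflection exchanges the two sides of each jump and reverses the relative
    momentum. It changes the sign of the derivative of the density but not
    that of the regularization, so the drag changes sign as well. *)
Lemma wave_profile_mirror c alpha e a b H s rho (L Rr : R -> R) :
  C1_itv a b H -> wave_profile c alpha e a b H s rho L Rr ->
  wave_profile c (- alpha) (fun r => - e r) (- b) (- a) (fun x => 1 - H (- x))
    [seq - x | x <- s] (fun x => rho (- x)) (fun x => Rr (- x)) (fun x => L (- x)).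
Proof.
move=> [dH cH] [rho0 rhoR rhoL ode jmp jmpa jmpb].
have flip x : - b < x < - a -> a < - x < b by move=> /andP[? ?]; apply/andP; split; lra.
split.
- by move=> x /andP[? ?]; apply: rho0; apply/andP; split; lra.
- move=> x /andP[? ?]; have [|cL L0] := rhoL (- x); first by apply/andP; split; lra.
  by split => //; move/cvg_at_leftNP : cL; rewrite opprK.
- move=> x /andP[? ?]; have [|cR R0] := rhoR (- x); first by apply/andP; split; lra.
  by split => //; move/cvg_at_rightNP : cR; rewrite opprK.
- move=> x xab xs; have xab' := flip _ xab.
  have nxs : - x \notin s.
    by apply: contra xs => xs; rewrite -(opprK x); apply: map_f.
  have [dr cdr E] := ode _ xab' nxs.
  have d1 := is_derive_mirror dr.
  have dHx : derivable H (- x) 1 by apply: dH; rewrite in_itv.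
  have d2 : is_derive x 1 (fun x => 1 - H (- x)) (derive1 H (- x)).
    have := is_deriveB (is_derive_cst (1 : R) x 1) (is_derive_mirror dHx).
    by rewrite sub0r opprK.
  split.
  + by case: d1.
  + have [l [r [al lxr rb free]]] := exception_free_nbhs xab' nxs.
    have E' : \forall y \near x, - derive1 rho (- y) = derive1 (fun y => rho (- y)) y.
      have : x \in `](- r), (- l)[ by rewrite in_itv /=; case/andP: lxr => ? ?; apply/andP; split; lra.
      move=> /near_in_itvoo; apply: filterS => y; rewrite in_itv /= => /andP[? ?].
      have ly : l < - y < r by apply/andP; split; lra.
      have yab : a < - y < b by apply/andP; split; lra.
      have [dry _ _] := ode _ yab (free _ ly).
      by rewrite [RHS]derive1E; case: (is_derive_mirror dry) => _ ->.
    rewrite /prop_for /continuous_at -(nbhs_singleton E').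
    have cx : - derive1 rho (- y) @[y --> x] --> - derive1 rho (- x).
      apply: cvgN; apply: (@continuous_comp _ _ _ -%R (derive1 rho)); last exact: cdr.
      exact: oppr_continuous.
    by apply: cvg_trans cx; exact: near_eq_cvg.
  + rewrite [in LHS]derive1E; case: d1 => _ ->.
    rewrite [in RHS]derive1E; case: d2 => _ ->.
    by rewrite sqrrN mulrN E; ring.
- by move=> x xab; apply: admissible_jump_mirror; apply: jmp; exact: flip.
- by apply: admissible_jump_mirror; rewrite opprK.
- by apply: admissible_jump_mirror; rewrite opprK.
Qed.

Lemma C1_itv_mirror a b H : C1_itv a b H -> C1_itv (- b) (- a) (fun x => 1 - H (- x)).
Proof.
move=> [dH cH].
have flip x : x \in `](- b), (- a)[ -> - x \in `]a, b[.
  by rewrite !in_itv /= => /andP[? ?]; apply/andP; split; lra.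
have d2 x : x \in `](- b), (- a)[ -> is_derive x 1 (fun x => 1 - H (- x)) (derive1 H (- x)).
  move=> xab; have := is_deriveB (is_derive_cst (1 : R) x 1) (is_derive_mirror (dH _ (flip _ xab))).
  by rewrite sub0r opprK.
split=> x xab; first by case: (d2 x xab).
have E' : \forall y \near x, derive1 H (- y) = derive1 (fun y => 1 - H (- y)) y.
  move: (xab) => /near_in_itvoo; apply: filterS => y yab.
  by rewrite [RHS]derive1E; case: (d2 y yab).
rewrite /continuous_at -(nbhs_singleton E').
have cx : derive1 H (- y) @[y --> x] --> derive1 H (- x).
  apply: (@continuous_comp _ _ _ -%R (derive1 H)); last by apply: cH; exact: flip.
  exact: oppr_continuous.
by apply: cvg_trans cx; exact: near_eq_cvg.
Qed.

Lemma admissible_regularization_mirror eps H : admissible_regularization eps H ->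
  admissible_regularization eps (fun x => 1 - H (- x)).
Proof.
move=> [cH C1H monoH H0 H1]; split.
- move=> x; apply: cvgB; first exact: cvg_cst.
  by apply: (@continuous_comp _ _ _ -%R H); [exact: oppr_continuous|exact: cH].
- by have := C1_itv_mirror C1H; rewrite mulNr opprK.
- by move=> x y xy; rewrite lerD2l lerN2; apply: monoH; rewrite lerN2.
- by move=> x xe; rewrite H1 ?subrr//; lra.
- by move=> x xe; rewrite H0 ?subr0//; lra.
Qed.

End mirror.

(** * Profiles satisfy the germ condition *)

Section potential.
Variable R : realType.
Variables (c w : R) (e F : R -> R).
Hypothesis c0 : 0 < c.
Hypothesis w0 : 0 < w.
Hypothesis e0 : forall r, 0 < r -> 0 < e r.
Hypothesis dF : forall r : R, 0 < r -> is_derive r 1 F ((c ^+ 2 - w ^+ 2 / r ^+ 2) / e r).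
Hypothesis Fs : F (w / c) = 0.

Let s := w / c.
Let s0 : 0 < s. Proof. exact: divr_gt0. Qed.
Let cs : c * s = w. Proof. by rewrite /s mulrC divfK// gt_eqF. Qed.

Lemma potential_continuous r : 0 < r -> {for r, continuous F}.
Proof. by move=> r0; apply: derivable_continuous; case: (dF r0). Qed.

Lemma potential_within p q : 0 < p -> {within `[p, q], continuous F}.
Proof.
move=> p0; apply/continuous_in_subspaceT => x /set_mem; rewrite /= in_itv /= => /andP[px _].
exact/potential_continuous/lt_le_trans/px.
Qed.

Lemma potential_slopeE r : 0 < r ->
  c ^+ 2 - w ^+ 2 / r ^+ 2 = c ^+ 2 / r ^+ 2 * ((r + s) * (r - s)).
Proof. by move=> r0; rewrite -cs; field; rewrite gt_eqF. Qed.

Lemma slope_neq0 r : 0 < r -> r != s -> c ^+ 2 - w ^+ 2 / r ^+ 2 != 0.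
Proof.
move=> r0 rs; rewrite potential_slopeE// !mulf_neq0 ?invr_neq0 ?expf_neq0 ?subr_eq0// gt_eqF//.
exact: addr_gt0.
Qed.

Lemma potential_decr x y : 0 < x -> x < y -> y <= s -> F y < F x.
Proof.
move=> x0 xy ys.
have [|z] := MVT xy _ (@potential_within x y x0) (df := fun r => (c ^+ 2 - w ^+ 2 / r ^+ 2) / e r).
  by move=> z; rewrite in_itv /= => /andP[xz _]; apply: dF; exact: lt_trans xz.
rewrite in_itv /= => /andP[xz zy] E; rewrite -subr_lt0 E.
have z0 : 0 < z by exact: lt_trans xz.
rewrite potential_slopeE// pmulr_llt0 ?subr_gt0//.
rewrite pmulr_llt0 ?invr_gt0 ?e0// pmulr_rlt0; last by rewrite divr_gt0 ?exprn_gt0.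
by rewrite pmulr_rlt0 ?addr_gt0// subr_lt0; exact: lt_le_trans ys.
Qed.

Lemma potential_incr x y : s <= x -> x < y -> F x < F y.
Proof.
move=> sx xy; have x0 : 0 < x by exact: lt_le_trans sx.
have [|z] := MVT xy _ (@potential_within x y x0) (df := fun r => (c ^+ 2 - w ^+ 2 / r ^+ 2) / e r).
  by move=> z; rewrite in_itv /= => /andP[xz _]; apply: dF; exact: lt_trans xz.
rewrite in_itv /= => /andP[xz zy] E; rewrite -subr_gt0 E.
have z0 : 0 < z by exact: lt_trans xz.
rewrite potential_slopeE//; apply: mulr_gt0; last by rewrite subr_gt0.
apply: divr_gt0; last exact: e0.
apply: mulr_gt0; first by rewrite divr_gt0// exprn_gt0.
by apply: mulr_gt0; [exact: addr_gt0|rewrite subr_gt0; exact: le_lt_trans xz].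
Qed.

Lemma potential_gt0 r : 0 < r -> r != s -> 0 < F r.
Proof.
move=> r0 rs; have [rs'|sr|E] := ltgtP r s; last by rewrite E eqxx in rs.
  by rewrite -Fs potential_decr.
by rewrite -Fs potential_incr.
Qed.

Lemma potential_le0 r : 0 < r -> F r <= 0 -> r = s.
Proof.
by move=> r0; apply: contraTeq => rs; rewrite -ltNge; exact: potential_gt0.
Qed.

(** The product of the two densities is [s ^+ 2] and [l < r], so [s] lies
    strictly between them. *)
Lemma jump_cases l r : 0 < l -> 0 < r -> admissible_jump c w l r ->
  l = r \/ [/\ l < s, s < r & r = w ^+ 2 / (c ^+ 2 * l)].
Proof.
move=> l0 r0 [->|[E wlr]]; [by left|right].
have lr : l < r by move: wlr; rewrite pmulr_rgt0// subr_gt0.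
have rE : r = w ^+ 2 / (c ^+ 2 * l).
  by rewrite -E; field; rewrite !gt_eqF.
have lrs : l * r = s ^+ 2 by rewrite rE -cs; field; rewrite !gt_eqF.
have [ls|sl] := ltP l s.
  split => //; rewrite ltNge; apply/negP => rs.
  have : l * r < s ^+ 2 by rewrite expr2; nra.
  by rewrite lrs ltxx.
have sr : s < r by exact: le_lt_trans lr.
have : s ^+ 2 < l * r.
  by rewrite expr2 (@le_lt_trans _ _ (l * s))// ?ler_wpM2r ?ltr_pM2l// ltW.
by rewrite lrs ltxx.
Qed.

(** The germ at a positive relative momentum: the first alternative is a wave
    without jump, the second a wave with one jump, [theta] being the value of
    the regularization at the jump. *)
Definition wave_connection (rm rp : R) :=
  (0 <= (s - rp) * (s - rm) /\ F rm - F rp = 1) \/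
  [/\ rm < s, s <= rp &
   exists rho theta : R, [/\ rm <= rho < s, 0 <= theta <= 1, F rm - F rho = theta &
      F (w ^+ 2 / (c ^+ 2 * rho)) - F rp = 1 - theta]].

Section necessity.
Variables (a b : R) (H : R -> R) (t : seq R) (rho L Rr : R -> R).
Hypothesis ab : a < b.
Hypothesis cH : continuous H.
Hypothesis dH : forall x, a < x < b -> derivable H x 1.
Hypothesis monoH : {homo H : x y / x <= y}.
Hypothesis Ha : H a = 0.
Hypothesis Hb : H b = 1.
Hypothesis pf : wave_profile c w e a b H t rho L Rr.

Let rho0 := profile_gt0 pf.

(** This is the differential equation divided by [e (rho x)]. *)
Lemma profile_conserved x : a < x < b -> x \notin t ->
  is_derive x 1 (fun y => F (rho y) + H y) 0.
Proof.
move=> xab xt; have [dr _ E] := profile_ode pf xab xt.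
have x0 : 0 < rho x by apply: rho0; case/andP: xab => /ltW -> /ltW ->.
have d1 : is_derive x 1 rho (derive1 rho x) by rewrite derive1E; exact: derivableP.
have d2 := @is_derive1_comp _ F rho x _ _ (dF x0) d1.
have d3 : is_derive x 1 H (derive1 H x) by rewrite derive1E; apply: derivableP; exact: dH.
apply: is_derive_eq (is_deriveD d2 d3) _.
rewrite /GRing.scale /= mulrAC E mulNr mulrAC divff ?mul1r ?addNr//.
by rewrite gt_eqF// e0.
Qed.

Lemma smooth_arc_potential l r : a <= l -> l < r -> r <= b ->
  (forall x, l < x < r -> x \notin t) ->
  F (Rr l) + H l = F (L r) + H r /\
  (forall x, l < x < r -> F (Rr l) + H l = F (rho x) + H x).
Proof.
move=> al lr rb free.
have sub x : l < x < r -> a < x < b by move=> /andP[? ?]; apply/andP; split; lra.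
have [|cl Rl0] := profile_right pf (x := l); first by apply/andP; split; lra.
have [|cr Lr0] := profile_left pf (x := r); first by apply/andP; split; lra.
have Gl : F (rho y) + H y @[y --> l^'+] --> F (Rr l) + H l.
  apply: cvgD; last exact/continuous_cvgr/cH.
  exact: (cvg_comp _ _ cl (potential_continuous Rl0)).
have Gr : F (rho y) + H y @[y --> r^'-] --> F (L r) + H r.
  apply: cvgD; last exact/continuous_cvgl/cH.
  exact: (cvg_comp _ _ cr (potential_continuous Lr0)).
have ftc (l' r' gl gr : R) : l <= l' -> l' < r' -> r' <= r ->
    F (rho y) + H y @[y --> l'^'+] --> gl -> F (rho y) + H y @[y --> r'^'-] --> gr -> gl = gr.
  move=> ll' l'r' r'r cgl cgr.
  have := @smooth_FTC2 R l' r' (fun y => F (rho y) + H y) (fun=> 0) gl gr l'r'.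
  rewrite integral0 => E; have : (0 : \bar R) = (gr - gl)%:E.
    apply: E => //; [|exact: is_cvg_cst|exact: is_cvg_cst].
    move=> x /andP[l'x xr']; split; last exact: cvg_cst.
    have xlr : l < x < r by apply/andP; split; lra.
    by apply: profile_conserved; [exact: sub|exact: free].
  by move=> [] /esym /eqP; rewrite subr_eq0 => /eqP.
split; first by apply: (ftc l r).
move=> x xlr; apply: (ftc l x) => //; [lra..|].
  have [dr _ _] := profile_ode pf (sub _ xlr) (free _ xlr).
  have x0 : 0 < rho x by apply: rho0; case/andP: (sub _ xlr) => /ltW -> /ltW ->.
  apply: cvgD; last exact/continuous_cvgl/cH.
  exact: (cvg_comp _ _ (continuous_cvgl (derivable_continuous dr)) (potential_continuous x0)).
Qed.

(** Along an arc [F] does not increase, and [s] is its only minimum point with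
    value [0]: an arc that reaches [s] remains there. An arc with ends
    strictly on different sides of [s] would meet [s] and then end at [s]. *)
Lemma smooth_arc_same_side l r : a <= l -> l < r -> r <= b ->
  (forall x, l < x < r -> x \notin t) ->
  0 <= (s - Rr l) * (s - L r) /\ (Rr l = s -> L r = s).
Proof.
move=> al lr rb free.
have [E1 E2] := smooth_arc_potential al lr rb free.
have sub x : l < x < r -> a < x < b by move=> /andP[? ?]; apply/andP; split; lra.
have [|cl Rl0] := profile_right pf (x := l); first by apply/andP; split; lra.
have [|cr Lr0] := profile_left pf (x := r); first by apply/andP; split; lra.
have stay : Rr l = s -> L r = s.
  move=> Es; apply: potential_le0 => //.
  move: E1; rewrite Es Fs add0r => E1.
  by have := monoH (ltW lr); lra.
split => //; rewrite leNgt; apply/negP => neg.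
pose rx := extend_ends l r (Rr l) (L r) rho.
have crx : {within `[l, r], continuous rx}.
  apply: extend_ends_continuous => // x xlr.
  by have [dr _ _] := profile_ode pf (sub _ xlr) (free _ xlr); exact: derivable_continuous.
have rxl : rx l = Rr l by rewrite /rx /extend_ends eqxx.
have rxr : rx r = L r by rewrite /rx /extend_ends eqxx gt_eqF.
have [|x xlr rxs] := @IVT R rx l r s (ltW lr) crx.
  rewrite rxl rxr; case: (leP (Rr l) (L r)) => ?.
    by apply/andP; split; rewrite leNgt; apply/negP => h; nra.
  by apply/andP; split; rewrite leNgt; apply/negP => h; nra.
have xlr' : l < x < r.
  move: xlr; rewrite in_itv /= !le_eqVlt => /andP[/predU1P[E|->] /predU1P[E'|->]] //.
  - by exfalso; move: neg; rewrite -rxl E rxs subrr mul0r ltxx.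
  - by exfalso; move: neg; rewrite -rxl E rxs subrr mul0r ltxx.
  - by exfalso; move: neg; rewrite -rxr -E' rxs subrr mulr0 ltxx.
move: rxs; rewrite /rx extend_ends_id// => rxs.
have := E2 _ xlr'; rewrite rxs Fs add0r E1 => E3.
have Ls : L r = s.
  apply: potential_le0 => //; have xr : x <= r by case/andP: xlr' => _ /ltW.
  by have := monoH xr; lra.
by move: neg; rewrite Ls subrr mulr0 ltxx.
Qed.

(** The relation [wave_connection] with the total increment [1] of the
    regularization replaced by the increment [h] up to an intermediate point:
    it is the invariant carried along the profile. *)
Definition reached (r h : R) :=
  (0 <= (s - r) * (s - rho a) /\ F (rho a) - F r = h) \/
  [/\ rho a < s, s <= r &
   exists rho1 theta : R, [/\ rho a <= rho1 < s, 0 <= theta <= h, F (rho a) - F rho1 = theta &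
      F (w ^+ 2 / (c ^+ 2 * rho1)) - F r = h - theta]].

(** A jump starts below [s]. This excludes an earlier jump, after which the
    density is at least [s]; so the state before the jump is in the first
    alternative, and the jump takes it to the second one with [theta = h]. *)
Lemma reached_jump l r h : 0 <= h -> 0 < l -> 0 < r -> admissible_jump c w l r ->
  reached l h -> reached r h.
Proof.
move=> h0 l0 r0 /(jump_cases l0 r0)[->//|[ls sr rE]].
have ra0 : 0 < rho a by apply: rho0; rewrite lexx ltW.
case=> [[side E]|[_ sl _]]; last by lra.
have ras : rho a <= s by rewrite leNgt; apply/negP => h'; nra.
have ras' : rho a < s.
  rewrite lt_neqAle ras andbT; apply/eqP => E'; move: E; rewrite E' Fs sub0r => E.
  have : l = s by apply: potential_le0 => //; lra.
  lra.
right; split => //; first exact: ltW.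
exists l, h; split => //.
- rewrite ls andbT leNgt; apply/negP => la.
  by have := potential_decr l0 la ras; lra.
- by rewrite h0 lexx.
- by rewrite -rE !subrr.
Qed.

Lemma reached_arc l r : a <= l -> l < r -> r <= b -> reached (Rr l) (H l) -> reached (L r) (H r).
Proof.
move: l r; apply: (@finite_exception_ind _ t) => [l r al lr rb free|l x r al lx xr rb IH1 IH2 /IH1 Rx].
  have [E1 _] := smooth_arc_potential al lr rb free.
  have [side stay] := smooth_arc_same_side al lr rb free.
  have Hlr := monoH (ltW lr).
  case=> [[side' E]|[ras sl [r1 [th [r1s /andP[th0 thh] E3 E4]]]]].
    left; split; last by lra.
    have [Es|Rls] := eqVneq (Rr l) s; first by rewrite (stay Es) subrr mul0r.
    (* The square transfers the sign condition from one pair of densities to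
       the next. *)
    have sq : 0 < (s - Rr l) ^+ 2 by rewrite exprn_even_gt0//= subr_eq0 eq_sym.
    rewrite -(pmulr_rge0 _ sq).
    rewrite (_ : (s - Rr l) ^+ 2 * _ = ((s - Rr l) * (s - L r)) * ((s - Rr l) * (s - rho a))); last by ring.
    exact: mulr_ge0.
  right; split => //.
    have [Es|Rls] := eqVneq (Rr l) s; first by rewrite (stay Es).
    have sR : s < Rr l by rewrite lt_neqAle eq_sym Rls sl.
    by rewrite leNgt; apply/negP => h; nra.
  exists r1, th; split => //; last by lra.
  by rewrite th0 (le_trans thh).
apply: IH2; apply: reached_jump Rx.
- by rewrite -Ha; apply: monoH; lra.
- by have [|_ ->] := profile_left pf (x := x); first by apply/andP; split; lra.
- by have [|_ ->] := profile_right pf (x := x); first by apply/andP; split; lra.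
- by apply: (profile_jump pf); apply/andP; split; lra.
Qed.

Lemma profile_connection : wave_connection (rho a) (rho b).
Proof.
have ra0 : 0 < rho a by apply: rho0; rewrite lexx ltW.
have rb0 : 0 < rho b by apply: rho0; rewrite lexx ltW.
have [|_ Ra0] := profile_right pf (x := a); first by rewrite lexx ab.
have [|_ Lb0] := profile_left pf (x := b); first by rewrite lexx ab.
have st : reached (rho a) 0 by left; rewrite subrr -expr2 sqr_ge0.
have : reached (Rr a) (H a).
  by rewrite Ha; apply: reached_jump st => //; exact: (profile_jump_left pf).
move=> /(reached_arc (lexx a) ab (lexx b)); rewrite Hb => /reached_jump.
by apply => //; exact: (profile_jump_right pf).
Qed.

End necessity.
End potential.

(** * Construction of a profile from the potential *)

Section branches.
Variable R : realType.

Lemma clamp_continuous (p q : R) (G : R -> R) : p <= q ->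
  {within `[p, q], continuous G} -> continuous (fun y => G (Num.max p (Num.min q y))).
Proof.
move=> pq /subspace_continuousP cG y.
have clampP z : `[p, q]%classic (Num.max p (Num.min q z)).
  by rewrite /= in_itv /= le_max lexx /= ge_max pq ge_min lexx.
have cc : {for y, continuous (fun z => Num.max p (Num.min q z))}.
  apply: (@continuous_max _ _ (cst p) (fun z => Num.min q z) y); first exact: cvg_cst.
  by apply: (@continuous_min _ _ (cst q) id y); [exact: cvg_cst|exact: cvg_id].
have cw : Num.max p (Num.min q z) @[z --> y] --> within `[p, q]%classic (nbhs (Num.max p (Num.min q y))).
  move=> A wA.
  have : nbhs y ((fun z => Num.max p (Num.min q z)) @^-1` [set z | `[p, q]%classic z -> A z]) := cc _ wA.
  by apply: filterS => z; exact: (fun h => h (clampP z)).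
exact: (cvg_comp _ _ cw (cG _ (clampP y))).
Qed.

(** The inverse is extended by constants beyond the image of the segment, so
    that it can be composed with any continuous function. It is differentiable
    only at inner points: the derivative of the potential vanishes at the
    sonic end of a branch. *)
Lemma inverse_branch (F F' : R -> R) (p q : R) : p < q ->
  (forall x : R, p <= x <= q -> is_derive x 1 F (F' x)) ->
  (forall x, p < x < q -> F' x != 0) ->
  {in `[p, q] &, injective F} ->
  exists G : R -> R, [/\ continuous G,
    forall x, p <= x <= q -> G (F x) = x &
    forall x : R, p < x < q -> is_derive (F x) 1 G (F' x)^-1].
Proof.
move=> pq dF F'0 injF.
have cF : {within `[p, q], continuous F}.
  apply/continuous_in_subspaceT => x /set_mem; rewrite /= in_itv /= => xpq.
  by apply: derivable_continuous; case: (dF x xpq).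
pose G0 y := get [set x | x \in `[p, q] /\ F x = y].
have G0K : {in `[p, q], cancel F G0}.
  move=> x xpq; have [] : [set z | z \in `[p, q] /\ F z = F x] (G0 (F x)).
    by apply: getPex; exists x.
  by move=> zpq /injF; apply.
have cG0 := segment_can_continuous (ltW pq) cF G0K.
set lo := Num.min (F p) (F q) in cG0; set hi := Num.max (F p) (F q) in cG0.
have lohi : lo <= hi by rewrite /lo /hi; case: (leP (F p) (F q)) => // /ltW.
pose G y := G0 (Num.max lo (Num.min hi y)).
have GK x : p <= x <= q -> G (F x) = x.
  move=> xpq; have xin : x \in `[p, q] by rewrite in_itv.
  rewrite /G; have /andP[lF Fh] : lo <= F x <= hi.
    have : F x \in F @`[p, q].
      by apply/(continuous_inj_image_segmentP (ltW pq) cF injF); exists x.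
    by rewrite in_itv.
  by rewrite min_r// max_r// G0K.
exists G; split => //.
  exact: clamp_continuous.
move=> x xpq; apply: is_derive_inverse; last exact: F'0.
- have : x \in `]p, q[ by rewrite in_itv.
  move=> /near_in_itvoo; apply: filterS => y; rewrite in_itv /= => /andP[py yq].
  by apply: GK; rewrite !ltW.
- have : x \in `]p, q[ by rewrite in_itv.
  move=> /near_in_itvoo; apply: filterS => y; rewrite in_itv /= => /andP[py yq].
  by apply: derivable_continuous; case: (dF y); rewrite // !ltW.
- by apply: dF; case/andP: xpq => /ltW -> /ltW ->.
Qed.

(** Taking the first such point matters where [H] has a plateau at the level
    [th]: an arc that becomes sonic at that level is still strictly away from
    the sonic density before [x0]. *)
Lemma first_hit (H : R -> R) (a b th : R) : a < b -> continuous H ->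
  {homo H : x y / x <= y} -> H a <= th <= H b ->
  exists x0, [/\ a <= x0 <= b, H x0 = th & forall x, a <= x -> x < x0 -> H x < th].
Proof.
move=> ab cH monoH /andP[Hath thHb].
have cHab : {within `[a, b], continuous H} by exact: continuous_subspaceT.
pose A := `[a, b]%classic `&` H @^-1` [set th].
have cA : compact A.
  apply: (@subclosed_compact _ _ `[a, b]%classic); [|exact: segment_compact|by move=> x []].
  apply: closedI; first exact: interval_closed.
  by move/continuous_closedP : cH; apply; exact: closed_eq.
have [|z zab zth] := @IVT R H a b th (ltW ab) cHab.
  by rewrite min_l ?max_r ?Hath ?thHb//; apply: monoH; exact: ltW.
have A0 : A !=set0 by exists z; split.
have idc : {within A, continuous (@id R)} by apply: continuous_subspaceT => x; exact: cvg_id.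
have [x0 /set_mem[/= x0ab x0th] x0min] := compact_EVT_min A0 cA idc.
rewrite in_itv /= in x0ab.
exists x0; split => // x ax xx0; rewrite lt_neqAle -{2}x0th monoH ?andbT; last exact: ltW.
apply/eqP => Hx; have := x0min x; rewrite leNgt xx0 => H0.
have : false by apply: H0; apply/mem_set; split => //; rewrite /= in_itv /= ax; case/andP: x0ab => _; exact: (le_trans (ltW xx0)).
by [].
Qed.

End branches.

Section sufficiency.
Variable R : realType.
Variables (c w : R) (e F : R -> R).
Hypothesis c0 : 0 < c.
Hypothesis w0 : 0 < w.
Hypothesis e0 : forall r, 0 < r -> 0 < e r.
Hypothesis ce : forall r, 0 < r -> {for r, continuous e}.
Hypothesis dF : forall r : R, 0 < r -> is_derive r 1 F ((c ^+ 2 - w ^+ 2 / r ^+ 2) / e r).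
Hypothesis Fs : F (w / c) = 0.

Let s := w / c.
Let s0 : 0 < s. Proof. exact: divr_gt0. Qed.

(** A smooth arc with the value [h] of the regularization as parameter. It may
    become sonic at the final level [h1] only, where [g] need not be
    differentiable. *)
Definition arc (r0 r1 h0 h1 : R) (g : R -> R) :=
  [/\ continuous g, g h0 = r0, g h1 = r1 &
   forall h : R, h0 <= h <= h1 -> [/\ 0 < g h, F (g h) = F r0 - (h - h0) &
     h < h1 -> g h != s /\ derivable g h 1]].

Lemma arc_cst r h : 0 < r -> arc r r h h (fun=> r).
Proof.
move=> r0; split => //; first by move=> x; exact: cvg_cst.
move=> h'; rewrite -eq_le => /eqP <-; split => //; first by rewrite subrr subr0.
by rewrite ltxx.
Qed.

(** The segment on which [F] is inverted may extend beyond the arc: the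
    initial density has to be an inner point for [g] to be differentiable at
    [h0]. *)
Lemma arc_of_branch (r0 r1 h0 h1 p q : R) : 0 < p -> p < q ->
  p <= r0 <= q -> p <= r1 <= q -> {in `[p, q] &, injective F} ->
  (forall x, p < x < q -> x != s) -> h0 <= h1 -> F r0 - F r1 = h1 - h0 ->
  (forall h, h0 <= h <= h1 -> exists x, [/\ p <= x <= q, F x = F r0 - (h - h0) & h < h1 -> p < x < q]) ->
  exists g, arc r0 r1 h0 h1 g.
Proof.
move=> p0 pq r0pq r1pq injF xs h01 E sol.
have [|x xpq|G [cG GK dG]] := @inverse_branch R F (fun r => (c ^+ 2 - w ^+ 2 / r ^+ 2) / e r) p q pq _ _ injF.
- by move=> x /andP[px _]; apply: dF; exact: lt_le_trans px.
- have x0 : 0 < x by apply: (lt_trans p0); case/andP: xpq.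
  rewrite mulf_neq0 ?invr_neq0 ?(gt_eqF (e0 _))//.
  by apply: (slope_neq0 c0 w0) => //; exact: xs.
exists (fun h => G (F r0 - (h - h0))); split.
- move=> h; apply: (@continuous_comp _ _ _ (fun h => F r0 - (h - h0)) G); last exact: cG.
  by apply: cvgB; [exact: cvg_cst|apply: cvgB; [exact: cvg_id|exact: cvg_cst]].
- by rewrite subrr subr0 GK.
- by rewrite (_ : F r0 - (h1 - h0) = F r1); [exact: GK|lra].
- move=> h hh; have [x [xpq Fx hlt]] := sol _ hh.
  have x0 : 0 < x by apply: (lt_le_trans p0); case/andP: xpq.
  rewrite -Fx GK//; split => // /hlt xoo; split; first exact: xs.
  have d1 : is_derive h 1 (fun h => F r0 - (h - h0)) (-1).
    by apply: is_derive_eq; ring.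
  have := dG x xoo; rewrite Fx => d2.
  by have [] := @is_derive1_comp _ G (fun h => F r0 - (h - h0)) h _ _ d2 d1.
Qed.

(** Both densities lie on the same monotone branch of [F], because they are on
    the same side of [s]. A sonic initial density leaves no room for [F] to
    decrease, so that arc is a point. *)
Lemma arc_exists (r0 r1 h0 h1 : R) : 0 < r0 -> 0 < r1 -> 0 <= (s - r0) * (s - r1) ->
  h0 <= h1 -> F r0 - F r1 = h1 - h0 -> exists g, arc r0 r1 h0 h1 g.
Proof.
move=> r00 r10 side h01 E.
have decr := potential_decr c0 w0 e0 dF.
have incr := potential_incr c0 w0 e0 dF.
have [lt0|gt0|eq0] := ltgtP r0 s.
(* Supersonic branch, on which the density increases from [r0] to [r1]; the
   segment starts at [r0 / 2] to make [r0] an inner point. *)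
- have r1s : r1 <= s by rewrite leNgt; apply/negP => h; nra.
  have r01 : r0 <= r1.
    by rewrite leNgt; apply/negP => h; have := decr _ _ r10 h (ltW lt0); lra.
  have r02 : 0 < r0 / 2 by lra.
  have inj : {in `[r0 / 2, r1] &, injective F}.
    move=> x y; rewrite !in_itv /= => /andP[x1 x2] /andP[y1 y2] Fxy.
    have [xy|yx|//] := ltgtP x y.
      by have := decr x y (lt_le_trans r02 x1) xy (le_trans y2 r1s); rewrite Fxy ltxx.
    by have := decr y x (lt_le_trans r02 y1) yx (le_trans x2 r1s); rewrite Fxy ltxx.
  apply: (@arc_of_branch r0 r1 h0 h1 (r0 / 2) r1) => //; [lra|apply/andP; split; lra|apply/andP; split; lra| |].
    by move=> x /andP[_ xr1]; rewrite lt_eqF//; exact: lt_le_trans r1s.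
  move=> h /andP[hh0 hh1].
  have [|x] := @IVT R F r0 r1 (F r0 - (h - h0)) r01 (potential_within dF r00).
    by rewrite ge_min le_max; apply/andP; split; apply/orP; [right|left]; lra.
  rewrite in_itv /= => /andP[x1 x2] Fx; exists x; split => //; first by apply/andP; split; lra.
  move=> hlt; apply/andP; split; first lra.
  by rewrite lt_neqAle x2 andbT; apply/eqP => xr; move: Fx; rewrite xr; lra.
(* Subsonic branch, on which the density decreases from [r0] to [r1]; the
   segment is prolonged to [r0 + 1] for the same reason. *)
- have r1s : s <= r1 by rewrite leNgt; apply/negP => h; nra.
  have r01 : r1 <= r0.
    by rewrite leNgt; apply/negP => h; have := incr _ _ (ltW gt0) h; lra.
  have inj : {in `[r1, r0 + 1] &, injective F}.
    move=> x y; rewrite !in_itv /= => /andP[x1 x2] /andP[y1 y2] Fxy.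
    have [xy|yx|//] := ltgtP x y.
      by have := incr x y (le_trans r1s x1) xy; rewrite Fxy ltxx.
    by have := incr y x (le_trans r1s y1) yx; rewrite Fxy ltxx.
  apply: (@arc_of_branch r0 r1 h0 h1 r1 (r0 + 1)) => //; [lra|apply/andP; split; lra|apply/andP; split; lra| |].
    by move=> x /andP[xr1 _]; rewrite gt_eqF//; exact: le_lt_trans xr1.
  move=> h /andP[hh0 hh1].
  have [|x] := @IVT R F r1 r0 (F r0 - (h - h0)) r01 (potential_within dF r10).
    by rewrite ge_min le_max; apply/andP; split; apply/orP; [left|right]; lra.
  rewrite in_itv /= => /andP[x1 x2] Fx; exists x; split => //; first by apply/andP; split; lra.
  move=> hlt; apply/andP; split; last lra.
  by rewrite lt_neqAle x1 andbT; apply/eqP => xr; move: Fx; rewrite -xr; lra.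
- have r1s : r1 = s.
    apply: (potential_le0 c0 w0 e0 dF Fs r10); move: E; rewrite eq0 Fs; lra.
  have h01' : h0 = h1 by move: E; rewrite eq0 r1s !Fs; lra.
  by rewrite r1s -eq0 -h01'; exists (fun=> r0); exact: arc_cst.
Qed.

(** Differentiating [F (rho x) = K - H x] gives the equation; as its
    coefficient does not vanish off the sonic density, the equation in turn
    shows that the derivative of [rho] is continuous. *)
Lemma follow_ode (H rho g : R -> R) (l r K : R) :
  (forall x, l < x < r -> derivable H x 1 /\ {for x, continuous (derive1 H)}) ->
  (forall x, l < x < r -> [/\ rho x = g (H x), 0 < g (H x), F (g (H x)) = K - H x,
      g (H x) != s & derivable g (H x) 1]) ->
  forall x, l < x < r -> [/\ derivable rho x 1, {for x, continuous (derive1 rho)} &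
        (c ^+ 2 - w ^+ 2 / rho x ^+ 2) * derive1 rho x = - (e (rho x) * derive1 H x)].
Proof.
move=> HH HG.
have near_lr x (P : R -> Prop) : l < x < r -> (forall y, l < y < r -> P y) -> \forall y \near x, P y.
  move=> xlr HP; have : x \in `]l, r[ by rewrite in_itv.
  by move=> /near_in_itvoo; apply: filterS => y; rewrite in_itv /=; exact: HP.
have drho x : l < x < r -> derivable rho x 1.
  move=> xlr; have [_ _ _ _ dg] := HG x xlr; have [dHx _] := HH x xlr.
  have d1 : is_derive (H x) 1 g ('D_1 g (H x)) by exact: derivableP.
  have d2 : is_derive x 1 H ('D_1 H x) by exact: derivableP.
  have [d3 _] := @is_derive1_comp _ g H x _ _ d1 d2.
  apply: near_eq_derivable d3.
  by apply: near_lr xlr _ => y /HG[-> _ _ _ _].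
have ode x : l < x < r -> (c ^+ 2 - w ^+ 2 / rho x ^+ 2) * derive1 rho x = - (e (rho x) * derive1 H x).
  move=> xlr; have [rE g0 Fg gs dg] := HG x xlr; have [dHx _] := HH x xlr.
  have r0 : 0 < rho x by rewrite rE.
  have d1 : is_derive x 1 rho (derive1 rho x) by rewrite derive1E; apply: derivableP; exact: drho.
  have d2 := @is_derive1_comp _ F rho x _ _ (dF r0) d1.
  have dH : is_derive x 1 H (derive1 H x) by rewrite derive1E; exact: derivableP.
  have d3 := is_deriveB (is_derive_cst K x 1) dH.
  have d4 : is_derive x 1 (F \o rho) (0 - derive1 H x).
    apply: (near_eq_is_derive _ d3).
    by apply: near_lr xlr _ => y /HG[ryE _ Fy _ _]; rewrite /= ryE Fy.
  have : (c ^+ 2 - w ^+ 2 / rho x ^+ 2) / e (rho x) * derive1 rho x = 0 - derive1 H x.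
    by case: d2 => _ <-; case: d4 => _ <-.
  move=> E; have -> : derive1 H x = - ((c ^+ 2 - w ^+ 2 / rho x ^+ 2) / e (rho x) * derive1 rho x).
    by rewrite E sub0r opprK.
  field.
  by rewrite (gt_eqF (e0 r0)) (gt_eqF r0).
have slope x : l < x < r -> c ^+ 2 - w ^+ 2 / rho x ^+ 2 != 0.
  by move=> xlr; have [-> g0 _ gs _] := HG x xlr; exact: (slope_neq0 c0 w0).
move=> x xlr; split; [exact: drho| |exact: ode].
have E : \forall y \near x, - (e (rho y) * derive1 H y) / (c ^+ 2 - w ^+ 2 / rho y ^+ 2) = derive1 rho y.
  by apply: near_lr xlr _ => y ylr; rewrite -ode// mulrAC divff ?mul1r// slope.
have cr : {for x, continuous rho} by apply: derivable_continuous; exact: drho.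
have [rE g0 _ _ _] := HG x xlr; have r0 : 0 < rho x by rewrite rE.
have [_ cHx] := HH x xlr.
rewrite /prop_for /continuous_at -(nbhs_singleton E).
have cx : {for x, continuous (fun y => - (e (rho y) * derive1 H y) / (c ^+ 2 - w ^+ 2 / rho y ^+ 2))}.
  apply: cvgM.
    apply: cvgN; apply: cvgM; last exact: cHx.
    exact: (cvg_comp _ _ cr (ce r0)).
  apply: cvgV; first exact: slope.
  apply: cvgB; first exact: cvg_cst.
  apply: cvgM; first exact: cvg_cst.
  apply: cvgV; first by rewrite expf_neq0// gt_eqF.
  have c2 : {for x, continuous (fun z => rho z * rho z)} by apply: cvgM; exact: cr.
  exact: c2.
by apply: cvg_trans cx; exact: near_eq_cvg.
Qed.

(** The first arc is followed up to the first point [x1] where [H] equals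
    [th], the second one up to the first point [x2] where [H] equals [1];
    after [x2] the density is constant. The breakpoints are those two; before
    each of them the arc that is followed is away from the sonic density. *)
Lemma two_arcs_profile (a b : R) (H g1 g2 : R -> R) (r0 r1 r2 r3 th : R) : a < b ->
  continuous H -> C1_itv a b H -> {homo H : x y / x <= y} -> H a = 0 -> H b = 1 ->
  0 <= th <= 1 -> arc r0 r1 0 th g1 -> arc r2 r3 th 1 g2 -> admissible_jump c w r1 r2 ->
  exists rho t L Rr, [/\ wave_profile c w e a b H t rho L Rr, rho a = r0 & rho b = r3].
Proof.
move=> ab cH [dH cdH] monoH Ha Hb /andP[th0 th1] [cg1 g10 g1th P1] [cg2 g2th g21 P2] jmp.
have [|x1 [/andP[ax1 x1b] Hx1 lt1]] := @first_hit R H a b th ab cH monoH.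
  by rewrite Ha Hb th0.
have [|x2 [/andP[ax2 x2b] Hx2 lt2]] := @first_hit R H a b 1 ab cH monoH.
  by rewrite Ha Hb ler01 lexx.
have x12 : x1 <= x2.
  by rewrite leNgt; apply/negP => h; have := lt1 x2 ax2 h; lra.
(* The test [x <= a] matters when [x1 = a]: the jump then sits at the left
   end, where the value of the density is the outer state. *)
pose rho x := if (x < x1) || (x <= a) then g1 (H x) else g2 (H x).
pose L x := if x <= x1 then g1 (H x) else g2 (H x).
pose Rr x := if x < x1 then g1 (H x) else g2 (H x).
have H01 x : a <= x <= b -> 0 <= H x <= 1.
  by move=> /andP[ax xb]; rewrite -Ha -Hb !monoH.
have Hth x : x <= x1 -> H x <= th by rewrite -Hx1 => /monoH.
have thH x : x1 <= x -> th <= H x by rewrite -Hx1 => /monoH.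
have cgH (g : R -> R) : continuous g -> continuous (fun x => g (H x)).
  by move=> cg x; apply: (@continuous_comp _ _ _ H g); [exact: cH|exact: cg].
have g1pos x : a <= x <= b -> x <= x1 -> 0 < g1 (H x).
  by move=> /H01/andP[Hx0 _] /Hth Hxt; have [] := P1 (H x); first by rewrite Hx0.
have g2pos x : a <= x <= b -> x1 <= x -> 0 < g2 (H x).
  by move=> /H01/andP[_ Hx0] /thH Hxt; have [] := P2 (H x); first by rewrite Hxt.
have HH x : a < x < b -> derivable H x 1 /\ {for x, continuous (derive1 H)}.
  by move=> xab; split; [apply: dH|apply: cdH]; rewrite in_itv.
exists rho, [:: x1; x2], L, Rr; split; last 2 first.
- by rewrite /rho lexx orbT Ha.
- by rewrite /rho ltNge x1b /= leNgt ab /= Hb.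
split.
- move=> x xab; rewrite /rho; case: ifPn => [|].
    case/orP => [/ltW|xa]; first exact: g1pos.
    have -> : x = a by apply/eqP; rewrite eq_le xa; case/andP: xab.
    by apply: g1pos => //; rewrite lexx ltW.
  by rewrite negb_or -!leNgt -ltNge => /andP[x1x _]; exact: g2pos.
- move=> x /andP[ax xb]; have xab : a <= x <= b by rewrite ax ltW.
  rewrite /Rr; have [xx1|x1x] := ltP x x1.
    split; last by apply: g1pos => //; exact: ltW.
    apply: cvg_trans (continuous_cvgr (cgH _ cg1 x)).
    apply: near_eq_cvg; near=> y; rewrite /rho.
    by have -> : y < x1 by near: y; exact: nbhs_right_lt.
  split; last exact: g2pos.
  apply: cvg_trans (continuous_cvgr (cgH _ cg2 x)).
  apply: near_eq_cvg; near=> y; rewrite /rho.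
  have xy : x < y by near: y; exact: nbhs_right_gt.
  by rewrite ltNge (le_trans x1x (ltW xy)) /= leNgt (le_lt_trans ax xy).
- move=> x /andP[ax xb]; have xab : a <= x <= b by rewrite xb ltW.
  rewrite /L; have [xx1|x1x] := leP x x1.
    split; last exact: g1pos.
    apply: cvg_trans (continuous_cvgl (cgH _ cg1 x)).
    apply: near_eq_cvg; near=> y; rewrite /rho.
    by have -> : y < x1 by apply: lt_le_trans xx1; near: y; exact: nbhs_left_lt.
  split; last by apply: g2pos => //; exact: ltW.
  apply: cvg_trans (continuous_cvgl (cgH _ cg2 x)).
  apply: near_eq_cvg; near=> y; rewrite /rho.
  have x1y : x1 < y by near: y; exact: nbhs_left_gt.
  have ay : a < y by near: y; exact: nbhs_left_gt.
  by rewrite ltNge (ltW x1y) /= leNgt ay.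
- move=> x /andP[ax xb]; rewrite !inE negb_or => /andP[xx1 xx2].
  have [lt_x1|gt_x1|E] := ltgtP x x1; last by rewrite E eqxx in xx1.
    apply: (@follow_ode H rho g1 a x1 (F r0)) => //; last by rewrite ax.
      by move=> y /andP[ay yx1]; apply: HH; rewrite ay; exact: lt_le_trans x1b.
    move=> y /andP[ay yx1]; have yab : a <= y <= b by rewrite (ltW ay) (le_trans (ltW yx1)).
    have Hlt := lt1 y (ltW ay) yx1.
    have [|g10' Fg1 imp] := P1 (H y); first by case/andP: (H01 _ yab) => -> _; rewrite ltW.
    have [gs dg] := imp Hlt.
    by split => //; [rewrite /rho yx1|rewrite Fg1 subr0].
  have [lt_x2|gt_x2|E] := ltgtP x x2; last by rewrite E eqxx in xx2.
    apply: (@follow_ode H rho g2 x1 x2 (F r2 + th)) => //; last by rewrite gt_x1.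
      by move=> y /andP[x1y yx2]; apply: HH; rewrite (le_lt_trans ax1)// (lt_le_trans yx2).
    move=> y /andP[x1y yx2].
    have ay : a < y by exact: le_lt_trans x1y.
    have Hlt := lt2 y (ltW ay) yx2.
    have [|g20' Fg2 imp] := P2 (H y); first by rewrite thH ?ltW.
    have [gs dg] := imp Hlt.
    split => //; last by rewrite Fg2; ring.
    by rewrite /rho ltNge (ltW x1y) /= leNgt ay.
  have one y : x2 < y < b -> rho y = r3 /\ H y = 1.
    move=> /andP[x2y yb].
    have Hy : H y = 1.
      by apply/eqP; rewrite eq_le -{1}Hb -{1}Hx2 !monoH// ltW.
    split => //; rewrite /rho ltNge (le_trans x12 (ltW x2y)) /= leNgt (le_lt_trans ax2 x2y) /=.
    by rewrite Hy.
  have near_lr (P : R -> Prop) : (forall y, x2 < y < b -> P y) -> \forall y \near x, P y.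
    move=> HP; have : x \in `]x2, b[ by rewrite in_itv /= gt_x2.
    by move=> /near_in_itvoo; apply: filterS => y; rewrite in_itv /=; exact: HP.
  have drho0 y : x2 < y < b -> is_derive y 1 rho 0.
    move=> ylr; apply: (near_eq_is_derive _ (is_derive_cst r3 y 1)).
    have : y \in `]x2, b[ by rewrite in_itv.
    by move=> /near_in_itvoo; apply: filterS => z; rewrite in_itv /= => /one[-> _].
  have dH0 : derive1 H x = 0.
    have dH0 : is_derive x 1 H 0.
      apply: (near_eq_is_derive _ (is_derive_cst (1 : R) x 1)).
      by apply: near_lr => y /one[_ ->].
    by rewrite derive1E; case: dH0.
  have xlr : x2 < x < b by rewrite gt_x2.
  have drx := drho0 x xlr.
  split; first by case: drx.
    have E : \forall y \near x, (0 : R) = derive1 rho y.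
      by apply: near_lr => y /drho0 dy; rewrite derive1E; case: dy.
    rewrite /prop_for /continuous_at -(nbhs_singleton E).
    have cx : {for x, continuous (cst (0 : R) : R -> R)} by exact: cvg_cst.
    by apply: cvg_trans cx; exact: near_eq_cvg.
  rewrite dH0 mulr0 oppr0 derive1E; case: drx => _ ->.
  by rewrite mulr0.
- move=> x _; rewrite /L /Rr; have [xx1|x1x|->] := ltgtP x x1; [by left|by left|].
  by rewrite Hx1 g1th g2th.
- rewrite /rho /Rr lexx orbT; case: ltP => [_|x1a]; first by left.
  have E : x1 = a by apply/eqP; rewrite eq_le x1a.
  have tE : th = 0 by rewrite -Hx1 E.
  by rewrite Ha -[X in g1 X]tE -[X in g2 X]tE g1th g2th.
- rewrite /rho /L [b < x1]ltNge x1b /= [b <= a]leNgt ab /=; case: leP => [bx1|_]; last by left.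
  have E : x1 = b by apply/eqP; rewrite eq_le x1b.
  have tE : th = 1 by rewrite -Hx1 E.
  by rewrite Hb -[X in g1 X]tE -[X in g2 X]tE g1th g2th.
Unshelve. all: end_near. Qed.

(** A wave without jump is obtained from a trivial first arc, at the level
    [th = 0]. *)
Lemma connection_profile (a b : R) (H : R -> R) (rm rp : R) : a < b ->
  continuous H -> C1_itv a b H -> {homo H : x y / x <= y} -> H a = 0 -> H b = 1 ->
  0 < rm -> 0 < rp -> wave_connection c w F rm rp ->
  exists rho t L Rr, [/\ wave_profile c w e a b H t rho L Rr, rho a = rm & rho b = rp].
Proof.
move=> ab cH C1H monoH Ha Hb rm0 rp0 [[side E]|[rms srp [rho [th [/andP[rmr rs] th01 E1 E2]]]]].
  have [||g2 A2] := @arc_exists rm rp 0 1 rm0 rp0 _ ler01; [by rewrite mulrC|by rewrite subr0|].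
  apply: (@two_arcs_profile a b H _ g2 rm rm rm rp 0) => //; first by rewrite lexx ler01.
    exact: arc_cst.
  by left.
have r0 : 0 < rho by exact: lt_le_trans rmr.
have [th0 th1] := andP th01.
pose rho' := w ^+ 2 / (c ^+ 2 * rho).
have cs : c * s = w by rewrite /s mulrC divfK// gt_eqF.
have r'E : rho' * rho = s * s by rewrite /rho' -cs; field; rewrite !gt_eqF.
have r'0 : 0 < rho' by rewrite divr_gt0 ?mulr_gt0 ?exprn_gt0.
have r's : s < rho'.
  rewrite ltNge; apply/negP => h.
  have : rho' * rho < s * s.
    by rewrite (@le_lt_trans _ _ (s * rho))// ?ler_wpM2r ?ltr_pM2l// ltW.
  by rewrite r'E ltxx.
have [||g1 A1] := @arc_exists rm rho 0 th rm0 r0 _ th0; [|by rewrite subr0|].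
  by rewrite mulr_ge0// subr_ge0 ltW.
have [||g2 A2] := @arc_exists rho' rp th 1 r'0 rp0 _ th1; [|exact: E2|].
  by rewrite mulr_le0// subr_le0// ltW.
apply: (@two_arcs_profile a b H g1 g2 rm rho rho' rp th) => //.
right; split; first by rewrite (mulrC rho) r'E -cs; ring.
by rewrite mulr_gt0// subr_gt0 (lt_trans rs).
Qed.

End sufficiency.

(** * The germ and the theorem *)

Section germ_connection.
Variable R : realType.
Implicit Types (c v alpha : R) (D : R -> R -> R).

Lemma drag_continuous D alpha (r : R) : drag_force D -> 0 < r -> {for r, continuous (D^~ alpha)}.
Proof.
move=> dragD r0.
exact: (@drag_cvg R R (nbhs r) _ D id (cst alpha) r alpha dragD r0 cvg_id (cvg_cst alpha)).
Qed.

(** The alternatives of the germ for other signs of the relative momentum are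
    contradictory. *)
Lemma germ_pos c D v (rhom qm rhop qp : R) : 0 < c -> 0 < qm - v * rhom ->
  germ c D v ((rhom, qm), (rhop, qp)) <->
  [/\ 0 < rhom, 0 < rhop, qm - v * rhom = qp - v * rhop &
    wave_connection c (qm - v * rhom) (Ffun c D (qm - v * rhom)) rhom rhop].
Proof.
move=> c0; rewrite /germ /=; set alpha := qm - v * rhom => a0.
have cP r : (c * r < alpha) = (r < alpha / c) by rewrite ltr_pdivlMr// mulrC.
split=> [[m0 p0 E]|[m0 p0 E]].
  move=> [[a0' _ _]|[_ side F1]|[an _ _]|[[sup sub [r [th [rr tt F1 F2]]]]|[an _ _]]].
  - by move: a0; rewrite a0' ltxx.
  - by split => //; left.
  - by move: (lt_trans an a0); rewrite ltxx.
  - by split => //; right; split => //; [rewrite -cP|exists r, th].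
  - have : alpha < 0 by rewrite (lt_le_trans an)// oppr_le0 ltW// mulr_gt0.
    by rewrite ltNge ltW.
move=> [[side F1]|[sup sub [r [th [rr tt F1 F2]]]]]; split => //.
  by apply: Or42.
by apply: Or44; left; split => //; [rewrite cP|exists r, th].
Qed.

(** The two states are exchanged, as they are by reflection of the axis. *)
Lemma germ_neg c D v (rhom qm rhop qp : R) : 0 < c -> qm - v * rhom < 0 ->
  germ c D v ((rhom, qm), (rhop, qp)) <->
  [/\ 0 < rhom, 0 < rhop, qm - v * rhom = qp - v * rhop &
    wave_connection c (- (qm - v * rhom)) (Ffun c D (qm - v * rhom)) rhop rhom].
Proof.
move=> c0; rewrite /germ /=; set alpha := qm - v * rhom => a0.
have cP r : (alpha < - (c * r)) = (r < - alpha / c) by rewrite ltr_pdivlMr// mulrC ltrNr.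
rewrite (ltr0_norm a0).
split=> [[m0 p0 E]|[m0 p0 E]].
  move=> [[a0' _ _]|[an _ _]|[_ side F1]|[[an _ _]|[sup sub [r [th [rr tt F1 F2]]]]]].
  - by move: a0; rewrite a0' ltxx.
  - by move: (lt_trans an a0); rewrite ltxx.
  - by split => //; left; split => //; rewrite mulrC.
  - have : 0 < alpha by apply: lt_trans an; exact: mulr_gt0.
    by rewrite ltNge ltW.
  - split => //; right; split => //; first by rewrite -cP.
    by exists r, th; rewrite sqrrN.
move=> [[side F1]|[sup sub [r [th [rr tt F1 F2]]]]]; split => //.
  by apply: Or43; split => //; rewrite mulrC.
apply: Or44; right; split => //; first by rewrite cP.
by exists r, th; rewrite sqrrN in F2.
Qed.

Lemma Ffun_derive_pos c D alpha : 0 < c -> 0 < alpha -> drag_force D ->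
  forall r : R, 0 < r ->
  is_derive r 1 (Ffun c D alpha) ((c ^+ 2 - alpha ^+ 2 / r ^+ 2) / D r alpha).
Proof.
move=> c0 a0 dragD r r0; have := Ffun_derive c0 (lt0r_neq0 a0) dragD r0.
by rewrite gtr0_norm//; case: dragD => _ Dp _ _; exact: Dp.
Qed.

Lemma Ffun_derive_neg c D alpha : 0 < c -> alpha < 0 -> drag_force D ->
  forall r : R, 0 < r ->
  is_derive r 1 (Ffun c D alpha) ((c ^+ 2 - (- alpha) ^+ 2 / r ^+ 2) / (- D r alpha)).
Proof.
move=> c0 a0 dragD r r0; have := Ffun_derive c0 (ltr0_neq0 a0) dragD r0.
by rewrite ltr0_norm ?sqrrN//; case: dragD => _ _ Dn _; exact: Dn.
Qed.

Lemma constant_profile c D (a b r0 : R) (H : R -> R) : 0 < r0 -> drag_force D ->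
  wave_profile c 0 (D^~ 0) a b H [::] (fun=> r0) (fun=> r0) (fun=> r0).
Proof.
move=> r00 [_ _ _ D0]; split => //.
- by move=> x _; split => //; exact: cvg_cst.
- by move=> x _; split => //; exact: cvg_cst.
- move=> x _ _; have E : derive1 (fun=> r0) = (fun=> 0) :> (R -> R).
    by apply/funext => y; exact: derive1_cst.
  rewrite E; split; [exact: derivable_cst|exact: cvg_cst|].
  by rewrite D0// mul0r oppr0 mulr0.
- by move=> x _; left.
- by left.
- by left.
Qed.

(** At zero relative momentum no jump is admissible, and the differential
    equation reduces to [c ^+ 2 * derive1 rho x = 0]. *)
Lemma constant_of_profile c e (a b : R) (H : R -> R) s rho (L Rr : R -> R) : 0 < c -> a < b ->
  (forall r, 0 < r -> e r = 0) ->
  wave_profile c 0 e a b H s rho L Rr -> rho a = rho b.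
Proof.
move=> c0 ab e0 [rho0 rhoR rhoL ode jmp jmpa jmpb].
have jmp0 l r : admissible_jump c 0 l r -> l = r.
  by move=> [//|[_]]; rewrite mul0r ltxx.
rewrite (jmp0 _ _ jmpa) -(jmp0 _ _ jmpb).
have := @piecewise_FTC2 R s a b rho (fun=> 0) L Rr ab.
rewrite integral0 => H0; have : (0 : \bar R) = (L b - Rr a)%:E.
  apply: H0.
  - move=> x xab xs; split; last exact: cvg_cst.
    have [dr _ E] := ode x xab xs.
    have x0 : 0 < rho x by apply: rho0; case/andP: xab => /ltW -> /ltW ->.
    have d0 : derive1 rho x = 0.
      move: E; rewrite e0// mul0r oppr0 expr0n /= mul0r subr0 => /eqP.
      by rewrite mulf_eq0 expf_eq0 /= gt_eqF//= => /eqP.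
    by rewrite -d0 derive1E; exact: derivableP.
  - by move=> x xab; split; [exact: is_cvg_cst|case: (rhoR x xab)].
  - by move=> x xab; split; [exact: is_cvg_cst|case: (rhoL x xab)].
  - by move=> x xab; exact/jmp0/jmp.
by move=> [] /esym /eqP; rewrite subr_eq0 => /eqP.
Qed.

End germ_connection.

Theorem theorem2p7 (R : realType) (c : R) (D : R -> R -> R) (v : R)
    (rhom qm rhop qp : R) (c_gt0 : 0 < c) (dragD : drag_force D) :
  (germ c D v ((rhom, qm), (rhop, qp)) ->
    forall (eps : R) (H : R -> R), 0 < eps -> admissible_regularization eps H ->
    exists rho q : R -> R,
      [/\ entropy_wave c D v eps H rho q,
          (rho (- eps / 2), q (- eps / 2)) = (rhom, qm) &
          (rho (eps / 2), q (eps / 2)) = (rhop, qp)]) /\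
  (forall (eps : R) (H : R -> R), 0 < eps -> admissible_regularization eps H ->
    forall rho q : R -> R,
      entropy_wave c D v eps H rho q ->
      (rho (- eps / 2), q (- eps / 2)) = (rhom, qm) ->
      (rho (eps / 2), q (eps / 2)) = (rhop, qp) ->
    germ c D v ((rhom, qm), (rhop, qp))).
Proof.
have posD alpha r : 0 < alpha -> 0 < r -> 0 < D r alpha.
  by move=> a0 r0; case: dragD => _ Dp _ _; exact: Dp.
have negD alpha r : alpha < 0 -> 0 < r -> 0 < - D r alpha.
  by move=> a0 r0; case: dragD => _ _ Dn _; rewrite oppr_gt0 Dn.
have Nhalf (eps : R) : - (- eps / 2) = eps / 2 by rewrite mulNr opprK.
have halfN (eps : R) : - (eps / 2) = - eps / 2 by rewrite mulNr.
split.
- move=> g eps H eps0 adm.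
  have [m0 p0 E _] := g; rewrite /= in m0 p0 E.
  suff [rho [s [L [Rr [pf ra rb]]]]] : exists rho s L Rr,
      [/\ wave_profile c (qm - v * rhom) (D^~ (qm - v * rhom)) (- eps / 2) (eps / 2) H s rho L Rr,
          rho (- eps / 2) = rhom & rho (eps / 2) = rhop].
    exists rho, (fun x => (qm - v * rhom) + v * rho x); split.
    + exact: profile_entropy_wave pf.
    + by rewrite ra subrK.
    + by rewrite rb E subrK.
  have ab : - eps / 2 < eps / 2 by lra.
  have [cH C1H monoH H0 H1] := adm.
  have [an|ap|a0] := ltgtP (qm - v * rhom) 0.
  + have [_ _ _ conn] := (germ_neg D rhop qp c_gt0 an).1 g.
    have [cH' C1H' monoH' H0' H1'] := admissible_regularization_mirror adm.
    have w0 : 0 < - (qm - v * rhom) by rewrite oppr_gt0.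
    have cN r : 0 < r ->
        {for r, continuous (fun r => - D r (qm - v * rhom))}.
      by move=> r0; apply: cvgN; exact: drag_continuous.
    have := @connection_profile R c (- (qm - v * rhom)) (fun r => - D r (qm - v * rhom))
      (Ffun c D (qm - v * rhom)) c_gt0 w0 (fun r => negD _ r an)
      cN
      (Ffun_derive_neg c_gt0 an dragD) _ (- eps / 2) (eps / 2) _ rhop rhom ab
      cH' C1H' monoH' (H0' _ (lexx _)) (H1' _ (lexx _)) p0 m0 conn.
    rewrite -{1}(ltr0_norm an) Ffun_sonic => /(_ erefl)[rho [t [L [Rr [pf ra rb]]]]].
    have pf' := wave_profile_mirror C1H' pf.
    exists (fun x => rho (- x)), [seq - x | x <- t], (fun x => Rr (- x)), (fun x => L (- x)).
    split; [|by rewrite Nhalf|by rewrite halfN].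
    move: pf'; rewrite Nhalf halfN opprK.
    rewrite (_ : (fun r => - - D r _) = D^~ (qm - v * rhom)); last first.
      by apply/funext => r; rewrite opprK.
    rewrite (_ : (fun x => 1 - (1 - H (- - x))) = H)//.
    by apply/funext => x; rewrite opprK subKr.
  + have [_ _ _ conn] := (germ_pos D rhop qp c_gt0 ap).1 g.
    have := @connection_profile R c (qm - v * rhom) (D^~ (qm - v * rhom))
      (Ffun c D (qm - v * rhom)) c_gt0 ap (fun r => posD _ r ap)
      (fun r r0 => drag_continuous (alpha := qm - v * rhom) dragD r0)
      (Ffun_derive_pos c_gt0 ap dragD) _ (- eps / 2) (eps / 2) _ rhom rhop ab
      cH C1H monoH (H0 _ (lexx _)) (H1 _ (lexx _)) m0 p0 conn.
    by rewrite -{2}(gtr0_norm ap) Ffun_sonic; apply.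
  + have rE : rhom = rhop.
      have [_ _ _ []] := g; rewrite /= a0.
      * by case.
      * by case; rewrite ltxx.
      * by case; rewrite ltxx.
      * case=> -[].
          by rewrite ltNge ltW// mulr_gt0.
        by rewrite ltNge oppr_le0 ltW// mulr_gt0.
    exists (fun=> rhom), [::], (fun=> rhom), (fun=> rhom); split => //.
    by rewrite a0; exact: constant_profile.
- move=> eps H eps0 adm rho q ew [ram qam] [rbp qbp].
  have [alpha [s [L [Rr [pf qa qb]]]]] := entropy_wave_profile c_gt0 dragD eps0 adm ew.
  have ab : - eps / 2 < eps / 2 by lra.
  have aE : qm - v * rhom = alpha by rewrite -qam -ram qa addrK.
  have bE : qp - v * rhop = alpha by rewrite -qbp -rbp qb addrK.
  have m0 : 0 < rhom by rewrite -ram; apply: (profile_gt0 pf); rewrite lexx ltW.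
  have p0 : 0 < rhop by rewrite -rbp; apply: (profile_gt0 pf); rewrite lexx ltW.
  have [cH C1H monoH H0 H1] := adm.
  have [an|ap|a0] := ltgtP alpha 0.
  + apply/germ_neg => //; first by rewrite aE.
    rewrite aE bE; split => //.
    have [cH' [dH' _] monoH' H0' H1'] := admissible_regularization_mirror adm.
    have w0 : 0 < - alpha by rewrite oppr_gt0.
    have pf' := wave_profile_mirror C1H pf; rewrite Nhalf halfN in pf'.
    have Fs : Ffun c D alpha (- alpha / c) = 0 by rewrite -(ltr0_norm an) Ffun_sonic.
    have := profile_connection c_gt0 w0 (fun r => negD _ r an) (Ffun_derive_neg c_gt0 an dragD) Fs
      ab cH' _ monoH' (H0' _ (lexx _)) (H1' _ (lexx _)) pf'.
    rewrite /= Nhalf halfN rbp ram; apply.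
    by move=> x xab; apply: dH'; rewrite in_itv.
  + apply/germ_pos => //; first by rewrite aE.
    rewrite aE bE; split => //.
    have Fs : Ffun c D alpha (alpha / c) = 0 by rewrite -{2}(gtr0_norm ap) Ffun_sonic.
    have := profile_connection c_gt0 ap (fun r => posD _ r ap) (Ffun_derive_pos c_gt0 ap dragD) Fs
      ab cH _ monoH (H0 _ (lexx _)) (H1 _ (lexx _)) pf.
    rewrite ram rbp; apply.
    by case: C1H => dH _ x xab; apply: dH; rewrite in_itv.
  + have rE : rhom = rhop.
      rewrite a0 in pf; rewrite -ram -rbp.
      by apply: (constant_of_profile c_gt0 ab _ pf) => r r0; case: dragD => _ _ _; apply.
    split => //=; first by rewrite aE bE.
    apply: Or41; rewrite aE a0; split => //.
    by move: aE bE; rewrite rE => <- /addIr.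
Qed.
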